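(* Let $(X,J)$ be a killed Markov additive process with finite phase space $E$ (irreducible phase process, killing rate vector $\boldsymbol q\ne\boldsymbol 0$) and life time $\zeta$, and let $\hat{\mathbb P}$ denote the law of the dual (time-reversed) Markov additive process. Then for every non-negative measurable functional $F$ on path space and all $i,j\in E$, $$\pi_iq_i\,\mathbb E_i\big(\hat F_{\zeta-};\,J_{\zeta-}=j\big)=\pi_jq_j\,\hat{\mathbb E}_j\big(F_{\zeta-};\,J_{\zeta-}=i\big).$$
   Context: Killed Markov additive process (MAP). $E$ is a finite set of phases. $(X_t,J_t)_{t\ge 0}$ is càdlàg with values in $\mathbb R\times E$ up to its life time $\zeta:=\inf\{t\ge 0: J_t=\dagger\}$, after which it stays in the absorbing state $(\infty,\dagger)$, $\dagger\notin E$. For all $T\ge 0$, given $\{J_T=i\}$ with $i\in E$, the process $(X_{T+t}-X_T,J_{T+t})_{t\ge0}$ is independent of $(X_t,J_t)_{t\in[0,T]}$ and has the law of $(X,J)$ given $\{J_0=i\}$. Equivalently: $J$ is a (possibly transient) continuous-time Markov chain on $E$, assumed irreducible, killed (sent to $\dagger$) at rate $q_i$ in phase $i$; $X$ evolves as a Lévy process $X^i$ while $J=i$, and has an additional jump distributed as a random variable $U_{ij}$ when $J$ switches from $i$ to $j\neq i$; all these components are independent. $\mathbb P_i$ denotes the law with $X_0=0,\ J_0=i$. Standing assumption: the vector of killing rates $\boldsymbol q=(q_i)_{i\in E}$ is not the zero vector, so $\zeta<\infty$ a.s. Matrix exponent: $\Psi(\alpha)$ is the $|E|\times|E|$ matrix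 with $\big(\mathbb E_i(e^{\alpha X_t};J_t=j)\big)_{ij}=e^{\Psi(\alpha)t}$, $\alpha\in\mathrm i\mathbb R$, $t\ge0$; $\Psi(0)$ is the transition rate matrix of $J$ on $E$ and $\boldsymbol q=-\Psi(0)\boldsymbol 1$. $\Delta_{\boldsymbol v}$ is the diagonal matrix with $\boldsymbol v$ on the diagonal. Dual process: $\boldsymbol\pi$ is the probability (row) vector with $\boldsymbol\pi(\Psi(0)+\Delta_{\boldsymbol q})=\boldsymbol 0$. $\hat{\mathbb P}$ is the law of the MAP with matrix exponent $\hat\Psi(\alpha)=\Delta_{\boldsymbol\pi}^{-1}\Psi(\alpha)^T\Delta_{\boldsymbol\pi}$ (it has the same killing rates $\boldsymbol q$). Killing and reversal at $\zeta$: for a path $\omega=(X,J)$ let $k_{\zeta}(\omega)_t=(X_t,J_t)$ for $t<\zeta$ and $(\infty,\dagger)$ for $t\ge\zeta$; let $r_{\zeta-}(\omega)_t=(X_{\zeta-}-X_{(\zeta-t)-},\,J_{(\zeta-t)-})$ for $t<\zeta$ and $(\infty,\dagger)$ for $t\ge\zeta$. Then $F_{\zeta-}:=F\circ k_\zeta=F$ and $\hat F_{\zeta-}:=F\circ r_{\zeta-}$. Paths are càdlàg, with the Skorokhod topology. *)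

(* Defs.v *)
From HB Require Import structures.
From mathcomp Require Import all_boot all_order all_algebra.
From mathcomp Require Import all_classical all_reals all_analysis.
From mathcomp Require Import measurable_realfun complex.
From mathcomp Require Import lra.

Set Implicit Arguments.
Unset Strict Implicit.
Unset Printing Implicit Defensive.
Import Order.TTheory GRing.Theory Num.Theory.
Import numFieldNormedType.Exports.
Local Open Scope classical_set_scope.
Local Open Scope ring_scope.

Section PathSpace.
Context {R : realType} {n : nat}.

(* The phase space is E = 'I_n.  [Some (x, i)] is the state (x, i) in R * E and
   [None] is the cemetery state (oo, dagger), an isolated point. *)
Definition state := option (R * 'I_n).

Definition close (e : R) (s s' : state) : Prop :=
  match s, s' with
  | Some (x, i), Some (y, j) => `|x - y| < e /\ i = j
  | None, None => True
  | _, _ => False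
  end.

Definition is_left_limit (f : R -> state) (t : R) (l : state) : Prop :=
  forall e, 0 < e -> \forall s \near t^'-, close e l (f s).

(* f_{t-}; a junk value where the left limit does not exist. *)
Definition left_limit (f : R -> state) (t : R) : state :=
  xget None [set l | is_left_limit f t l].

(* The time set is [0, oo[; values at negative times carry no information and
   are normalized to [None]. *)
Record is_cadlag_path (f : R -> state) : Prop := IsCadlagPath {
  cadlag_neg : forall t, t < 0 -> f t = None;
  cadlag_right : forall t, 0 <= t ->
    forall e, 0 < e -> \forall s \near t^'+, close e (f t) (f s);
  cadlag_left : forall t, 0 < t -> exists l, is_left_limit f t l;
  cadlag_absorbed : forall s t, 0 <= s -> s <= t -> f s = None -> f t = None
}.

Record cadlag_path := CadlagPath {
  path_fun :> R -> state;
  path_cadlag : is_cadlag_path path_fun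
}.

Lemma near_leftP (t : R) (Q : R -> Prop) :
  (\forall s \near t^'-, Q s) <->
  exists2 d, 0 < d & forall s, t - d < s -> s < t -> Q s.
Proof.
split.
  move=> /nbhs_ballP[d /= d0 H]; exists d => // s s1 s2.
  by apply: H => //=; rewrite /ball /= ltr_norml; apply/andP; split; lra.
move=> [d d0 H]; apply/nbhs_ballP; exists d => //= s.
by rewrite /ball /= ltr_norml => /andP[s1 s2] s3; apply: H => //; lra.
Qed.

Lemma near_rightP (t : R) (Q : R -> Prop) :
  (\forall s \near t^'+, Q s) <->
  exists2 d, 0 < d & forall s, t < s -> s < t + d -> Q s.
Proof.
split.
  move=> /nbhs_ballP[d /= d0 H]; exists d => // s s1 s2.
  by apply: H => //=; rewrite /ball /= ltr_norml; apply/andP; split; lra.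
move=> [d d0 H]; apply/nbhs_ballP; exists d => //= s.
by rewrite /ball /= ltr_norml => /andP[s1 s2] s3; apply: H => //; lra.
Qed.

Lemma close_refl e s : 0 < e -> close e s s.
Proof. by case: s => [[x i]|] //= e0; rewrite subrr normr0. Qed.

Lemma close_sym e s s' : close e s s' -> close e s' s.
Proof.
by case: s s' => [[x i]|] [[y j]|] //= [H ->]; rewrite distrC.
Qed.

Lemma close_trans e s1 s2 s3 :
  close (e / 2) s1 s2 -> close (e / 2) s2 s3 -> close e s1 s3.
Proof.
case: s1 s2 s3 => [[x i]|] [[y j]|] [[z k]|] //= [h1 ->] [h2 ->]; split => //.
by rewrite -(subrKA y) (le_lt_trans (ler_normD _ _))// [e]splitr ltrD.
Qed.

Lemma dead_is_cadlag : is_cadlag_path (fun=> None).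
Proof.
split => //.
- by move=> t _ e _; apply/near_rightP; exists 1.
- by move=> t _; exists None => e _; apply/near_leftP; exists 1.
Qed.

Definition dead_path : cadlag_path := CadlagPath dead_is_cadlag.

HB.instance Definition _ := gen_eqMixin cadlag_path.
HB.instance Definition _ := gen_choiceMixin cadlag_path.
HB.instance Definition _ := isPointed.Build cadlag_path dead_path.

(* X_t and J_t, with [None] for J_t = dagger.  The value 0 of [level w t] after the
   life time is junk standing for oo. *)
Definition level (w : cadlag_path) (t : R) : R :=
  if w t is Some (x, _) then x else 0.
Definition phase (w : cadlag_path) (t : R) : option 'I_n :=
  if w t is Some (_, i) then Some i else None.

Definition lifetime (w : cadlag_path) : \bar R :=
  ereal_inf [set t%:E | t in [set t : R | 0 <= t /\ phase w t = None]].

(* The event {J_{zeta-} = j}, which is meant to include zeta < oo. *)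
Definition J_before_death (j : 'I_n) : set cadlag_path :=
  [set w | if lifetime w is z%:E
           then exists x, left_limit w z = Some (x, j) else False].

(* Strictly increasing bijections of [0, oo[. *)
Definition time_change (lam : R -> R) : Prop :=
  [/\ forall s, 0 <= s -> 0 <= lam s,
      forall s t, 0 <= s -> s < t -> lam s < lam t &
      forall t, 0 <= t -> exists2 s, 0 <= s & lam s = t].

(* Skorokhod's J1 topology on paths indexed by [0, oo[:
   w_k --> w iff w_k is eventually in each [skorokhod_nbhs w N e]: there are time
   changes lam_k with sup_s |lam_k s - s| --> 0 and, for every N,
   sup_(s <= N) d (w s) (w_k (lam_k s)) --> 0 (Jacod-Shiryaev, VI.1.14). *)
Definition skorokhod_nbhs (w : cadlag_path) (N e : R) : set cadlag_path :=
  [set w' | exists lam, [/\ time_change lam,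
      forall s, 0 <= s -> `|lam s - s| < e &
      forall s, 0 <= s -> s <= N -> close e (w s) (w' (lam s))]].

Definition skorokhod_open : set (set cadlag_path) :=
  [set U | forall w, U w -> exists N e : R,
      0 < e /\ skorokhod_nbhs w N e `<=` U].

End PathSpace.

Arguments state : clear implicits.
Arguments cadlag_path : clear implicits.

(* Borel sigma-algebra of the Skorokhod topology. *)
Notation path_space R n := (g_sigma_algebraType (@skorokhod_open R n)).

Section Transformations.
Context {R : realType} {n : nat}.
Implicit Types w : cadlag_path R n.

Definition shift_state (x : R) (s : state R n) : state R n :=
  if s is Some (y, i) then Some (y - x, i) else None.

(* (X_{T+t} - X_T, J_{T+t})_t; the dead path if J_T = dagger. *)
Definition shift_fun (w : cadlag_path R n) (T t : R) : state R n :=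
  if t < 0 then None else
  if w T is Some (x, _) then shift_state x (w (T + t)) else None.

Lemma close_shift_state e x (s s' : state R n) :
  close e s s' -> close e (shift_state x s) (shift_state x s').
Proof.
case: s s' => [[y i]|] [[z j]|] //= [H ->]; split => //.
by rewrite (_ : _ - _ = y - z) //; lra.
Qed.

Lemma shift_is_cadlag w T : is_cadlag_path (shift_fun w T).
Proof.
have [wneg wr wl wa] := path_cadlag w.
rewrite /shift_fun; have [T0|T0] := ltP T 0.
  rewrite wneg//; have -> : (fun t : R => if t < 0 then None else None) =
    (fun=> None : state R n) by apply/funext => t; case: ifP.
  exact: dead_is_cadlag.
case: (w T) => [[x k]|]; last first.
  have -> : (fun t : R => if t < 0 then None else None) =
    (fun=> None : state R n) by apply/funext => t; case: ifP.
  exact: dead_is_cadlag.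
split.
- by move=> t ->.
- move=> t t0 e e0; have /near_rightP[d d0 H] := wr (T + t) (addr_ge0 T0 t0) e e0.
  apply/near_rightP; exists d => // s s1 s2.
  rewrite !ifF; [|by apply/negbTE; rewrite -leNgt; lra..].
  by apply/close_shift_state/H; lra.
- move=> t t0; have [|l lP] := wl (T + t); first by lra.
  exists (shift_state x l) => e e0.
  have /near_leftP[d d0 H] := lP e e0.
  apply/near_leftP; exists (Num.min d t); first by rewrite lt_min d0.
  move=> s s1 s2; have [? ?] : Num.min d t <= d /\ Num.min d t <= t.
    by rewrite !ge_min !lexx orbT.
  rewrite ifF; last by apply/negbTE; rewrite -leNgt; lra.
  by apply/close_shift_state/H; lra.
- move=> s t s0 st; rewrite !ifF; [|by apply/negbTE; rewrite -leNgt; lra..].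
  case E : (w (T + s)) => [[]|] // _.
  by rewrite (wa (T + s) (T + t)) //; lra.
Qed.

Definition shift_path (T : R) (w : cadlag_path R n) : cadlag_path R n :=
  CadlagPath (shift_is_cadlag w T).

Definition kill_fun (w : cadlag_path R n) (t : R) : state R n :=
  if (t%:E < lifetime w)%E then w t else None.

Lemma alive_before w t : 0 <= t -> (t%:E < lifetime w)%E -> w t <> None.
Proof.
move=> t0 tz wt; move: tz; rewrite ltNge => /negP; apply.
apply: ereal_inf_lbound; exists t => //=; split => //.
by rewrite /phase wt.
Qed.

Lemma dead_after w t : (lifetime w <= t%:E)%E -> w t = None.
Proof.
move=> zt; have [wneg wr wl wa] := path_cadlag w.
have [/wneg//|t0] := ltP t 0.
case wt : (w t) => [[x i]|] //.
have /near_rightP[d d0 H] := wr t t0 1 ltr01.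
have : (lifetime w < (t + d)%:E)%E.
  by apply: (le_lt_trans zt); rewrite lte_fin; lra.
move=> /ereal_inf_lt[_ [s [s0 Js] <-]]; rewrite lte_fin => std.
have ws : w s = None by move: Js; rewrite /phase; case: (w s) => [[]|].
have [st|ts] := leP s t; first by rewrite (wa s t) in wt.
by have := H s ts std; rewrite wt ws.
Qed.

Lemma kill_is_cadlag w : is_cadlag_path (kill_fun w).
Proof.
have -> : kill_fun w = w; last exact: path_cadlag.
apply/funext => t; rewrite /kill_fun; case: ltP => // /dead_after ->//.
Qed.

Definition kill_path (w : cadlag_path R n) : cadlag_path R n :=
  CadlagPath (kill_is_cadlag w).

Definition flip_state (x : R) (s : state R n) : state R n :=
  if s is Some (y, i) then Some (x - y, i) else None.

(* (X_{z-} - X_{(z-t)-}, J_{(z-t)-}) for t < z, where z is the life time.  If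
   z = oo the reversal is undefined and the dead path is returned. *)
Definition reverse_fun (w : cadlag_path R n) (t : R) : state R n :=
  if lifetime w is z%:E then
    if (0 <= t) && (t < z) then
      if left_limit w z is Some (x, _)
      then flip_state x (left_limit w (z - t)) else None
    else None
  else None.

Lemma close_flip_state e x (s s' : state R n) :
  close e s s' -> close e (flip_state x s) (flip_state x s').
Proof.
case: s s' => [[y i]|] [[z j]|] //= [H ->]; split => //.
by rewrite distrC (_ : _ - _ = y - z) //; lra.
Qed.

Lemma left_limitP w t : 0 < t -> is_left_limit w t (left_limit w t).
Proof.
move=> t0; have [_ _ /(_ t t0)[l lP] _] := path_cadlag w.
by rewrite /left_limit; case: xgetP => [s _ //|/(_ l)]; case.
Qed.

Lemma left_limit_near_left w u e : 0 < u -> 0 < e ->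
  exists2 d, 0 < d & forall v, u - d < v -> v < u -> 0 < v ->
    close e (left_limit w u) (left_limit w v).
Proof.
move=> u0 e0; have e20 : 0 < e / 2 by lra.
have /near_leftP[d d0 H] := left_limitP w u0 e20.
exists d => // v v1 v2 v0.
have /near_leftP[d' d'0 H'] := left_limitP w v0 e20.
set m := Num.max (u - d) (v - d').
have mv : m < v by rewrite gt_max v1 /=; lra.
have [m1 m2] : u - d <= m /\ v - d' <= m by rewrite !le_max !lexx orbT.
apply: (@close_trans _ _ _ _ (w ((m + v) / 2))); first by apply: H; lra.
by apply: close_sym; apply: H'; lra.
Qed.

Lemma left_limit_near_right w u e : 0 <= u -> 0 < e ->
  exists2 d, 0 < d & forall v, u < v -> v < u + d ->
    close e (w u) (left_limit w v).
Proof.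
move=> u0 e0; have e20 : 0 < e / 2 by lra.
have /near_rightP[d d0 H] := cadlag_right (path_cadlag w) u0 e20.
exists d => // v v1 v2; have v0 : 0 < v by lra.
have /near_leftP[d' d'0 H'] := left_limitP w v0 e20.
set m := Num.max u (v - d').
have mv : m < v by rewrite gt_max v1 /=; lra.
have [m1 m2] : u <= m /\ v - d' <= m by rewrite !le_max !lexx orbT.
apply: (@close_trans _ _ _ _ (w ((m + v) / 2))); first by apply: H; lra.
by apply: close_sym; apply: H'; lra.
Qed.

Lemma reverse_is_cadlag w : is_cadlag_path (reverse_fun w).
Proof.
rewrite /reverse_fun; case Ez : (lifetime w) => [z||];
  [|exact: dead_is_cadlag..].
case: (left_limit w z) => [[x k]|]; last first.
  have -> : (fun t : R => if (0 <= t) && (t < z) then None else None) =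
    (fun=> None : state R n) by apply/funext => t; case: ifP.
  exact: dead_is_cadlag.
split.
- by move=> t t0; rewrite leNgt t0.
- move=> t t0 e e0; apply/near_rightP; have [tz|zt] := ltP t z; last first.
    exists 1 => // s s1 s2; rewrite andbF (_ : s < z = false) ?andbF//.
    by apply/negbTE; rewrite -leNgt; lra.
  have zt0 : 0 < z - t by lra.
  have [d d0 H] := left_limit_near_left w zt0 e0.
  exists (Num.min d (z - t)); first by rewrite lt_min d0.
  move=> s s1 s2; have [? ?] : Num.min d (z - t) <= d /\
    Num.min d (z - t) <= z - t by rewrite !ge_min !lexx orbT.
  have -> : 0 <= s by lra.
  have -> : s < z by lra.
  by rewrite t0 /=; apply/close_flip_state/H; lra.
- move=> t t0; have [tz|zt] := leP t z; last first.
    exists None => e e0; apply/near_leftP; exists (t - z); first by lra.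
    move=> s s1 s2; rewrite (_ : s < z = false) ?andbF//.
    by apply/negbTE; rewrite -leNgt; lra.
  have zt0 : 0 <= z - t by lra.
  exists (flip_state x (w (z - t))) => e e0.
  have [d d0 H] := left_limit_near_right w zt0 e0.
  apply/near_leftP; exists (Num.min d t); first by rewrite lt_min d0.
  move=> s s1 s2; have [? ?] : Num.min d t <= d /\ Num.min d t <= t.
    by rewrite !ge_min !lexx orbT.
  have -> : 0 <= s by lra.
  have -> : s < z by lra.
  by apply/close_flip_state/H; lra.
- move=> s t s0 st; rewrite s0 (le_trans s0 st) /=.
  have [tz|//] := ltP t z.
  have sz : s < z by lra.
  rewrite sz; have zs0 : 0 < z - s by lra.
  have /near_leftP[d d0 H] := left_limitP w zs0 ltr01.
  case E : (left_limit w (z - s)) => [[]|] // _.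
  set m := Num.max 0 (z - s - d).
  have mz : m < z - s by rewrite gt_max zs0 /=; lra.
  have [m1 m2] : 0 <= m /\ z - s - d <= m by rewrite !le_max !lexx orbT.
  have : close 1 None (w ((m + (z - s)) / 2)) by rewrite -E; apply: H; lra.
  case E' : (w _) => [//|] _; exfalso; move: E'; apply: alive_before; first lra.
  by rewrite Ez lte_fin; lra.
Qed.

Definition reverse_path (w : cadlag_path R n) : cadlag_path R n :=
  CadlagPath (reverse_is_cadlag w).

End Transformations.

Section MAP.
Context {R : realType} {n : nat}.
Local Open Scope complex_scope.

(* sigma((X_t, J_t), 0 <= t <= T) *)
Definition past (T : R) : set (set (cadlag_path R n)) :=
  <<s [set A | exists (t : R) (B : set R) (j : 'I_n),
        [/\ 0 <= t <= T, measurable B &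
            A = [set w : cadlag_path R n | exists2 x, B x & w t = Some (x, j)]]] >>.

(* P i is the law of (X, J) given X_0 = 0 and J_0 = i. *)
Record is_MAP (P : 'I_n -> probability (path_space R n) R) : Prop := IsMAP {
  MAP_start : forall i, P i [set w : cadlag_path R n | w 0 = Some (0, i)] = 1%E;
  MAP_markov : forall (i : 'I_n) (T : R) (j : 'I_n)
      (A : set (cadlag_path R n)) (B : set (path_space R n)),
    0 <= T -> past T A -> measurable B ->
    (P i ((A `&` [set w | phase w T = Some j]) `&` (shift_path T @^-1` B)) =
     P i (A `&` [set w | phase w T = Some j]) * P j B)%E
}.

Definition irreducible_phase (P : 'I_n -> probability (path_space R n) R) :=
  forall i j, exists2 t : R, 0 <= t & (0 < P i [set w | phase w t = Some j])%E.

Definition cexp (z : R[i]) : R[i] :=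
  (expR (complex.Re z))%:C * (cos (complex.Im z) +i* sin (complex.Im z)).

Definition cintegral (mu : {measure set (path_space R n) -> \bar R})
    (D : set (path_space R n)) (f : path_space R n -> R[i]) : R[i] :=
  (\int[mu]_(w in D) complex.Re (f w)) +i* (\int[mu]_(w in D) complex.Im (f w)).

Definition expmx_partial (M : 'M[R[i]]_n) (N : nat) : 'M[R[i]]_n :=
  \sum_(k < N) (k`!%:R)^-1 *: M ^+ k.

Definition expmx (M : 'M[R[i]]_n) : 'M[R[i]]_n := \matrix_(i, j)
  (limn (fun N => complex.Re (expmx_partial M N i j)) +i*
   limn (fun N => complex.Im (expmx_partial M N i j))).

Definition is_matrix_exponent (P : 'I_n -> probability (path_space R n) R)
    (Psi : R[i] -> 'M[R[i]]_n) : Prop :=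
  forall (alpha : R[i]) (t : R) (i j : 'I_n),
    complex.Re alpha = 0 -> 0 <= t ->
    cintegral (P i) [set w | phase w t = Some j]
      (fun w => cexp (alpha * (level w t)%:C)) =
    expmx (t%:C *: Psi alpha) i j.

(* q = - Psi(0) 1 *)
Definition killing_rates (Psi : R[i] -> 'M[R[i]]_n) (q : 'cV[R]_n) : Prop :=
  map_mx (real_complex R) q = - (Psi 0 *m const_mx 1).

Definition is_probability_vector (pi : 'rV[R]_n) : Prop :=
  (forall i, 0 <= pi 0 i) /\ \sum_i pi 0 i = 1.

Definition is_stationary (Psi : R[i] -> 'M[R[i]]_n) (q : 'cV[R]_n)
    (pi : 'rV[R]_n) : Prop :=
  is_probability_vector pi /\
  map_mx (real_complex R) pi *m
    (Psi 0 + diag_mx (map_mx (real_complex R) q)^T) = 0.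

Definition dual_exponent (pi : 'rV[R]_n) (Psi : R[i] -> 'M[R[i]]_n)
    (alpha : R[i]) : 'M[R[i]]_n :=
  let D := diag_mx (map_mx (real_complex R) pi) in
  invmx D *m (Psi alpha)^T *m D.

End MAP.

(* Main.v *)
(** Let [T] be the last point of the grid of mesh [h] before the life time. By the Markov
    property, the probability that the path sampled at finitely many times up to [T] has
    prescribed phases and increments, and then dies in ]T, T + h], is a product of kernels
    Q_t(i, j, dx) = P_i(X_t in dx, J_t = j) and of P_j(zeta <= h). The matrix exponents and
    the uniqueness of characteristic functions give
      pi_i Q_t(i, j, .) = pi_j Qhat_t(j, i, .),
    so that reversing the chain of kernels yields, exactly for each grid,
      pi_i Phat_i(zeta <= h) P_i(event of the path flipped at T, J_T = j)
        = pi_j P_j(zeta <= h) Phat_j(same event of the path, J_T = i).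
    After division by [h], P_j(zeta <= h) / h --> q_j. As h --> 0 the path flipped at [T]
    converges pointwise to the reversal at zeta-, hence the limit identity is an inequality
    for open increment sets and the opposite one for closed sets; open rays are exhausted by
    closed rays. A pi-lambda argument passes from increments to positions, and the Borel
    sigma-algebra of the Skorokhod topology is the one of the cylinders. *)

From Pilot Require Import Defs.
From HB Require Import structures.
From mathcomp Require Import all_boot all_order all_algebra.
From mathcomp Require Import all_classical all_reals all_analysis.
From mathcomp Require Import measurable_realfun complex.
From mathcomp Require Import ring lra.
Set Implicit Arguments.
Unset Strict Implicit.
Unset Printing Implicit Defensive.
Import Order.TTheory GRing.Theory Num.Theory.
Import numFieldNormedType.Exports.
Local Open Scope classical_set_scope.
Local Open Scope ring_scope.

(* MathComp-Analysis has another [close]. *)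
Local Notation close := Pilot.Defs.close.

(** * Evaluations are Borel measurable *)

(** Death leaves a factor at the last phase of a chain of kernels: the chain of P ends in j, that of
    Phat in i. Putting the factor of the opposite chain on each side balances the grid identity
    without a division, so it passes to the limit even when q_i or q_j vanishes. Irreducibility
    gives pi_i > 0, hence an invertible diagonal matrix in the dual exponent. Increments rather than
    positions are followed because a flipped path is measured from its level at T: a step run
    backwards keeps the same set of increments. The obstacle is the limit. The flipped path
    converges at every time, jump times included, since T - u tends to zeta - u from strictly below;
    but the laws of the increments may have atoms, so a limit increment may sit on the boundary of
    its set. The dual side has no such defect: its increments do not depend on the grid, so its
    probabilities converge for arbitrary increment sets and provide the common limit. *)

Definition slevel (R : realType) n (s : state R n) : R :=
  if s is Some (x, _) then x else 0.
Definition sphase (R : realType) n (s : state R n) : option 'I_n :=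
  if s is Some (_, i) then Some i else None.

Lemma state_eta (R : realType) n (s : state R n) k :
  sphase s = Some k -> s = Some (slevel s, k).
Proof. by case: s => [[x i]|] //= [->]. Qed.

Lemma cadlag_path_eq (R : realType) n (w w' : cadlag_path R n) :
  path_fun w = path_fun w' -> w = w'.
Proof.
case: w w' => [f Hf] [g Hg] /= E; move: Hf; rewrite E => Hf.
by rewrite (Prop_irrelevance Hf Hg).
Qed.

Definition grid_step (R : realType) (N : nat) : R := N.+1%:R^-1.

Lemma grid_step_gt0 (R : realType) N : 0 < grid_step R N.
Proof. by rewrite /grid_step invr_gt0. Qed.

Lemma near_grid_step (R : realType) (e : R) : 0 < e ->
  \forall N \near \oo, grid_step R N < e.
Proof.
by move=> e0; have := @near_infty_natSinv_lt R (PosNum e0).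
Qed.

Section MeasurableStates.
Context {R : realType} {n : nat} {d : measure_display} {T : measurableType d}.

(** The rays from -N upwards exhaust the event of being in phase [k]; on that event the closed rays
    generate the Borel sets of the level. *)
Lemma measurable_state (G : T -> state R n) :
  (forall (a : R) (k : 'I_n), measurable [set w | exists2 x, a <= x & G w = Some (x, k)]) ->
  forall (B : set R) (k : 'I_n), measurable B ->
    measurable [set w | exists2 x, B x & G w = Some (x, k)].
Proof.
move=> mG B k mB.
have mD : measurable [set w | sphase (G w) = Some k].
  rewrite [X in _ X](_ : _ = \bigcup_N [set w : T | exists2 x, - N%:R <= x & G w = Some (x, k)]).
    by apply: bigcupT_measurable => N; exact: mG.
  apply/seteqP; split => w /=.
    case E : (G w) => [[x l]|] //= [kj].
    exists (Num.bound x) => //=; exists x; last by rewrite ?E kj.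
    by rewrite lerNl ltW// unstable.ltrNbound.
  by move=> [N _ /= [x _ ->]].
have mL : measurable_fun [set w | sphase (G w) = Some k] (fun w => slevel (G w)).
  apply: (measurability _ (RGenCInfty.measurableE R)) => _ [_ [a ->] <-].
  rewrite [X in _ X](_ : _ = [set w : T | exists2 x, a <= x & G w = Some (x, k)]).
    exact: mG.
  apply/seteqP; split => w /=.
    case: (G w) => [[x l]|] [] //= [->].
    by rewrite in_itv /= andbT => ax; exists x.
  by move=> [x ax ->]; rewrite /= in_itv /= andbT.
rewrite [X in _ X](_ : _ = [set w : T | sphase (G w) = Some k] `&`
    (fun w => slevel (G w)) @^-1` B); first exact: mL.
apply/seteqP; split => w /=.
  by move=> [x Bx ->].
by case: (G w) => [[x l]|] [] //= [->] Bx; exists x.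
Qed.

End MeasurableStates.

Section Evaluation.
Context {R : realType} {n : nat}.
Implicit Types (w : cadlag_path R n) (t : R) (j : 'I_n).

(* Evaluations are not continuous for the Skorokhod topology, but events of this kind
   are open, and right-continuity recovers the value at [t] from those on ]t, t + h[. *)
Lemma exceed_open (a b c : R) j :
  skorokhod_open [set w : cadlag_path R n |
    exists s x, [/\ a < s < b, 0 <= s, w s = Some (x, j) & c < x]].
Proof.
move=> w /= [s [x [/andP[as_ sb] s0 ws cx]]].
(* The margin x - c keeps the level above [c]; the other two keep the changed time inside ]a, b[. *)
exists s, (Num.min (x - c) (Num.min (s - a) (b - s))).
split; first by rewrite !lt_min !subr_gt0 cx as_ sb.
move=> w' [lam [[lam0 _ _] lams /(_ s s0 (lexx _))]].
rewrite ws; have := lams s s0; rewrite !lt_min => /and3P[_ h1 h2].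
case E : (w' (lam s)) => [[y k]|] //= [h3 jk].
exists (lam s), y; split; last 1 first.
- by move: h3; rewrite lt_min ltr_norml => /andP[/andP[] h3 h4 _]; lra.
- by move: h1 h2; rewrite !ltr_norml => /andP[? ?] /andP[? ?]; apply/andP; split; lra.
- exact: lam0.
- by rewrite E -jk.
Qed.

(** Lowering the bound by the same step as the time window makes each event one of those in
    [exceed_open]; the slack disappears in the intersection, which leaves the closed ray. *)
Lemma ray_cylinderE t j (a : R) : 0 <= t ->
  [set w : cadlag_path R n | exists2 x, a <= x & w t = Some (x, j)] =
  \bigcap_N [set w | exists s x, [/\ t < s < t + grid_step R N, 0 <= s,
    w s = Some (x, j) & a - grid_step R N < x]].
Proof.
move=> t0; apply/seteqP; split => w /=.
  move=> [x ax wt] N _ /=; have hN := grid_step_gt0 R N.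
  have /near_rightP[d d0 H] := cadlag_right (path_cadlag w) t0 hN.
  pose s := t + Num.min d (grid_step R N) / 2.
  have m0 : 0 < Num.min d (grid_step R N) by rewrite lt_min d0.
  have [m1 m2] : Num.min d (grid_step R N) <= d /\
    Num.min d (grid_step R N) <= grid_step R N by rewrite !ge_min !lexx orbT.
  have := H s; rewrite wt; case E : (w s) => [[y k]|] /=; last first.
    by move=> HH; exfalso; apply: HH; rewrite /s; lra.
  case; [rewrite /s; lra| rewrite /s; lra|].
  move=> + jk; rewrite ltr_norml => /andP[h1 h2].
  exists s, y; split.
  - by apply/andP; split; rewrite /s; lra.
  - by rewrite /s; lra.
  - by rewrite E -jk.
  - lra.
move=> H.
have near_t e : 0 < e -> exists y, a - e < y /\ close e (w t) (Some (y, j)).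
  move=> e0; have /near_rightP[d d0 Hd] := cadlag_right (path_cadlag w) t0 e0.
  have [N [N1 N2]] : exists N, grid_step R N < d /\ grid_step R N < e.
    have [N _ HN] : \forall N \near \oo, grid_step R N < d /\ grid_step R N < e.
      by near=> N; split; near: N; exact: near_grid_step.
    by exists N; apply: HN => /=.
  have [s [y [/andP[s1 s2] s0 ws ay]]] := H N I.
  exists y; split; first by lra.
  by rewrite -ws; apply: Hd => //; lra.
have [y0 [_]] := near_t 1 ltr01.
case E : (w t) => [[x k]|] //= [_ kj]; exists x; last by rewrite ?E kj.
rewrite leNgt; apply/negP => xa.
(* With half the gap as tolerance, [y] would lie on both sides of the midpoint of x and a. *)
have [|y [y1]] := near_t ((a - x) / 2); first by lra.
rewrite E /= ltr_norml => -[/andP[y2 y3] _]; lra.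
Unshelve. all: by end_near. Qed.

Lemma measurable_ray_cylinder t j (a : R) : 0 <= t ->
  measurable ([set w | exists2 x, a <= x & w t = Some (x, j)] :
    set (path_space R n)).
Proof.
move=> t0; rewrite [X in _ X](ray_cylinderE j a t0); apply: bigcapT_measurable => N.
by apply: sub_sigma_algebra; exact: exceed_open.
Qed.

Lemma measurable_visit t (B : set R) j : measurable B ->
  measurable [set w : path_space R n | exists2 x, B x & w t = Some (x, j)].
Proof.
move=> mB; have [t0|t0] := leP 0 t.
  by apply: measurable_state => // a k; exact: measurable_ray_cylinder.
rewrite [X in _ X](_ : _ = set0); first exact: measurable0.
apply/seteqP; split => w //= [x _].
by rewrite (cadlag_neg (path_cadlag w) t0).
Qed.

Lemma measurable_phase t j : measurable [set w : path_space R n | phase w t = Some j].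
Proof.
rewrite [X in _ X](_ : _ = [set w : path_space R n |
  exists2 x, setT x & w t = Some (x, j)]); first exact: measurable_visit.
apply/seteqP; split => w /=; rewrite /phase; last by move=> [x _ ->].
by case: (w t) => [[x k]|] //= [->]; exists x.
Qed.

Lemma measurable_dead t :
  measurable ([set w | w t = None] : set (path_space R n)).
Proof.
rewrite [X in _ X](_ : _ =
    ~` \bigcup_(j in [set: 'I_n]) [set w : cadlag_path R n | phase w t = Some j]).
  apply: measurableC; apply: fin_bigcup_measurable => // j _.
  exact: measurable_phase.
apply/seteqP; split => w /=.
  by move=> wt [j _ /=]; rewrite /phase wt.
move=> H; case E : (w t) => [[x k]|] //; exfalso; apply: H.
by exists k => //=; rewrite /phase E.
Qed.

Lemma measurable_level t :
  measurable_fun setT (fun w : path_space R n => level w t).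
Proof.
move=> _ B mB; rewrite setTI.
(* [level] is 0 at the cemetery, so the dead paths belong to the preimage exactly when [B] contains
   0. *)
rewrite [X in _ X](_ : _ = \bigcup_(j in [set: 'I_n])
  [set w : path_space R n | exists2 x, B x & w t = Some (x, j)]
   `|` [set w : cadlag_path R n | w t = None /\ B 0]).
  apply: measurableU.
    by apply: fin_bigcup_measurable => // j _; exact: measurable_visit.
  have [B0|B0] := pselect (B 0).
    rewrite [X in _ X](_ : _ = [set w : cadlag_path R n | w t = None]).
      exact: measurable_dead.
    by apply/seteqP; split => w /=; [case|split].
  rewrite [X in _ X](_ : _ = set0); first exact: measurable0.
  by apply/seteqP; split => w //= [].
apply/seteqP; split => w /=.
  rewrite /level; case E : (w t) => [[x k]|] Bx; last by right.
  by left; exists k => //=; exists x.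
by case=> [[j _ [x Bx wt]]|[wt B0]]; rewrite /level wt.
Qed.

End Evaluation.

(** * Time changes and grids *)

Section TimeChange.
Context {R : realType}.
Implicit Types lam mu : R -> R.

Lemma time_change_le lam s t : time_change lam -> 0 <= s -> s <= t ->
  lam s <= lam t.
Proof.
move=> [_ H _] s0; rewrite le_eqVlt => /predU1P[->//|st].
exact/ltW/H.
Qed.

Lemma time_change_id : time_change (@id R).
Proof. by split => // t t0; exists t. Qed.

Lemma time_change_comp lam mu :
  time_change lam -> time_change mu -> time_change (lam \o mu).
Proof.
move=> [l0 lS ls] [m0 mS ms]; split => /=.
- by move=> s s0; apply/l0/m0.
- by move=> s t s0 st; apply: lS; [exact: m0|exact: mS].
- move=> t t0; have [u u0 ut] := ls t t0; have [v v0 vu] := ms u u0.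
  by exists v => //=; rewrite vu.
Qed.

Lemma time_change_inv lam : time_change lam ->
  exists2 mu, time_change mu & forall s, 0 <= s -> lam (mu s) = s.
Proof.
move=> tl; have [l0 lS ls] := tl.
have [mu muP] : exists mu : R -> R,
    forall s, 0 <= s -> 0 <= mu s /\ lam (mu s) = s.
  suff /choice[mu muP] : forall s : R, exists t : R, 0 <= s -> 0 <= t /\ lam t = s.
    by exists mu.
  move=> s.
  have [s0|s0] := leP 0 s; last by exists 0.
  by have [t t0 ts] := ls s s0; exists t.
exists mu; last by move=> s /muP[].
split.
- by move=> s /muP[].
- move=> s t s0 st; have t0 : 0 <= t by lra.
  have [ms0 ms] := muP s s0; have [mt0 mt] := muP t t0.
  rewrite ltNge; apply/negP => /(time_change_le tl mt0).
  by rewrite ms mt leNgt st.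
- move=> t t0; exists (lam t); first exact: l0.
  have [m0 m1] := muP (lam t) (l0 t t0).
  have [h|h|//] := ltgtP (mu (lam t)) t.
  + by have := lS _ _ m0 h; rewrite m1 ltxx.
  + by have := lS _ _ t0 h; rewrite m1 ltxx.
Qed.

(** Lets a time change be built one partition interval at a time: only the part after [g] is
    replaced. *)
Definition extend_linearly lam (g k t : R) : R :=
  if t < g then lam t else lam g + k * (t - g).

Lemma time_change_extend lam g k : time_change lam -> 0 <= g -> 0 < k ->
  time_change (extend_linearly lam g k).
Proof.
move=> tl g0 k0; have [l0 lS ls] := tl; rewrite /extend_linearly; split.
- move=> s s0; case: ltP => sg; first exact: l0.
  by rewrite addr_ge0 ?l0// mulr_ge0 ?subr_ge0// ltW.
- move=> s t s0 st; have [sg|sg] := ltP s g; have [tg|tg] := ltP t g.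
  + exact: lS.
  + have h1 := lS _ _ s0 sg.
    have h2 : 0 <= k * (t - g) by rewrite mulr_ge0 ?subr_ge0// ltW.
    lra.
  + lra.
  + by rewrite ltrD2l ltr_pM2l//; lra.
- move=> t t0; have [tg|tg] := ltP t (lam g).
    have [s s0 st] := ls t t0; exists s => //.
    rewrite ifT//; rewrite ltNge; apply/negP => gs.
    by have := time_change_le tl g0 gs; rewrite st leNgt tg.
  have h : 0 <= (t - lam g) / k by rewrite divr_ge0 ?subr_ge0// ltW.
  exists (g + (t - lam g) / k); first lra.
  rewrite ifF; last by apply/negbTE; rewrite -leNgt; lra.
  by rewrite (addrC g) addrK mulrC divfK ?gt_eqF// addrC subrK.
Qed.

End TimeChange.

Section Grid.
Context {R : realType}.
Implicit Types (x t : R).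

Definition grid_floor N (t : R) : R :=
  (Num.floor (t / grid_step R N))%:~R * grid_step R N.
Definition grid_ceil N (t : R) : R :=
  (Num.ceil (t / grid_step R N))%:~R * grid_step R N.

Lemma grid_floor_le N t : grid_floor N t <= t.
Proof.
by rewrite /grid_floor -ler_pdivlMr ?grid_step_gt0// floor_le.
Qed.

Lemma grid_floor_gt N t : t < grid_floor N t + grid_step R N.
Proof.
have h := grid_step_gt0 R N.
rewrite /grid_floor -[X in _ + X]mul1r -mulrDl -ltr_pdivrMr//.
have := floorD1_gt (t / grid_step R N); by rewrite intrD.
Qed.

Lemma grid_ceil_ge N x : x <= grid_ceil N x.
Proof.
by rewrite /grid_ceil -ler_pdivrMr ?grid_step_gt0// ceil_ge.
Qed.

Lemma grid_ceil_lt N x : grid_ceil N x < x + grid_step R N.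
Proof.
have h := grid_step_gt0 R N.
rewrite -ltrBlDr /grid_ceil -[X in _ - X]mul1r -mulrBl -ltr_pdivlMr//.
have := ceilB1_lt (x / grid_step R N); by rewrite intrB.
Qed.

(** With [grid_ceil_le_floor]: for [t] between the grid ceilings of x and y, the left end of the
    cell of [t] lies in [x, y[, although [t] itself need not. *)
Lemma grid_floor_lt_ceil N t y : t < grid_ceil N y -> grid_floor N t < y.
Proof.
have h := grid_step_gt0 R N.
rewrite /grid_floor /grid_ceil -!ltr_pdivrMr// => H.
rewrite -ltr_pdivlMr// -ceil_gt_int -(ltr_int R).
by apply: le_lt_trans H; exact: floor_le.
Qed.

Lemma grid_ceil_le_floor N t x : grid_ceil N x <= t -> x <= grid_floor N t.
Proof.
have h := grid_step_gt0 R N.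
rewrite /grid_floor /grid_ceil -!ler_pdivlMr// -floor_ge_int => H.
rewrite -ler_pdivrMr// (le_trans (ceil_ge _))//.
by rewrite ler_int.
Qed.

Lemma grid_floorE N t : 0 <= t ->
  grid_floor N t = `|Num.floor (t / grid_step R N)|%N%:R * grid_step R N.
Proof.
move=> t0; rewrite /grid_floor natr_absz ger0_norm//.
by rewrite floor_ge0 divr_ge0// ltW// grid_step_gt0.
Qed.

Lemma grid_floor_ge0 N t : 0 <= t -> 0 <= grid_floor N t.
Proof. by move=> t0; rewrite grid_floorE// mulr_ge0// ltW// grid_step_gt0. Qed.

Lemma grid_floor_homo N s t : s <= t -> grid_floor N s <= grid_floor N t.
Proof.
move=> st; rewrite ler_pM2r ?grid_step_gt0// ler_int le_floor//.
by rewrite ler_pM2r ?invr_gt0 ?grid_step_gt0.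
Qed.

Lemma grid_floor_eq N s t : grid_floor N t <= s -> s < grid_floor N t + grid_step R N ->
  grid_floor N s = grid_floor N t.
Proof.
have h := grid_step_gt0 R N.
rewrite {1 2}/grid_floor -[X in _ + X]mul1r -mulrDl.
rewrite -ler_pdivlMr// -ltr_pdivrMr// => h1 h2; rewrite /grid_floor.
congr (_%:~R * _); apply: floor_def; by rewrite h1 intrD.
Qed.

End Grid.

(** * The Skorokhod Borel sigma-algebra *)

Section CloseLemmas.
Context {R : realType} {n : nat}.

Lemma close_le e e' (s s' : state R n) : e <= e' -> close e s s' -> close e' s s'.
Proof.
by case: s s' => [[x i]|] [[y j]|] //= ee [h ->]; split => //; exact: lt_le_trans ee.
Qed.

Lemma close_add e1 e2 (s1 s2 s3 : state R n) :
  close e1 s1 s2 -> close e2 s2 s3 -> close (e1 + e2) s1 s3.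
Proof.
case: s1 s2 s3 => [[x i]|] [[y j]|] [[z k]|] //= [h1 ->] [h2 ->]; split => //.
by rewrite -(subrKA y) (le_lt_trans (ler_normD _ _))// ltrD.
Qed.

End CloseLemmas.

Section Discretization.
Context {R : realType} {n : nat}.
Implicit Types (w : cadlag_path R n) (t : R) (j : 'I_n).

(** Replaces an explicit partition into intervals of oscillation below [e]: were the reachable
    points bounded, their supremum would be reached thanks to the left limit there, then passed by
    right-continuity. *)
Lemma cadlag_induction w e (Q : R -> Prop) : 0 < e -> Q 0 ->
  (forall x y, 0 <= x -> x < y -> Q x ->
    (forall s t, x <= s < y -> x <= t < y -> close e (w s) (w t)) -> Q y) ->
  forall M, exists2 x, M < x & 0 <= x /\ Q x.
Proof.
move=> e0 Q0 QS M; apply: contrapT => noQ.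
have leM x : 0 <= x -> Q x -> x <= M.
  by move=> x0 Qx; rewrite leNgt; apply/negP => Mx; apply: noQ; exists x.
have e20 : 0 < e / 2 by lra.
pose S := [set x | 0 <= x /\ Q x].
have S0 : S 0 by split.
have Ssup : has_sup S.
  by split; [exists 0|exists M => x [x0 Qx]; exact: leM].
set sg := sup S.
have sg0 : 0 <= sg by apply: ub_le_sup => //; case: Ssup.
have Qsg : Q sg.
  have [sg_pos|sg_neg] := ltP 0 sg; last first.
    by rewrite (_ : sg = 0)//; apply/eqP; rewrite eq_le sg0 sg_neg.
  have [l lP] := cadlag_left (path_cadlag w) sg_pos.
  have /near_leftP[d d0 H] := lP _ e20.
  have [x [x0 Qx] dx] := sup_adherent d0 Ssup.
  have : x <= sg by apply: ub_le_sup => //; case: Ssup.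
  rewrite le_eqVlt => /predU1P[<-//|xsg].
  apply: (QS x) => // s t /andP[xs ss] /andP[xt ts].
  apply: (@Defs.close_trans _ _ _ _ l); last by apply: H => //; apply: lt_le_trans xt.
  by apply: Defs.close_sym; apply: H => //; apply: lt_le_trans xs.
have /near_rightP[d d0 H] := cadlag_right (path_cadlag w) sg0 e20.
have H' s : sg <= s -> s < sg + d -> close (e / 2) (w sg) (w s).
  by rewrite le_eqVlt => /predU1P[<- _|s1 s2]; [exact: Defs.close_refl|exact: H].
have : S (sg + d / 2).
  split; first by lra.
  apply: (QS sg) => //; first by lra.
  move=> s t /andP[s1 s2] /andP[t1 t2].
  apply: (@Defs.close_trans _ _ _ _ (w sg)); last by apply: H' => //; lra.
  by apply: Defs.close_sym; apply: H' => //; lra.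
move=> Sd; have : sg + d / 2 <= sg by apply: ub_le_sup => //; case: Ssup.
by lra.
Qed.

(* Piecewise linear time changes matching the grid points [grid_ceil N p] with the
   points [p] of a partition on which the oscillation of [w] is small. *)
Lemma discretization_near w e M : 0 < e -> \forall N \near \oo,
  exists lam, [/\ time_change lam, forall s, 0 <= s -> `|lam s - s| < e &
    forall t, 0 <= t -> t <= M -> close e (w (grid_floor N t)) (w (lam t))].
Proof.
move=> e0.
pose Q x := \forall N \near \oo, exists lam, [/\ time_change lam,
  lam (grid_ceil N x) = x & forall t, 0 <= t -> t < grid_ceil N x ->
    `|lam t - t| < e /\ close e (w (grid_floor N t)) (w (lam t))].
have Q0 : Q 0.
  near=> N; exists id.
  have g0 : grid_ceil N (0 : R) = 0 by rewrite /grid_ceil mul0r ceil0 mul0r.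
  by split; [exact: time_change_id|rewrite g0|move=> t; rewrite g0; lra].
have QS x y : 0 <= x -> x < y -> Q x ->
    (forall s t, x <= s < y -> x <= t < y -> close e (w s) (w t)) -> Q y.
  move=> x0 xy Qx H; near=> N.
  have [lam [tl lx lP]] : exists lam, [/\ time_change lam,
      lam (grid_ceil N x) = x & forall t, 0 <= t -> t < grid_ceil N x ->
      `|lam t - t| < e /\ close e (w (grid_floor N t)) (w (lam t))].
    by near: N.
  have he : grid_step R N < e by near: N; exact: near_grid_step.
  (* A mesh below y - x keeps the two grid ceilings apart, so the slope between them makes sense. *)
  have hxy : grid_step R N < y - x by near: N; apply: near_grid_step; lra.
  have gx1 := grid_ceil_ge N x; have gx2 := grid_ceil_lt N x.
  have gy1 := grid_ceil_ge N y; have gy2 := grid_ceil_lt N y.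
  set gx := grid_ceil N x in lx lP gx1 gx2 *.
  set gy := grid_ceil N y in gy1 gy2 *.
  have gxy : 0 < gy - gx by lra.
  exists (extend_linearly lam gx ((y - x) / (gy - gx))); split.
  - by apply: time_change_extend => //; [lra|rewrite divr_gt0//; lra].
  - rewrite /extend_linearly ifF; last by apply/negbTE; rewrite -leNgt; lra.
    by rewrite lx divfK ?gt_eqF//; lra.
  - move=> t t0 ty; rewrite /extend_linearly; have [tx|xt] := ltP t gx; first exact: lP.
    rewrite lx; set r := (t - gx) / (gy - gx).
    have r0 : 0 <= r by rewrite divr_ge0//; lra.
    have r1 : r < 1 by rewrite ltr_pdivrMr//; lra.
    have -> : (y - x) / (gy - gx) * (t - gx) = r * (y - x).
      by rewrite /r mulrAC [RHS]mulrAC (mulrC (y - x)).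
    have tE : t = gx + r * (gy - gx) by rewrite /r divfK ?gt_eqF//; lra.
    have i1 : 0 <= r * (y - x) by rewrite mulr_ge0//; lra.
    have i2 : r * (y - x) < y - x by rewrite gtr_pMl//; lra.
    split.
      (* The displacement is a convex combination of the two rounding errors, both at most one grid
         step. *)
      have -> : x + r * (y - x) - t = - ((1 - r) * (gx - x) + r * (gy - y)).
        by rewrite {1}tE; lra.
      have j1 : 0 <= (1 - r) * (gx - x) by rewrite mulr_ge0//; lra.
      have j2 : 0 <= r * (gy - y) by rewrite mulr_ge0//; lra.
      have j3 : (1 - r) * (gx - x) <= (1 - r) * grid_step R N.
        by apply: ler_wpM2l; lra.
      have j4 : r * (gy - y) <= r * grid_step R N by apply: ler_wpM2l; lra.
      by rewrite normrN ger0_norm; lra.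
    apply: H.
      by rewrite grid_ceil_le_floor//= grid_floor_lt_ceil.
    by apply/andP; split; lra.
have [x Mx [x0 Qx]] := cadlag_induction e0 Q0 QS M.
near=> N.
have [lam [tl lx lP]] : exists lam, [/\ time_change lam,
    lam (grid_ceil N x) = x & forall t, 0 <= t -> t < grid_ceil N x ->
    `|lam t - t| < e /\ close e (w (grid_floor N t)) (w (lam t))].
  by near: N.
have he : grid_step R N < e by near: N; exact: near_grid_step.
have gx1 := grid_ceil_ge N x; have gx2 := grid_ceil_lt N x.
(* Slope 1 past the last matched point: the displacement stays constant from there on. *)
exists (extend_linearly lam (grid_ceil N x) 1); split.
- by apply: time_change_extend => //; lra.
- move=> s s0; rewrite /extend_linearly; have [sg|sg] := ltP s (grid_ceil N x).
    by have [] := lP s s0 sg.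
  rewrite lx mul1r (_ : x + (s - grid_ceil N x) - s = - (grid_ceil N x - x)); last lra.
  by rewrite normrN ger0_norm; lra.
- move=> t t0 tM; rewrite /extend_linearly ifT; last by lra.
  by have [|_] := lP t t0; first lra.
Unshelve. all: by end_near. Qed.

Definition discretize_fun N w t : state R n :=
  if t < 0 then None else w (grid_floor N t).

Lemma discretize_is_cadlag N w : is_cadlag_path (discretize_fun N w).
Proof.
have h := grid_step_gt0 R N; rewrite /discretize_fun; split.
- by move=> t ->.
- move=> t t0 e e0; apply/near_rightP.
  have g1 := grid_floor_le N t; have g2 := grid_floor_gt N t.
  exists (grid_floor N t + grid_step R N - t); first lra.
  move=> s s1 s2; rewrite !ifF; [|by apply/negbTE; rewrite -leNgt; lra..].
  by rewrite (@grid_floor_eq _ N s t); [exact: Defs.close_refl|lra|lra].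
- move=> t t0; set g := grid_ceil N t - grid_step R N.
  have g1 := grid_ceil_ge N t; have g2 := grid_ceil_lt N t.
  exists (w (Num.max 0 g)) => e e0; apply/near_leftP; exists (t - Num.max 0 g).
    by rewrite subr_gt0 gt_max t0 /=; rewrite /g; lra.
  move=> s s1 s2; have [m1 m2] : 0 <= Num.max 0 g /\ g <= Num.max 0 g.
    by rewrite !le_max !lexx orbT.
  rewrite ifF; last by apply/negbTE; rewrite -leNgt; lra.
  suff -> : grid_floor N s = Num.max 0 g by exact: Defs.close_refl.
  have gE : grid_floor N g = g.
    rewrite /grid_floor /g /grid_ceil -[X in _ - X]mul1r -mulrBl.
    rewrite mulfK ?gt_eqF// (_ : _ - 1 = (Num.ceil (t / grid_step R N) - 1)%:~R).
      by rewrite intrKfloor.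
    by rewrite intrB.
  have g0 : 0 <= g.
    rewrite /g /grid_ceil -[X in _ - X]mul1r -mulrBl mulr_ge0 //; last exact: ltW.
    have : 0 < Num.ceil (t / grid_step R N) by rewrite ceil_gt0 divr_gt0.
    by rewrite gtz0_ge1 -(ler_int R) subr_ge0.
  rewrite (max_idPr g0) in m1 m2 s1 *.
  have gc : g + grid_step R N = grid_ceil N t by rewrite /g subrK.
  have := @grid_floor_eq _ N s g; rewrite gE; apply; lra.
- move=> s t s0 st; rewrite !ifF; [|by apply/negbTE; rewrite -leNgt; lra..].
  apply: (cadlag_absorbed (path_cadlag w)); first exact: grid_floor_ge0.
  exact: grid_floor_homo.
Qed.

Definition discretize N w : cadlag_path R n :=
  CadlagPath (discretize_is_cadlag N w).

End Discretization.

Definition cylinders (R : realType) n : set (set (cadlag_path R n)) :=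
  [set A | exists (t : R) (B : set R) (j : 'I_n), [/\ 0 <= t, measurable B &
    A = [set w : cadlag_path R n | exists2 x, B x & w t = Some (x, j)]]].

Section BorelCylinder.
Context {R : realType} {n : nat}.
Implicit Types (w : cadlag_path R n) (t : R).

Notation cyl_space := (g_sigma_algebraType (@cylinders R n)).

Lemma cylinder_measurable_close e (s : state R n) t : 0 <= t ->
  measurable [set w : cyl_space | close e s (w t)].
Proof.
move=> t0; case: s => [[y i]|].
  apply: sub_sigma_algebra; exists t, `]y - e, y + e[%classic, i; split => //.
  apply/seteqP; split => w /=.
    case: (w t) => [[x j]|] //= [+ ->]; rewrite ltr_norml => /andP[h1 h2].
    by exists x => //; rewrite in_itv /=; apply/andP; split; lra.
  move=> [x]; rewrite in_itv /= => /andP[h1 h2] ->; split => //.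
  by rewrite ltr_norml; apply/andP; split; lra.
rewrite [X in _ X](_ : _ = ~` \bigcup_(j in [set: 'I_n])
    [set w : cadlag_path R n | exists2 x, setT x & w t = Some (x, j)]).
  apply: measurableC; apply: fin_bigcup_measurable => // j _.
  by apply: sub_sigma_algebra; exists t, setT, j; split.
apply/seteqP; split => w /=.
  by move=> + [j _ [x _ wt]]; rewrite wt.
case wt : (w t) => [[x j]|] // H; exfalso; apply: H.
by exists j => //; exists x.
Qed.

Definition rat_state (s : option (rat * 'I_n)) : state R n :=
  omap (fun xi => (ratr xi.1, xi.2)) s.

Lemma rat_state_dense e (s : state R n) : 0 < e ->
  exists r, close e (rat_state r) s.
Proof.
move=> e0; case: s => [[x i]|]; last by exists None.
have [|q] := @rat_in_itvoo R (x - e) (x + e); first lra.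
rewrite in_itv /= => /andP[q1 q2]; exists (Some (q, i)); split => //=.
by rewrite ltr_norml; apply/andP; split; lra.
Qed.

Definition grid_close N e (s : seq (option (rat * 'I_n))) w : Prop :=
  forall l, (l < size s)%N ->
    close e (rat_state (nth None s l)) (w (l%:R * grid_step R N)).

Lemma cylinder_measurable_grid_close N e s :
  measurable [set w : cyl_space | grid_close N e s w].
Proof.
rewrite [X in _ X](_ : _ = \bigcap_(l in [set l | (l < size s)%N])
  [set w : cyl_space | close e (rat_state (nth None s l)) (w (l%:R * grid_step R N))]).
  apply: bigcap_measurableType => // l _; apply: cylinder_measurable_close.
  by rewrite mulr_ge0// ltW// grid_step_gt0.
by apply/seteqP; split => w H l /H.
Qed.

(** Cells of mesh 1/(N+1), in number (N+1)^2, cover [0, N+1[. The state [r] depends on [t] and the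
    pattern only, so two paths with the same pattern are compared through it. *)
Lemma grid_close_floor N e s w t : size s = (N.+1 * N.+1)%N ->
  grid_close N e s w -> 0 <= t -> t <= N%:R -> exists r,
    forall w', grid_close N e s w' -> close e (rat_state r) (w' (grid_floor N t)).
Proof.
move=> ss H t0 tN; have h := grid_step_gt0 R N.
rewrite grid_floorE//; set k := `|_|%N; exists (nth None s k) => w'; apply.
rewrite ss -(ltr_nat R) natrM.
have <- : grid_floor N t / grid_step R N = k%:R by rewrite grid_floorE// mulfK ?gt_eqF.
rewrite /grid_step invrK ltr_pM2r// (le_lt_trans (grid_floor_le N t))//.
by rewrite (le_lt_trans tN)// ltr_nat.
Qed.

(* A path lies in the open set [U] iff, for some [m] and all fine enough grids, its grid
   values are close to those of a rational pattern [s] realized by a path [v] that is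
   constant on grid cells and has a Skorokhod neighbourhood inside [U]. *)
Definition good_grid (U : set (cadlag_path R n)) m N s : Prop :=
  size s = (N.+1 * N.+1)%N /\ exists v : cadlag_path R n,
    [/\ forall t, 0 <= t -> v t = v (grid_floor N t),
        grid_close N (grid_step R m / 4) s v &
        skorokhod_nbhs v m%:R (grid_step R m) `<=` U].

(** Three errors of a quarter of [grid_step R m] add up: from [v] to the pattern, from the pattern
    to the grid values of [w], and from these to [w] after a time change. The threshold on [N]
    depends on [w] but not on [s], as the countable formula for [U] requires. *)
Lemma good_grid_in U m w : \forall N \near \oo, forall s,
  good_grid U m N s -> grid_close N (grid_step R m / 4) s w -> U w.
Proof.
have hm := grid_step_gt0 R m; have hm4 : 0 < grid_step R m / 4 by lra.
near=> N => s [ss [v [vE vs vU]]] ws; apply: vU.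
have [lam [tl lam1 lam2]] : exists lam, [/\ time_change lam,
    forall s, 0 <= s -> `|lam s - s| < grid_step R m / 4 & forall t, 0 <= t -> t <= m%:R ->
    close (grid_step R m / 4) (w (grid_floor N t)) (w (lam t))].
  by near: N; exact: discretization_near.
exists lam; split => //.
  by move=> t t0; apply: lt_trans (lam1 t t0) _; lra.
move=> t t0 tm; have mN : (m <= N)%N by near: N; exact: nbhs_infty_ge.
have tN : t <= N%:R by rewrite (le_trans tm)// ler_nat.
have [r rP] := grid_close_floor ss vs t0 tN.
rewrite vE//; apply: (@close_le _ _ (grid_step R m / 4 + grid_step R m / 4 + grid_step R m / 4)).
  by lra.
apply: close_add (lam2 t t0 tm); apply: close_add (rP _ ws).
by apply: Defs.close_sym; exact: rP.
Unshelve. all: by end_near. Qed.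

(** The pattern rounds the grid values of [w] and is realized by [discretize N w]. A path near the
    latter is near [w]: its time change is composed with the inverse of the one relating [w] to its
    discretization. *)
Lemma good_grid_exists U w : skorokhod_open U -> U w -> exists m,
  \forall N \near \oo, exists s, good_grid U m N s /\
    grid_close N (grid_step R m / 4) s w.
Proof.
move=> Uo Uw; have [M [e [e0 MU]]] := Uo w Uw.
(* The cap 1 on the displacement, together with M + 1 <= m below, makes the inverse time change map
   [0, M] into [0, m]. *)
have e40 : 0 < Num.min (e / 4) 1 by rewrite lt_min ltr01 andbT; lra.
have [e41 e42] : Num.min (e / 4) 1 <= e / 4 /\ Num.min (e / 4) 1 <= 1.
  by rewrite !ge_min !lexx orbT.
have [m [m1 m2]] : exists m, grid_step R m < e / 4 /\ M + 1 <= m%:R.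
  have [m _ mP] : \forall m \near \oo, grid_step R m < e / 4 /\ M + 1 <= m%:R.
    near=> m; split; near: m; first by apply: near_grid_step; lra.
    exact: nbhs_infty_ger.
  by exists m; apply: mP => /=.
exists m; have hm := grid_step_gt0 R m; have hm4 : 0 < grid_step R m / 4 by lra.
near=> N.
have [lam2 [tl2 lam21 lam22]] : exists lam, [/\ time_change lam,
    forall s, 0 <= s -> `|lam s - s| < Num.min (e / 4) 1 &
    forall t, 0 <= t -> t <= m%:R ->
    close (Num.min (e / 4) 1) (w (grid_floor N t)) (w (lam t))].
  by near: N; exact: discretization_near.
have hN := grid_step_gt0 R N.
have [f fP] : exists f : nat -> option (rat * 'I_n), forall l,
    close (grid_step R m / 4) (rat_state (f l)) (w (l%:R * grid_step R N)).
  by have /choice[f fP] := fun l : nat =>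
    rat_state_dense (w (l%:R * grid_step R N)) hm4; exists f.
exists (mkseq f (N.+1 * N.+1)); split; last first.
  by move=> l; rewrite size_mkseq => lN; rewrite nth_mkseq.
split; first by rewrite size_mkseq.
have lN0 (l : nat) : (l%:R * grid_step R N < 0) = false.
  by apply/negbTE; rewrite -leNgt mulr_ge0// ltW.
have floor_grid (l : nat) : grid_floor N (l%:R * grid_step R N) = l%:R * grid_step R N.
  by rewrite /grid_floor mulfK ?gt_eqF// pmulrn intrKfloor.
exists (discretize N w); split.
- move=> t t0 /=; rewrite /discretize_fun !ifF.
  + by congr (w _); rewrite grid_floorE// floor_grid.
  + by apply/negbTE; rewrite -leNgt grid_floor_ge0.
  + by apply/negbTE; rewrite -leNgt.
- move=> l; rewrite size_mkseq => lN; rewrite nth_mkseq//=.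
  by rewrite /discretize_fun lN0 floor_grid.
move=> w' [lam1 [tl1 lam11 lam12]]; apply: MU.
have [mu tmu muP] := time_change_inv tl2.
have [mu0 _ _] := tmu.
exists (lam1 \o mu); split; first exact: time_change_comp.
  move=> s s0 /=; have := lam11 (mu s) (mu0 s s0); have := lam21 (mu s) (mu0 s s0).
  by rewrite muP// !ltr_norml => /andP[? ?] /andP[? ?]; apply/andP; split; lra.
move=> s s0 sM /=.
have mum : mu s <= m%:R.
  have := lam21 (mu s) (mu0 s s0); rewrite muP// ltr_norml => /andP[? ?]; lra.
have := lam12 (mu s) (mu0 s s0) mum; have := lam22 (mu s) (mu0 s s0) mum.
rewrite muP//= /discretize_fun ifF; last by apply/negbTE; rewrite -leNgt mu0.
move=> /Defs.close_sym/close_add /[apply]; apply: close_le; lra.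
Unshelve. all: by end_near. Qed.

(** Only countable operations occur: the uncountable choice of the path [v] is confined to the
    predicate [good_grid] on patterns, and these form a countable type. *)
Lemma skorokhod_open_cylinder (U : set (cadlag_path R n)) :
  skorokhod_open U -> <<s @cylinders R n>> U.
Proof.
move=> Uo.
have -> : U = \bigcup_m \bigcup_N0 \bigcap_(N in [set N | (N0 <= N)%N])
    \bigcup_(s in [set s | good_grid U m N s])
      [set w : cyl_space | grid_close N (grid_step R m / 4) s w].
  apply/seteqP; split => w.
    move=> /(good_grid_exists Uo)[m [N0 _ H]].
    by exists m => //; exists N0 => // N /H[s [? ?]]; exists s.
  move=> [m _ [N0 _ H]]; have [N1 _ H1] := good_grid_in U m w.
  have [|s] := H (maxn N0 N1); first exact: leq_maxl.
  by apply: H1; exact: leq_maxr.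
have : measurable (\bigcup_m \bigcup_N0 \bigcap_(N in [set N | (N0 <= N)%N])
    \bigcup_(s in [set s | good_grid U m N s])
      [set w : cyl_space | grid_close N (grid_step R m / 4) s w]).
  apply: bigcupT_measurable => m; apply: bigcupT_measurable => N0.
  apply: bigcap_measurableType => // N _; rewrite bigcup_mkcond.
  apply: countable_bigcupT_measurable => // s; case: ifP => // _.
  exact: cylinder_measurable_grid_close.
by [].
Qed.

Lemma cylinder_borel (A : set (cadlag_path R n)) :
  @cylinders R n A -> @measurable _ (path_space R n) A.
Proof.
move=> [t [B [j [_ mB ->]]]].
exact: measurable_visit.
Qed.

Lemma borel_cylinderE : <<s @skorokhod_open R n>> = <<s @cylinders R n>>.
Proof.
apply/seteqP; split; apply: smallest_sub; try exact: smallest_sigma_algebra.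
- exact: skorokhod_open_cylinder.
- exact: cylinder_borel.
Qed.

End BorelCylinder.

(** * Uniqueness of measures from trigonometric integrals *)

Section CosineUniqueness.
Context {R : realType}.
Implicit Types (f g p : R -> R) (I : (R -> R) -> R).

Definition bounded_measurable f :=
  measurable_fun setT f /\ exists C, forall x, `|f x| <= C.

(** Abstracts f -> c * E(f(Y); D), so that two measures on path space with different weights, events
    and starting phases are compared as functionals on functions of one real variable. *)
Record is_bounded_integral I : Prop := IsBoundedIntegral {
  bintegral_linear : forall a f g,
    bounded_measurable f -> bounded_measurable g ->
    I (fun x => a * f x + g x) = a * I f + I g;
  bintegral_cvg : forall (f_ : nat -> R -> R) f C,
    (forall k, measurable_fun setT (f_ k)) -> (forall k x, `|f_ k x| <= C) ->
    (forall x, f_ k x @[k --> \oo] --> f x) ->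
    I (f_ k) @[k --> \oo] --> I f
}.

Lemma bounded_measurableM f g : bounded_measurable f -> bounded_measurable g ->
  bounded_measurable (fun x => f x * g x).
Proof.
move=> [mf [C fC]] [mg [D gD]]; split; first exact: measurable_funM.
by exists (C * D) => x; rewrite normrM ler_pM.
Qed.

Lemma bounded_measurable_lin a f g : bounded_measurable f -> bounded_measurable g ->
  bounded_measurable (fun x => a * f x + g x).
Proof.
move=> [mf [C fC]] [mg [D gD]]; split.
  apply: measurable_funD => //; exact: measurable_funM.
exists (`|a| * C + D) => x; rewrite (le_trans (ler_normD _ _))// lerD//.
by rewrite normrM ler_wpM2l.
Qed.

Lemma bounded_measurable_cos a b : bounded_measurable (fun x => cos (a * x + b)).
Proof.
split; last by exists 1 => x; rewrite ler_norml cos_geN1 cos_le1.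
apply: continuous_measurable_fun => x.
apply: (@continuous_comp _ _ _ (fun y => a * y + b) (@cos R)).
  apply: continuousD; last exact: cvg_cst.
  by apply: continuousM; [exact: cvg_cst|exact: cvg_id].
exact: continuous_cos.
Qed.

Lemma bounded_measurable_lim (f_ : nat -> R -> R) f C :
  (forall k, measurable_fun setT (f_ k)) -> (forall k x, `|f_ k x| <= C) ->
  (forall x, f_ k x @[k --> \oo] --> f x) -> bounded_measurable f.
Proof.
move=> mf fC fl; split.
  by apply: (@measurable_fun_cvg _ _ _ _ f_) => // x _; exact: fl.
exists C => x; have /cvg_norm h := fl x.
by apply: cvgr_to_le h _; near=> k.
Unshelve. all: by end_near. Qed.

Lemma bounded_measurable_cst c : bounded_measurable (fun=> c).
Proof. by split; [exact: measurable_cst|exists `|c|]. Qed.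

(* Maps [-1, 1] to itself with fixed points -1, 0, 1; its iterates are odd
   polynomials converging to the sign. *)
Definition sign_step (y : R) : R := (3 * y - y ^+ 3) / 2.

Lemma sign_stepN y : sign_step (- y) = - sign_step y.
Proof. by rewrite /sign_step exprNn -signr_odd /= expr1 mulN1r; lra. Qed.

Lemma iter_sign_stepN k y : iter k sign_step (- y) = - iter k sign_step y.
Proof. by elim: k => //= k ->; rewrite sign_stepN. Qed.

(** A step from [p] multiplies the distance to 1 by 1 - (p + p^2)/2; since [p] never falls below
    [y], the decay is geometric. *)
Lemma iter_sign_step_pos k y : 0 < y <= 1 ->
  y <= iter k sign_step y <= 1 /\ 1 - iter k sign_step y <= (1 - y / 2) ^+ k.
Proof.
move=> /andP[y0 y1]; elim: k => [|k [/andP[IH1 IH2] IH3]] /=.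
  by rewrite lexx y1 expr0; split => //; lra.
set p := iter k sign_step y in IH1 IH2 IH3 *.
have E : 1 - sign_step p = (1 - p) * ((1 - p) * (2 + p) / 2).
  by rewrite /sign_step !exprS expr0; field.
have q0 : 0 <= (1 - p) * (2 + p) / 2 by rewrite divr_ge0 ?mulr_ge0//; lra.
have q1 : (1 - p) * (2 + p) / 2 <= 1 - y / 2.
  have : 0 <= p * p by rewrite mulr_ge0//; lra.
  nra.
have H : 1 - sign_step p <= (1 - y / 2) ^+ k.+1.
  rewrite E exprS mulrC ler_pM//; lra.
have H2 : 0 <= 1 - sign_step p by rewrite E mulr_ge0//; lra.
have H3 : 1 - sign_step p <= 1 - p.
  by rewrite E -[leRHS]mulr1 ler_wpM2l//; lra.
by split => //; apply/andP; split; lra.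
Qed.

Lemma iter_sign_step_le1 k y : `|y| <= 1 -> `|iter k sign_step y| <= 1.
Proof.
have pos z : 0 < z <= 1 -> `|iter k sign_step z| <= 1.
  move=> z01; have [/andP[h1 h2] _] := iter_sign_step_pos k z01.
  by rewrite ger0_norm//; case/andP: z01 => *; lra.
have [y0|y0|->] := ltgtP y 0.
- move=> h; rewrite -[y]opprK iter_sign_stepN normrN; apply: pos.
  by move: h; rewrite ler_norml => /andP[? ?]; apply/andP; split; lra.
- by move=> h; apply: pos; move: h; rewrite ler_norml y0 => /andP[].
- suff -> : iter k sign_step 0 = 0 by rewrite normr0.
  by elim: k {pos} => //= k ->; rewrite /sign_step exprS; lra.
Qed.

Lemma iter_sign_step_cvg y : `|y| <= 1 ->
  iter k sign_step y @[k --> \oo] --> Num.sg y.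
Proof.
have pos z : 0 < z <= 1 -> iter k sign_step z @[k --> \oo] --> (1 : R).
  move=> z01; have /andP[z0 z1] := z01.
  apply: (@squeeze_cvgr _ _ _ _ (fun k => 1 - (1 - z / 2) ^+ k) (fun=> 1)).
  - near=> k; have [/andP[_ h2] h] := iter_sign_step_pos k z01.
    by apply/andP; split; lra.
  - rewrite -[X in _ --> X]subr0; apply: cvgB; first exact: cvg_cst.
    by apply: cvg_expr; rewrite ger0_norm; lra.
  - exact: cvg_cst.
have [y0|y0|->] := ltgtP y 0.
- move=> h; rewrite -[y]opprK sgrN gtr0_sg ?oppr_gt0//.
  under eq_cvg do rewrite iter_sign_stepN.
  apply: cvgN; apply: pos.
  by move: h; rewrite ler_norml => /andP[? ?]; apply/andP; split; lra.
- by move=> h; rewrite gtr0_sg//; apply: pos; move: h; rewrite ler_norml y0 => /andP[].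
- rewrite sgr0 => _; under eq_cvg => k.
    have -> : iter k sign_step 0 = 0.
      by elim: k => //= k ->; rewrite /sign_step exprS; lra.
    over.
  exact: cvg_cst.
Unshelve. all: by end_near. Qed.

Section Agreement.
Variables I1 I2 : (R -> R) -> R.
Hypothesis (I1P : is_bounded_integral I1) (I2P : is_bounded_integral I2).
Hypothesis I12 : forall a b, I1 (fun x => cos (a * x + b)) = I2 (fun x => cos (a * x + b)).

Definition trig_agree f := bounded_measurable f /\
  forall a b, I1 (fun x => f x * cos (a * x + b)) = I2 (fun x => f x * cos (a * x + b)).

(** Multipliers form an algebra closed under bounded pointwise limits, which agreement of integrals
    alone does not. The path from cosines to sines, signs and indicators of rays stays inside this
    algebra. *)
Definition multiplier p := bounded_measurable p /\
  forall f, trig_agree f -> trig_agree (fun x => p x * f x).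

Let bm_cos := bounded_measurable_cos.

Lemma trig_agree_lin c f g : trig_agree f -> trig_agree g ->
  trig_agree (fun x => c * f x + g x).
Proof.
move=> [bf fE] [bg gE]; split; first exact: bounded_measurable_lin.
move=> a b; have -> : (fun x => (c * f x + g x) * cos (a * x + b)) =
    (fun x => c * (f x * cos (a * x + b)) + g x * cos (a * x + b)).
  by apply/funext => x; rewrite mulrDl mulrA.
have bf' := bounded_measurableM bf (bm_cos a b).
have bg' := bounded_measurableM bg (bm_cos a b).
by rewrite (bintegral_linear I1P)// (bintegral_linear I2P)// fE gE.
Qed.

Lemma multiplier_lin c p q : multiplier p -> multiplier q ->
  multiplier (fun x => c * p x + q x).
Proof.
move=> [bp pE] [bq qE]; split; first exact: bounded_measurable_lin.
move=> f fE; have -> : (fun x => (c * p x + q x) * f x) =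
    (fun x => c * (p x * f x) + q x * f x).
  by apply/funext => x; rewrite mulrDl mulrA.
by apply: trig_agree_lin; [exact: pE|exact: qE].
Qed.

Lemma multiplierM p q : multiplier p -> multiplier q ->
  multiplier (fun x => p x * q x).
Proof.
move=> [bp pE] [bq qE]; split; first exact: bounded_measurableM.
move=> f fE; have -> : (fun x => p x * q x * f x) = (fun x => p x * (q x * f x)).
  by apply/funext => x; rewrite mulrA.
by apply: pE; exact: qE.
Qed.

(** By the product-to-sum formula, multiplication by a cosine only shifts frequency and phase. The
    final 0 in the sum gives it the shape of [bintegral_linear]. *)
Lemma multiplier_cos c d : multiplier (fun x => cos (c * x + d)).
Proof.
split; first exact: bm_cos.
move=> f [bf fE]; split; first exact: bounded_measurableM.
move=> a b.
have -> : (fun x => cos (c * x + d) * f x * cos (a * x + b)) =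
    (fun x => 2^-1 * (f x * cos ((a + c) * x + (b + d))) +
      (2^-1 * (f x * cos ((a - c) * x + (b - d))) + 0)).
  apply/funext => x.
  have -> : (a + c) * x + (b + d) = (a * x + b) + (c * x + d) by lra.
  have -> : (a - c) * x + (b - d) = (a * x + b) - (c * x + d) by lra.
  by rewrite (cosD (a * x + b)) (cosB (a * x + b)); field.
have b1 := bounded_measurableM bf (bm_cos (a + c) (b + d)).
have b2 := bounded_measurableM bf (bm_cos (a - c) (b - d)).
have b0 := bounded_measurable_cst 0.
have z I : is_bounded_integral I -> I (fun=> 0) = 0.
  move=> IP; have := bintegral_linear IP 1 b0 b0.
  have -> : (fun x : R => 1 * 0 + 0 : R) = fun=> 0 by apply/funext => x; lra.
  lra.
have b3 := bounded_measurable_lin 2^-1 b2 b0.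
do 2 rewrite (bintegral_linear I1P)// (bintegral_linear I2P)//.
by rewrite !fE !z.
Qed.

Lemma multiplier_lim (p_ : nat -> R -> R) p C : (forall k, multiplier (p_ k)) ->
  (forall k x, `|p_ k x| <= C) -> (forall x, p_ k x @[k --> \oo] --> p x) ->
  multiplier p.
Proof.
move=> pM pC pl.
have bp : bounded_measurable p.
  by apply: (bounded_measurable_lim _ pC pl) => k; case: (pM k) => -[].
split => // f fE; have [bf _] := fE; split; first exact: bounded_measurableM.
move=> a b; have [D fD] := bf.2.
have C0 : 0 <= C by apply: le_trans (pC 0%N 0).
have lim12 I : is_bounded_integral I ->
    I (fun x => p_ k x * f x * cos (a * x + b)) @[k --> \oo] -->
    I (fun x => p x * f x * cos (a * x + b)).
  move=> IP; apply: (bintegral_cvg IP (C := C * D)).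
  - move=> k; have [bk _] := pM k.
    exact: (bounded_measurableM (bounded_measurableM bk bf) (bm_cos a b)).1.
  - move=> k x; rewrite normrM -[C * D]mulr1 ler_pM//.
      by rewrite normrM ler_pM.
    by rewrite ler_norml cos_geN1 cos_le1.
  - move=> x; apply: cvgMr_tmp; apply: cvgMr_tmp; exact: pl.
have l1 := lim12 _ I1P; have l2 := lim12 _ I2P.
have E : (fun k => I1 (fun x => p_ k x * f x * cos (a * x + b))) =
    (fun k => I2 (fun x => p_ k x * f x * cos (a * x + b))).
  by apply/funext => k; have [_ /(_ _ fE)[_]] := pM k; apply.
by move: l1; rewrite E => l1; exact: cvg_unique l1 l2.
Qed.

Lemma trig_agree1 : trig_agree (fun=> 1).
Proof.
split; first exact: bounded_measurable_cst.
by move=> a b; under eq_fun do rewrite mul1r; rewrite I12.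
Qed.

Lemma multiplier_agree p : multiplier p -> I1 p = I2 p.
Proof.
move=> [_ /(_ _ trig_agree1)[_ /(_ 0 0)]].
have -> : (fun x : R => p x * 1 * cos (0 * x + 0)) = p.
  by apply/funext => x; rewrite mul0r addr0 cos0 !mulr1.
by [].
Qed.

(** The iterates of [sign_step] at a sine are polynomials in it, hence multipliers, and converge
    boundedly to its sign. *)
Lemma multiplier_sg_sin t a : multiplier (fun x => Num.sg (sin (t * (x - a)))).
Proof.
have ms : multiplier (fun x => sin (t * (x - a))).
  have -> : (fun x => sin (t * (x - a))) = (fun x => cos (t * x + (- (t * a) - pi / 2))).
    by apply/funext => x; rewrite addrA cosBpihalf mulrBr.
  exact: multiplier_cos.
have s1 x : `|sin (t * (x - a))| <= 1 by rewrite ler_norml sin_geN1 sin_le1.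
apply: (@multiplier_lim (fun k x => iter k sign_step (sin (t * (x - a)))) _ 1).
- elim=> [//|k IH].
  have -> : (fun x => iter k.+1 sign_step (sin (t * (x - a)))) =
     (fun x => (3 / 2) * iter k sign_step (sin (t * (x - a))) +
       ((- 2^-1) * (iter k sign_step (sin (t * (x - a))) *
        (iter k sign_step (sin (t * (x - a))) * iter k sign_step (sin (t * (x - a))))) +
        0 * iter k sign_step (sin (t * (x - a))))).
    by apply/funext => x /=; rewrite /sign_step !exprS expr0; field.
  apply: multiplier_lin => //; apply: multiplier_lin; first by do 2 apply: multiplierM => //.
  (* [multiplier_lin] always adds a second multiplier, so a lone multiple c * p is written (c - 1) *
     p + p. *)
  have -> : (fun x => 0 * iter k sign_step (sin (t * (x - a)))) =
    (fun x => (-1) * iter k sign_step (sin (t * (x - a))) + iter k sign_step (sin (t * (x - a)))).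
    by apply/funext => x; lra.
  exact: multiplier_lin.
- by move=> k x; exact: iter_sign_step_le1.
- by move=> x; exact: iter_sign_step_cvg.
Qed.

(** For fixed [x] and a low enough frequency the argument of the sine lies in ]-pi, pi[, where the
    sine has the sign of its argument. *)
Lemma multiplier_sg a : multiplier (fun x => Num.sg (x - a)).
Proof.
apply: (@multiplier_lim (fun k x => Num.sg (sin (k.+1%:R^-1 * (x - a)))) _ 1).
- by move=> k; exact: multiplier_sg_sin.
- by move=> k x; rewrite normr_sg; case: (_ != _).
- move=> x; apply: cvg_near_cst.
  have [/eqP|xa] := eqVneq x a.
    by rewrite -subr_eq0 => /eqP->; near=> k; rewrite mulr0 sin0.
  have d0 : 0 < pi / `|x - a| by rewrite divr_gt0 ?pi_gt0// normr_gt0 subr_eq0.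
  near=> k; have k0 : (0 : R) < k.+1%:R^-1 by rewrite invr_gt0.
  have kpi : k.+1%:R^-1 * `|x - a| < pi.
    by rewrite -ltr_pdivlMr ?normr_gt0 ?subr_eq0//; near: k; have := @near_infty_natSinv_lt R (PosNum d0).
  have [ax|ax] := ltP a x.
    rewrite [RHS]gtr0_sg ?subr_gt0// gtr0_sg// sin_gt0_pi// mulr_gt0 ?subr_gt0//=.
    by move: kpi; rewrite gtr0_norm ?subr_gt0.
  have {}ax : x < a by rewrite lt_neqAle xa.
  rewrite [RHS]ltr0_sg ?subr_lt0// ltr0_sg//.
  rewrite -[x - a]opprB mulrN sinN oppr_lt0 sin_gt0_pi// mulr_gt0 ?subr_gt0//=.
  by move: kpi; rewrite distrC gtr0_norm ?subr_gt0.
Unshelve. all: by end_near. Qed.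

(** The signs are centred slightly to the left of [a], so that the limit at x = a is 1 and the ray
    comes out closed. *)
Lemma multiplier_indic_ray a : multiplier (\1_[set x | a <= x] : R -> R).
Proof.
have m1 : multiplier (fun x => if a <= x then 1 else -1).
  apply: (@multiplier_lim (fun k x => Num.sg (x - (a - k.+1%:R^-1))) _ 1).
  - by move=> k; exact: multiplier_sg.
  - by move=> k x; rewrite normr_sg; case: (_ != _).
  - move=> x; apply: cvg_near_cst; case: leP => ax; last first.
      have ax0 : 0 < a - x by lra.
      near=> k; rewrite ltr0_sg// subr_lt0 ltrBrDl -ltrBrDr.
      by near: k; have := @near_infty_natSinv_lt R (PosNum ax0).
    near=> k; have k0 : (0 : R) < k.+1%:R^-1 by rewrite invr_gt0.
    by rewrite gtr0_sg// subr_gt0 ltrBlDr (le_lt_trans ax)// ltrDl.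
have -> : (\1_[set x | a <= x] : R -> R) =
    (fun x => 2^-1 * (if a <= x then 1 else -1) + 2^-1 * cos (0 * x + 0)).
  apply/funext => x; rewrite indicE mul0r addr0 cos0; case: (boolP (a <= x)) => ax.
    by rewrite mem_set// mulr1n; field.
  by rewrite memNset ?mulr0n; [field|exact/negP].
apply: multiplier_lin => //.
have -> : (fun x : R => 2^-1 * cos (0 * x + 0)) =
    (fun x : R => (- 2^-1) * cos (0 * x + 0) + cos (0 * x + 0) : R).
  by apply/funext => x; field.
by apply: multiplier_lin; exact: multiplier_cos.
Unshelve. all: by end_near. Qed.

End Agreement.

End CosineUniqueness.

Section TrigUniqueness.
Context {R : realType}.

(** Closed rays are a pi-system generating the Borel sets; the constant cosine with a = b = 0
    supplies the total mass that complements require. *)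
Lemma trig_unique_indic (I1 I2 : (R -> R) -> R) :
  is_bounded_integral I1 -> is_bounded_integral I2 ->
  (forall a b, I1 (fun x => cos (a * x + b)) = I2 (fun x => cos (a * x + b))) ->
  forall B : set R, measurable B -> I1 \1_B = I2 \1_B.
Proof.
move=> I1P I2P I12 B mB.
have bm_indic (S : set R) : measurable S -> bounded_measurable (\1_S : R -> R).
  move=> mS; split; first exact: measurable_indic.
  by exists 1 => x; rewrite indicE ger0_norm ?ler0n// lern1 leq_b1.
pose G : set (set R) := [set S | exists a, S = [set x | a <= x]].
have GE : measurable = <<s G>> :> set (set R).
  transitivity <<s RGenCInfty.G (R:=R)>>; first exact: RGenCInfty.measurableE.
  congr (<<s _>>).
  by apply/seteqP; split => _ [a ->]; exists a; apply/seteqP; split => x /=;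
    rewrite in_itv /= andbT.
rewrite GE in mB; apply: (dynkin_induction (P := fun S => I1 \1_S = I2 \1_S) GE _ _ _ _ _ mB).
- move=> _ _ [a ->] [b ->]; exists (Num.max a b).
  by apply/seteqP; split => x /=; rewrite ge_max => /andP.
- have := I12 0 0; congr (_ = _); congr (_ _); apply/funext => x;
    by rewrite indicE in_setT mul0r addr0 cos0.
- by move=> _ [a ->]; apply: multiplier_agree => //; exact: multiplier_indic_ray.
- move=> S mS SE.
  have mT := bm_indic _ (@measurableT _ R).
  have -> : (\1_(~` S) : R -> R) = (fun x => (-1) * \1_S x + \1_setT x).
    apply/funext => x; rewrite !indicE in_setT in_setC.
    by case: (x \in S) => /=; lra.
  rewrite (bintegral_linear I1P) ?(bintegral_linear I2P) ?SE//; try exact: bm_indic.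
  congr (_ + _); have := I12 0 0; congr (_ = _); congr (_ _); apply/funext => x;
    by rewrite indicE in_setT mul0r addr0 cos0.
- move=> F mF tF FE.
  (* Countable unions are split into finite ones, handled by linearity, and a bounded limit. *)
  have FN N : I1 (\1_(\bigcup_(k in `I_N) F k)) = I2 (\1_(\bigcup_(k in `I_N) F k)).
    elim: N => [|N IH].
      rewrite II0 bigcup_set0.
      have z (I : (R -> R) -> R) : is_bounded_integral I -> I \1_set0 = 0.
        move=> IP; have m0 := bm_indic _ (@measurable0 _ R).
        have := bintegral_linear IP 1 m0 m0.
        have -> : (fun x : R => 1 * \1_set0 x + \1_set0 x : R) = \1_set0.
          by apply/funext => x; rewrite !indicE in_set0 mulr0 addr0.
        lra.
      by rewrite !z.
    have mFN : measurable (\bigcup_(k in `I_N) F k).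
      by apply: bigcup_measurable.
    have -> : (\1_(\bigcup_(k in `I_N.+1) F k) : R -> R) =
        (fun x => 1 * \1_(F N) x + \1_(\bigcup_(k in `I_N) F k) x).
      apply/funext => x; rewrite mul1r !indicE.
      have [xN|xN] := pselect (F N x).
        rewrite (mem_set xN) mem_set; last by exists N => /=.
        rewrite memNset ?addr0// => -[k /= kN Fkx].
        have kE : k = N by apply: tF => //; exists x.
        by rewrite kE ltnn in kN.
      rewrite (memNset xN) add0r; congr (nat_of_bool _)%:R.
      apply/idP/idP => /set_mem [k /= kN Fkx]; apply: mem_set; exists k => //=.
        by move: kN; rewrite ltnS leq_eqVlt => /predU1P[kE|//]; rewrite kE in Fkx.
      exact: ltnW.
    by rewrite (bintegral_linear I1P) ?(bintegral_linear I2P) ?FE ?IH//; exact: bm_indic.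
  have lim12 (I : (R -> R) -> R) : is_bounded_integral I ->
      I (\1_(\bigcup_(k in `I_N) F k)) @[N --> \oo] --> I (\1_(\bigcup_k F k)).
    move=> IP; apply: (bintegral_cvg IP (C := 1)).
    - by move=> k; apply: measurable_indic; apply: bigcup_measurable.
    - by move=> k x; rewrite indicE ger0_norm ?ler0n// lern1 leq_b1.
    - move=> x; apply: cvg_near_cst; have [[m _ Fmx]|nF] := pselect ((\bigcup_k F k) x).
        near=> N; rewrite !indicE !mem_set//; first by exists m.
        by exists m => //=; near: N; exact: nbhs_infty_gt.
      near=> N; rewrite !indicE !memNset// => -[m _ Fmx].
      by apply: nF; exists m.
  have l1 := lim12 _ I1P; have l2 := lim12 _ I2P.
  by move: l1; rewrite (funext FN) => l1; exact: cvg_unique l1 l2.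
Unshelve. all: by end_near. Qed.

Lemma is_bounded_integral_Rintegral d (T : measurableType d)
    (m : {measure set T -> \bar R}) (D : set T) (Y : T -> R) (c : R) :
  measurable D -> (m D < +oo)%E -> measurable_fun D Y ->
  is_bounded_integral (fun f => c * \int[m]_(w in D) f (Y w)).
Proof.
move=> mD Doo mY.
have mfY (f : R -> R) : measurable_fun setT f -> measurable_fun D (fun w => f (Y w)).
  by move=> mf; exact: (measurableT_comp mf mY).
have intf (f : R -> R) : bounded_measurable f -> m.-integrable D (EFin \o (fun w => f (Y w))).
  move=> [mf [C fC]]; apply: measurable_bounded_integrable => //; first exact: mfY.
  exists C; split; first exact: num_real.
  by move=> x Cx w _ /=; rewrite (le_trans (fC _))// ltW.
split.
- move=> a f g bf bg.
  have -> : \int[m]_(w in D) (a * f (Y w) + g (Y w)) =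
      \int[m]_(w in D) (a * f (Y w)) + \int[m]_(w in D) g (Y w).
    rewrite -RintegralD//; last exact: intf.
    have /intf : bounded_measurable (fun x => a * f x + 0 * g x).
      apply: bounded_measurable_lin => //.
      have [mg [C gC]] := bg; split; first exact: measurable_funM.
      by exists 0 => x; rewrite mul0r normr0.
    by congr (_.-integrable _ _); apply/funext => w /=; rewrite mul0r addr0.
  rewrite RintegralZl//; last exact: intf.
  by rewrite mulrDr mulrCA.
- move=> f_ f C mf fC fl.
  have bf : bounded_measurable f by exact: bounded_measurable_lim mf fC fl.
  have H : ((\int[m]_(w in D) (f_ k (Y w))%:E)%E @[k --> \oo] -->
      (\int[m]_(w in D) (f (Y w))%:E)%E).
    apply: (@dominated_cvg _ _ _ m D mD (fun k w => (f_ k (Y w))%:E) _ (fun=> C%:E)) => //.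
    - by move=> k; apply/measurable_EFinP; exact: mfY.
    - by move=> w _; apply/cvg_EFin; [near=> k|exact: fl].
    - by apply: (intf (fun=> C)); split => //; exists `|C|.
    - by move=> k w _; rewrite /= lee_fin.
  apply: cvgMl_tmp; rewrite /Rintegral.
  apply: fine_cvg; rewrite fineK//.
  apply: integrable_fin_num => //; exact: intf.
Unshelve. all: by end_near. Qed.

Lemma Rintegral_indic_preimage d (T : measurableType d)
    (m : {measure set T -> \bar R}) (D : set T) (Y : T -> R) (B : set R) :
  measurable D -> measurable_fun D Y -> measurable B ->
  \int[m]_(w in D) (\1_B (Y w)) = fine (m (D `&` Y @^-1` B)).
Proof.
move=> mD mY mB; rewrite /Rintegral; congr fine.
have mDB : measurable (D `&` Y @^-1` B) by exact: mY.
have := integral_indic m mD mDB; rewrite (setIC _ D) setIA setIid => <-.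
apply: eq_integral => w /set_mem Dw; rewrite !indicE in_setI (mem_set Dw) /=.
by congr ((nat_of_bool _)%:R)%:E; apply/idP/idP => /set_mem h; apply/mem_set.
Qed.

End TrigUniqueness.

(** * Matrix exponential *)

Section ExponentialSeries.
Context {R : realType}.
Implicit Types (u : nat -> R) (C t : R).

(** With [u k] the real or imaginary part of an entry of M^k, these are the partial sums for that
    entry of exp(tM): the matrix exponential is treated through real series. *)
Definition exp_partial u t (N : nat) : R := \sum_(k < N) (k`!%:R^-1 * t ^+ k * u k).

Lemma exp_partialE C N : exp_partial (fun k => C ^+ k) 1 N = series (exp_coeff C) N.
Proof.
rewrite /exp_partial /series /= big_mkord; apply: eq_bigr => k _.
by rewrite /exp_coeff /= expr1n mulr1 mulrC.
Qed.

Lemma exp_partial_le_exp C N : 0 <= C ->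
  exp_partial (fun k => C ^+ k) 1 N <= expR C.
Proof.
move=> C0; rewrite exp_partialE.
apply: nondecreasing_cvgn_le; last exact: is_cvg_series_exp_coeff.
by apply: nondecreasing_series => k _ _; exact: exp_coeff_ge0.
Qed.

Lemma exp_partial_cvg u C t : (forall k, `|u k| <= C ^+ k) ->
  cvgn (exp_partial u t).
Proof.
move=> uC.
have C0 : 0 <= C by have := le_trans (normr_ge0 _) (uC 1%N); rewrite expr1.
have -> : exp_partial u t = series (fun k => k`!%:R^-1 * t ^+ k * u k).
  by apply/funext => N; rewrite /exp_partial /series /= big_mkord.
apply: normed_cvg; rewrite /normed_series_of /=.
apply: (series_le_cvg (v_ := exp_coeff (`|t| * C))).
- by move=> k; exact: normr_ge0.
- by move=> k; rewrite exp_coeff_ge0// mulr_ge0.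
- move=> k; rewrite !normrM normfV normrX (ger0_norm (ler0n _ _)) /exp_coeff /=.
  rewrite exprMn [leRHS]mulrC -mulrA; apply: ler_wpM2l; first by rewrite invr_ge0.
  by apply: ler_wpM2l; first exact: exprn_ge0.
- exact: is_cvg_series_exp_coeff.
Qed.

(** For t in [0, 1] every power from the second on is at most t^2; what remains is dominated by the
    exponential series at [C]. *)
Lemma exp_partial_expansion u C t N : (forall k, `|u k| <= C ^+ k) ->
  0 <= t <= 1 -> (2 <= N)%N ->
  `|exp_partial u t N - u 0%N - t * u 1%N| <= t ^+ 2 * expR C.
Proof.
move=> uC /andP[t0 t1]; case: N => [//|[//|N]] _.
have C0 : 0 <= C by have := le_trans (normr_ge0 _) (uC 1%N); rewrite expr1.
have e0 : 0`!%:R^-1 * t ^+ 0 * u 0%N = u 0%N by rewrite fact0 invr1 !mul1r.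
have e1 : 1`!%:R^-1 * t ^+ 1 * u 1%N = t * u 1%N by rewrite (_ : 1`! = 1%N)// invr1 mul1r.
rewrite /exp_partial big_ord_recl big_ord_recl /= /bump /= addn0 e0 e1.
rewrite (_ : _ - u 0%N - _ = \sum_(i < N) ((i.+2)`!%:R^-1 * t ^+ i.+2 * u i.+2)); last first.
  rewrite [u 0%N + _]addrC addrK [t * _ + _]addrC addrK; apply: eq_bigr => k _.
  by rewrite !add1n.
rewrite (le_trans (ler_norm_sum _ _ _))//.
have := exp_partial_le_exp N.+2 C0; rewrite /exp_partial => E.
have t2 : 0 <= t ^+ 2 by rewrite exprn_ge0.
apply: le_trans (ler_wpM2l t2 E); rewrite !big_ord_recl /= /bump /=.
apply: (@le_trans _ _ (t ^+ 2 * \sum_(i < N) ((i.+2)`!%:R^-1 * 1 ^+ i.+2 * C ^+ i.+2))).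
  rewrite mulr_sumr ler_sum// => k _.
  have f0 : 0 <= (k.+2)`!%:R^-1 :> R by rewrite invr_ge0.
  rewrite expr1n mulr1 (mulrCA (t ^+ 2)) -mulrA normrM (ger0_norm f0).
  apply: ler_wpM2l => //; rewrite normrM; apply: ler_pM => //.
  rewrite ger0_norm ?exprn_ge0// -[k.+2]addn2 exprD.
  by rewrite ler_piMl// exprn_ile1.
rewrite ler_wpM2l// addrA ler_wpDl//.
  by rewrite !expr1n !mulr1 addr_ge0// mulr_ge0 ?invr_ge0// exprn_ge0.
Qed.

Lemma exp_limit_expansion u C t : (forall k, `|u k| <= C ^+ k) -> 0 <= t <= 1 ->
  `|limn (exp_partial u t) - u 0%N - t * u 1%N| <= t ^+ 2 * expR C.
Proof.
move=> uC t01; have cv := exp_partial_cvg (t := t) uC.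
have : (fun N => `|exp_partial u t N - u 0%N - t * u 1%N|) N @[N --> \oo] -->
   `|limn (exp_partial u t) - u 0%N - t * u 1%N|.
  by apply: cvg_norm; apply: cvgB; [apply: cvgB => //; exact: cvg_cst|exact: cvg_cst].
move=> /cvgr_to_le; apply; near=> N; apply: exp_partial_expansion => //.
by near: N; exact: nbhs_infty_ge.
Unshelve. all: by end_near. Qed.

Lemma exp_limit_derivative u C : (forall k, `|u k| <= C ^+ k) ->
  ((limn (exp_partial u (grid_step R N)) - u 0%N) / grid_step R N) @[N --> \oo]
    --> u 1%N.
Proof.
move=> uC; apply/cvgrPdist_le => e e0.
have eC : 0 < e / expR C by rewrite divr_gt0// expR_gt0.
near=> N; have h0 := grid_step_gt0 R N.
have h1 : grid_step R N <= 1 by rewrite ltW//; near: N; exact: near_grid_step.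
have he : grid_step R N < e / expR C by near: N; exact: near_grid_step.
have := @exp_limit_expansion u C (grid_step R N) uC.
rewrite (ltW h0) h1 => /(_ isT); set L := limn _ => H.
have -> : u 1%N - (L - u 0%N) / grid_step R N =
    - (L - u 0%N - grid_step R N * u 1%N) / grid_step R N.
  by field; rewrite gt_eqF.
rewrite normrM normrN normfV (gtr0_norm h0) ler_pdivrMr//.
rewrite (le_trans H)// expr2 -mulrA mulrC ler_wpM2r ?(ltW h0)//.
by rewrite -ler_pdivlMr ?expR_gt0// ltW.
Unshelve. all: by end_near. Qed.

End ExponentialSeries.

Section MatrixExponential.
Context {R : realType} {n : nat}.
Local Open Scope complex_scope.
Implicit Types (M : 'M[R[i]]_n) (t : R).

Lemma ReD (x y : R[i]) : complex.Re (x + y) = complex.Re x + complex.Re y.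
Proof. by case: x y => [a b] [c d]. Qed.
Lemma ImD (x y : R[i]) : complex.Im (x + y) = complex.Im x + complex.Im y.
Proof. by case: x y => [a b] [c d]. Qed.
Lemma ReM (x y : R[i]) :
  complex.Re (x * y) = complex.Re x * complex.Re y - complex.Im x * complex.Im y.
Proof. by case: x y => [a b] [c d]. Qed.
Lemma ImM (x y : R[i]) :
  complex.Im (x * y) = complex.Re x * complex.Im y + complex.Im x * complex.Re y.
Proof. by case: x y => [a b] [c d]. Qed.
Lemma Re_sum (I : Type) (r : seq I) (F : I -> R[i]) :
  complex.Re (\sum_(k <- r) F k) = \sum_(k <- r) complex.Re (F k).
Proof. by elim/big_rec2: _ => // k x y _ <-; rewrite ReD. Qed.
Lemma Im_sum (I : Type) (r : seq I) (F : I -> R[i]) :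
  complex.Im (\sum_(k <- r) F k) = \sum_(k <- r) complex.Im (F k).
Proof. by elim/big_rec2: _ => // k x y _ <-; rewrite ImD. Qed.
Lemma Re_scale c (z : R[i]) : complex.Re (c%:C * z) = c * complex.Re z.
Proof. by rewrite ReM /= mul0r subr0. Qed.
Lemma Im_scale c (z : R[i]) : complex.Im (c%:C * z) = c * complex.Im z.
Proof. by rewrite ImM /= mul0r addr0. Qed.

Lemma mx_expS M k i j : (M ^+ k.+1) i j = \sum_l M i l * (M ^+ k) l j.
Proof. by rewrite exprS mxE. Qed.

Lemma mx_expSr M k i j : (M ^+ k.+1) i j = \sum_l (M ^+ k) i l * M l j.
Proof. by rewrite exprSr mxE. Qed.

Lemma mx_expZ (c : R[i]) M k i j : ((c *: M) ^+ k) i j = c ^+ k * (M ^+ k) i j.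
Proof.
elim: k i j => [|k IH] i j; first by rewrite !expr0 mul1r.
rewrite !mx_expS mulr_sumr; apply: eq_bigr => l _.
by rewrite IH mxE exprS mulrACA.
Qed.

Lemma expmx_partialE t M N i j : expmx_partial (t%:C *: M) N i j =
  \sum_(k < N) (k`!%:R^-1 * t ^+ k)%:C * (M ^+ k) i j.
Proof.
rewrite /expmx_partial summxE; apply: eq_bigr => k _.
rewrite mxE mx_expZ mulrA; congr (_ * _).
by rewrite rmorphM rmorphXn fmorphV rmorph_nat.
Qed.

Lemma Re_expmx t M i j : complex.Re (expmx (t%:C *: M) i j) =
  limn (exp_partial (fun k => complex.Re ((M ^+ k) i j)) t).
Proof.
rewrite /expmx mxE /=; congr (limn _); apply/funext => N.
by rewrite expmx_partialE Re_sum; apply: eq_bigr => k _; rewrite Re_scale.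
Qed.

Lemma Im_expmx t M i j : complex.Im (expmx (t%:C *: M) i j) =
  limn (exp_partial (fun k => complex.Im ((M ^+ k) i j)) t).
Proof.
rewrite /expmx mxE /=; congr (limn _); apply/funext => N.
by rewrite expmx_partialE Im_sum; apply: eq_bigr => k _; rewrite Im_scale.
Qed.

Lemma mx_exp_bound M : exists C, forall k i j,
  `|complex.Re ((M ^+ k) i j)| <= C ^+ k /\ `|complex.Im ((M ^+ k) i j)| <= C ^+ k.
Proof.
pose c := \sum_i \sum_j (`|complex.Re (M i j)| + `|complex.Im (M i j)|).
have s0 (i j : 'I_n) : 0 <= `|complex.Re (M i j)| + `|complex.Im (M i j)| by exact: addr_ge0.
have c0 : 0 <= c by do 2 apply: sumr_ge0 => ? _.
have cM i j : `|complex.Re (M i j)| + `|complex.Im (M i j)| <= c.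
  rewrite /c (bigD1 i)//= (bigD1 j)//= -addrA lerDl addr_ge0//.
    by apply: sumr_ge0.
  by do 2 apply: sumr_ge0 => ? _.
(* An entry of M * M^k is a sum of n products, each at most [c] times the previous bound. *)
exists (n%:R * c); elim=> [|k IH] i j.
  rewrite !expr0 mxE; case: (i == j) => /=; rewrite ?normr1 ?normr0 ?ler01 ?lexx//.
have nc0 : 0 <= (n%:R * c) ^+ k by rewrite exprn_ge0// mulr_ge0.
have bound (x y z t : R) : `|z| <= (n%:R * c) ^+ k -> `|t| <= (n%:R * c) ^+ k ->
    `|x| + `|y| <= c -> `|x * z| + `|y * t| <= c * (n%:R * c) ^+ k.
  move=> zk tk xy; apply: (@le_trans _ _ ((`|x| + `|y|) * (n%:R * c) ^+ k)).
    by rewrite mulrDl !normrM lerD// ler_wpM2l.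
  by rewrite ler_wpM2r.
have sumb (F : 'I_n -> R) : (forall l, `|F l| <= c * (n%:R * c) ^+ k) ->
    `|\sum_l F l| <= (n%:R * c) ^+ k.+1.
  move=> Fb; rewrite (le_trans (ler_norm_sum _ _ _))//.
  rewrite (le_trans (ler_sum _ (fun l _ => Fb l)))//.
  by rewrite sumr_const card_ord exprS -[leLHS]mulr_natl mulrA.
rewrite mx_expS Re_sum Im_sum; split; apply: sumb => l; have [IH1 IH2] := IH l j.
  rewrite ReM (le_trans (ler_normB _ _))//; exact: bound.
rewrite ImM (le_trans (ler_normD _ _))//; exact: bound.
Qed.

Lemma Re_expmx_derivative M i j :
  ((complex.Re (expmx ((grid_step R N)%:C *: M) i j) - (i == j)%:R) / grid_step R N)
    @[N --> \oo] --> complex.Re (M i j).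
Proof.
have [C HC] := mx_exp_bound M.
have := exp_limit_derivative (fun k => (HC k i j).1).
rewrite expr1 expr0 mxE (_ : complex.Re _ = (i == j)%:R); last by case: (i == j).
by under eq_fun do rewrite -Re_expmx.
Qed.

Lemma Im_expmx_derivative M i j :
  (complex.Im (expmx ((grid_step R N)%:C *: M) i j) / grid_step R N)
    @[N --> \oo] --> complex.Im (M i j).
Proof.
have [C HC] := mx_exp_bound M.
have := exp_limit_derivative (fun k => (HC k i j).2).
rewrite expr1 expr0 mxE (_ : complex.Im _ = 0); last by case: (i == j).
by under eq_fun do rewrite -Im_expmx subr0.
Qed.

(** The indices are exchanged as under transposition. The factor [a] is real, so it passes through
    the real and imaginary parts in which the series are defined. *)
Lemma expmx_similar M M' (a : R) i j :
  (forall k, (M' ^+ k) j i = a%:C * (M ^+ k) i j) -> forall t,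
  expmx (t%:C *: M') j i = a%:C * expmx (t%:C *: M) i j.
Proof.
move=> E t; have [C HC] := mx_exp_bound M.
have cre := exp_partial_cvg (t := t) (fun k => (HC k i j).1).
have cim := exp_partial_cvg (t := t) (fun k => (HC k i j).2).
have pull (u v : nat -> R) : cvgn (exp_partial u t) -> (forall k, v k = a * u k) ->
    limn (exp_partial v t) = a * limn (exp_partial u t).
  move=> cu vu; have -> : exp_partial v t = fun N => a * exp_partial u t N.
    apply/funext => N; rewrite /exp_partial mulr_sumr; apply: eq_bigr => k _.
    by rewrite vu mulrCA.
  have H : a * exp_partial u t x @[x --> \oo] --> a * limn (exp_partial u t).
    exact: cvgMl_tmp cu.
  exact: (cvg_lim (@Rhausdorff R) H).
have re : complex.Re (expmx (t%:C *: M') j i) = complex.Re (a%:C * expmx (t%:C *: M) i j).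
  rewrite Re_scale (Re_expmx t M' j i) (Re_expmx t M i j).
  by apply: (pull _ _ cre) => k; rewrite E Re_scale.
have im : complex.Im (expmx (t%:C *: M') j i) = complex.Im (a%:C * expmx (t%:C *: M) i j).
  rewrite Im_scale (Im_expmx t M' j i) (Im_expmx t M i j).
  by apply: (pull _ _ cim) => k; rewrite E Im_scale.
by apply/eqP; rewrite eq_complex re im !eqxx.
Qed.

End MatrixExponential.

(** * Duality of the transition kernels *)

Section Kernel.
Context {R : realType} {n : nat}.
Local Open Scope complex_scope.
Implicit Types (P : 'I_n -> probability (path_space R n) R)
  (Psi : R[i] -> 'M[R[i]]_n) (q : 'cV[R]_n) (pi : 'rV[R]_n).

Lemma cexp_imag (a x : R) : cexp ((0 +i* a) * x%:C) = cos (a * x) +i* sin (a * x).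
Proof.
rewrite /cexp ReM ImM /= !mul0r !mulr0 subr0 add0r expR0.
by apply/eqP; rewrite eq_complex ReM ImM /= !mul1r !mul0r subr0 addr0 !eqxx.
Qed.

Lemma cos_integral P Psi a t i j : is_matrix_exponent P Psi -> 0 <= t ->
  \int[P i]_(w in [set w : path_space R n | phase w t = Some j]) cos (a * level w t) =
  complex.Re (expmx (t%:C *: Psi (0 +i* a)) i j).
Proof.
move=> HP t0; rewrite -(HP (0 +i* a) t i j erefl t0) /cintegral.
transitivity (\int[P i]_(w in [set w : path_space R n | phase w t = Some j])
  complex.Re (cexp ((0 +i* a) * (level w t)%:C))); last by [].
by apply: eq_Rintegral => w _; rewrite cexp_imag.
Qed.

Lemma sin_integral P Psi a t i j : is_matrix_exponent P Psi -> 0 <= t ->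
  \int[P i]_(w in [set w : path_space R n | phase w t = Some j]) sin (a * level w t) =
  complex.Im (expmx (t%:C *: Psi (0 +i* a)) i j).
Proof.
move=> HP t0; rewrite -(HP (0 +i* a) t i j erefl t0) /cintegral.
transitivity (\int[P i]_(w in [set w : path_space R n | phase w t = Some j])
  complex.Im (cexp ((0 +i* a) * (level w t)%:C))); last by [].
by apply: eq_Rintegral => w _; rewrite cexp_imag.
Qed.

Lemma prob_phase P Psi t i j : is_matrix_exponent P Psi -> 0 <= t ->
  fine (P i [set w : path_space R n | phase w t = Some j]) =
  complex.Re (expmx (t%:C *: Psi 0) i j).
Proof.
move=> HP t0; have := cos_integral 0 i j HP t0.
rewrite (_ : 0 +i* 0 = 0 :> R[i])// => <-.
have mD := measurable_phase t j.
under eq_Rintegral do rewrite mul0r cos0.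
by rewrite Rintegral_cst// mul1r.
Qed.

Lemma Im_expmx_eq0 P Psi t i j : is_matrix_exponent P Psi -> 0 <= t ->
  complex.Im (expmx (t%:C *: Psi 0) i j) = 0.
Proof.
move=> HP t0; have := sin_integral 0 i j HP t0.
rewrite (_ : 0 +i* 0 = 0 :> R[i])// => <-.
have mD := measurable_phase t j.
under eq_Rintegral do rewrite mul0r sin0.
by rewrite Rintegral_cst// mul0r.
Qed.

(** Psi(0) is real because it is the derivative at 0 of matrices of probabilities. *)
Lemma Im_generator P Psi i j : is_matrix_exponent P Psi ->
  complex.Im (Psi 0 i j) = 0.
Proof.
move=> HP; have := @Im_expmx_derivative R n (Psi 0) i j.
under eq_fun do rewrite (Im_expmx_eq0 _ _ HP (ltW (grid_step_gt0 R _))) mul0r.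
move=> H; have H0 : (fun _ : nat => 0 : R) N @[N --> \oo] --> (0 : R) by exact: cvg_cst.
exact: cvg_unique H H0.
Qed.

Lemma generator_offdiag_ge0 P Psi i j : is_matrix_exponent P Psi -> i != j ->
  0 <= complex.Re (Psi 0 i j).
Proof.
move=> HP ij; have := @Re_expmx_derivative R n (Psi 0) i j.
rewrite (negbTE ij) => /cvgr_to_ge; apply; near=> N.
rewrite subr0 -(prob_phase _ _ HP (ltW (grid_step_gt0 R N))).
by rewrite divr_ge0 ?fine_ge0//; exact/ltW/grid_step_gt0.
Unshelve. all: by end_near. Qed.

Lemma prob_dead P t i :
  fine (P i [set w : path_space R n | w t = None]) =
  1 - \sum_j fine (P i [set w : path_space R n | phase w t = Some j]).
Proof.
pose A j := [set w : path_space R n | phase w t = Some j].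
have mA j : measurable (A j) by exact: measurable_phase.
have tA : trivIset [set: 'I_n] A.
  by move=> k l _ _ [w [/=]]; rewrite /A /= => -> [].
have -> : [set w : path_space R n | w t = None] = ~` (\big[setU/set0]_(j < n) A j).
  rewrite -(bigcup_seq (index_enum _) A); apply/seteqP; split => w /=.
    by move=> wt [j _]; rewrite /A /= /phase wt.
  move=> H; case E : (w t) => [[x k]|] //; exfalso; apply: H.
  by exists k; [exact: mem_index_enum|rewrite /A /= /phase E].
rewrite (probability_setC (P i)); last exact: bigsetU_measurable.
rewrite (measure_bigsetU_ord (P i) xpredT)//.
have fA j : P i (A j) \is a fin_num by apply: fin_num_measure.
by rewrite -(EFin_sum_fine _ (fun j _ => fA j)).
Qed.

(** The 1 in the probability of death is spread over the phases as a sum of Kronecker symbols, which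
    turns the quotient into minus a sum of difference quotients of the exponential. *)
Lemma dead_rate P Psi q i : is_matrix_exponent P Psi -> killing_rates Psi q ->
  (fine (P i [set w : path_space R n | w (grid_step R N) = None]) / grid_step R N)
    @[N --> \oo] --> q i 0.
Proof.
move=> HP Hq.
have -> : q i 0 = - \sum_j complex.Re (Psi 0 i j).
  have /matrixP/(_ i 0) := Hq; rewrite !mxE => /(congr1 (@complex.Re R)) /= ->.
  have -> (z : R[i]) : complex.Re (- z) = - complex.Re z by case: z.
  by rewrite Re_sum; congr (- _); apply: eq_bigr => j _; rewrite mxE mulr1.
rewrite (_ : (fun N => _) = (fun N => - \sum_j
   ((complex.Re (expmx ((grid_step R N)%:C *: Psi 0) i j) - (i == j)%:R) / grid_step R N))).
  apply: cvgN; apply: cvg_big => [|j _]; first exact: add_continuous.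
  exact: Re_expmx_derivative.
apply/funext => N; rewrite prob_dead -mulr_suml sumrB -mulNr opprB; congr (_ / _).
have -> : \sum_j (i == j)%:R = 1 :> R.
  by rewrite (bigD1 i)//= eqxx big1 ?addr0// => j; rewrite eq_sym => /negbTE ->.
congr (_ - _); apply: eq_bigr => j _.
exact: (prob_phase _ _ HP (ltW (grid_step_gt0 R N))).
Qed.

Lemma stationary_re P Psi q pi j : is_matrix_exponent P Psi -> is_stationary Psi q pi ->
  \sum_i pi 0 i * complex.Re (Psi 0 i j) = - (pi 0 j * q j 0).
Proof.
move=> HP [_ /matrixP/(_ 0 j)]; rewrite !mxE => /(congr1 (@complex.Re R)) /=.
rewrite Re_sum => H.
transitivity (\sum_i (pi 0 i * complex.Re (Psi 0 i j) +
    (if i == j then pi 0 j * q j 0 else 0)) - pi 0 j * q j 0).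
  rewrite big_split /= -big_mkcond big_pred1_eq; lra.
rewrite -[RHS]add0r -[in RHS]H; congr (_ - _); apply: eq_bigr => i _.
rewrite !mxE Re_scale ReD mulrDr; congr (_ + _).
by have [->|_] := eqVneq i j; rewrite ?mulr1n ?mulr0n ?mulr0.
Qed.

Lemma generator_power_zero (M : 'M[R[i]]_n) (Z : pred 'I_n) :
  (forall i j, ~~ Z i -> Z j -> M i j = 0) ->
  forall k i j, ~~ Z i -> Z j -> (M ^+ k) i j = 0.
Proof.
move=> MZ; elim=> [|k IH] i j iZ jZ.
  by rewrite expr0 mxE; case: eqVneq => // ij; move: iZ; rewrite ij jZ.
rewrite mx_expS big1// => l _; have [lZ|lZ] := boolP (Z l).
  by rewrite MZ ?mul0r.
by rewrite IH ?mulr0.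
Qed.

(* By irreducibility, a zero of [pi] would propagate to all phases: the rates from
   the support of [pi] into its zero set vanish by stationarity. *)
Lemma stationary_gt0 P Psi q pi : is_matrix_exponent P Psi ->
  irreducible_phase P -> is_stationary Psi q pi -> forall i, 0 < pi 0 i.
Proof.
move=> HP Hirr Hpi; have [[pi0 pi1] _] := Hpi.
pose Z : pred 'I_n := fun i => pi 0 i == 0.
have MZ i j : ~~ Z i -> Z j -> Psi 0 i j = 0.
  rewrite /Z => iZ /eqP jZ.
  have H := stationary_re j HP Hpi; rewrite jZ mul0r oppr0 in H.
  have nonneg l : true -> 0 <= pi 0 l * complex.Re (Psi 0 l j).
    move=> _; have [->|lj] := eqVneq l j; first by rewrite jZ mul0r.
    by rewrite mulr_ge0// (generator_offdiag_ge0 HP).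
  move: (psumr_eq0P nonneg H) => /(_ i isT)/eqP.
  rewrite mulf_eq0 (negbTE iZ) /= => /eqP re0.
  by apply/eqP; rewrite eq_complex re0 (Im_generator _ _ HP) !eqxx.
have [i0 i0Z] : exists i, ~~ Z i.
  apply: contrapT => H; suff : (1 : R) = 0 by move/eqP; rewrite oner_eq0.
  rewrite -pi1 big1// => i _; apply: contrapT => /eqP iZ; apply: H; by exists i.
move=> j; rewrite lt_neqAle pi0 andbT eq_sym; apply/negP => jZ.
have [t t0 Pt] := Hirr i0 j; have := prob_phase i0 j HP t0.
rewrite (Re_expmx t (Psi 0)) (_ : exp_partial _ t = fun=> 0).
  rewrite lim_cst// => E; have mD := measurable_phase t j.
  by move: Pt; rewrite -[P i0 _]fineK ?fin_num_measure// E ltxx.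
apply/funext => N; rewrite /exp_partial big1// => k _.
by rewrite (generator_power_zero MZ)//= mulr0.
Qed.

Lemma dual_exponentE Psi pi a i j : (forall i, 0 < pi 0 i) ->
  dual_exponent pi Psi a i j = ((pi 0 i)^-1 * pi 0 j)%:C * Psi a j i.
Proof.
move=> pi0; rewrite /dual_exponent.
set D := diag_mx _; pose D' := diag_mx (map_mx (real_complex R) (\row_k (pi 0 k)^-1)).
have D'D : D' *m D = 1%:M.
  rewrite /D' /D mulmx_diag -diag_const_mx; congr diag_mx; apply/rowP => k.
  by rewrite !mxE -rmorphM /= mulVf ?rmorph1// gt_eqF.
have -> : invmx D = D'.
  have uD : D \in unitmx by have := mulmx1_unit D'D => -[].
  by rewrite -[RHS]mulmx1 -(mulmxV uD) mulmxA D'D mul1mx.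
rewrite mul_mx_diag mxE mul_diag_mx !mxE rmorphM.
by rewrite mulrAC.
Qed.

Lemma dual_exponent_power Psi pi a k i j : (forall i, 0 < pi 0 i) ->
  (dual_exponent pi Psi a ^+ k) j i = ((pi 0 j)^-1 * pi 0 i)%:C * (Psi a ^+ k) i j.
Proof.
move=> pi0; elim: k i j => [|k IH] i j.
  rewrite !expr0 !mxE eq_sym; have [->|_] := eqVneq i j; last by rewrite mulr0.
  by rewrite mulVf ?gt_eqF// mulr1.
rewrite mx_expS mx_expSr mulr_sumr; apply: eq_bigr => l _.
rewrite IH dual_exponentE// mulrACA [_ * (Psi a ^+ k) i l]mulrC; congr (_ * _).
by rewrite -rmorphM mulrA mulfK// gt_eqF.
Qed.

(** Up to the factor 1 / pi_i, the row sum of the dual generator at i is the i-th entry of pi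
    Psi(0), which stationarity evaluates to - pi_i q_i. *)
Lemma dual_killing_rates P Psi q pi : is_matrix_exponent P Psi -> 
  (forall i, 0 < pi 0 i) -> is_stationary Psi q pi ->
  killing_rates (dual_exponent pi Psi) q.
Proof.
move=> HP pi0 Hpi; apply/matrixP => i j; rewrite !mxE (ord1 j).
have H := stationary_re i HP Hpi.
have -> : \sum_k dual_exponent pi Psi 0 i k * const_mx 1 k (ord0 : 'I_1) =
    ((pi 0 i)^-1 * \sum_k pi 0 k * complex.Re (Psi 0 k i))%:C.
  rewrite rmorphM rmorph_sum /= mulr_sumr; apply: eq_bigr => k _.
  rewrite dual_exponentE// [const_mx _ _ _]mxE mulr1 rmorphM -mulrA; congr (_ * _).
  apply/eqP; rewrite eq_complex Re_scale Im_scale (Im_generator _ _ HP) /=.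
  by rewrite mulr0 !eqxx.
by rewrite H mulrN mulrA mulVf ?gt_eqF// mul1r rmorphN opprK.
Qed.

Lemma kernel_duality P Phat Psi pi t i j (B : set R) : (forall i, 0 < pi 0 i) ->
  is_matrix_exponent P Psi -> is_matrix_exponent Phat (dual_exponent pi Psi) ->
  0 <= t -> measurable B ->
  ((pi 0 i)%:E * P i [set w : path_space R n | exists2 x, B x & w t = Some (x, j)] =
   (pi 0 j)%:E * Phat j [set w : path_space R n | exists2 x, B x & w t = Some (x, i)])%E.
Proof.
move=> pi0 HP HPhat t0 mB.
pose D k := [set w : path_space R n | phase w t = Some k].
have mD k : measurable (D k) by exact: measurable_phase.
have mL k : measurable_fun (D k) (fun w : path_space R n => level w t).
  by apply: measurable_funTS; exact: measurable_level.
have setE k : [set w : path_space R n | exists2 x, B x & w t = Some (x, k)] =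
    D k `&` (fun w : path_space R n => level w t) @^-1` B.
  apply/seteqP; split => w /=; rewrite /D /= /phase /level.
    by move=> [x Bx ->].
  by case: (w t) => [[x l]|] [] //= [->] Bx; exists x.
pose I1 (f : R -> R) := pi 0 i * \int[P i]_(w in D j) f (level w t).
pose I2 (f : R -> R) := pi 0 j * \int[Phat j]_(w in D i) f (level w t).
have fin1 : (P i (D j) < +oo)%E by rewrite ltey_eq fin_num_measure.
have fin2 : (Phat j (D i) < +oo)%E by rewrite ltey_eq fin_num_measure.
have I1P : is_bounded_integral I1 by apply: is_bounded_integral_Rintegral.
have I2P : is_bounded_integral I2 by apply: is_bounded_integral_Rintegral.
have ex a : expmx (t%:C *: dual_exponent pi Psi a) j i =
    ((pi 0 j)^-1 * pi 0 i)%:C * expmx (t%:C *: Psi a) i j.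
  by apply: expmx_similar => k; exact: dual_exponent_power.
have exRe a : complex.Re (expmx (t%:C *: dual_exponent pi Psi a) j i) =
    (pi 0 j)^-1 * pi 0 i * complex.Re (expmx (t%:C *: Psi a) i j).
  exact: etrans (congr1 (@complex.Re R) (ex a)) (Re_scale _ _).
have exIm a : complex.Im (expmx (t%:C *: dual_exponent pi Psi a) j i) =
    (pi 0 j)^-1 * pi 0 i * complex.Im (expmx (t%:C *: Psi a) i j).
  exact: etrans (congr1 (@complex.Im R) (ex a)) (Im_scale _ _).
have Icos a : I1 (fun x => cos (a * x)) = I2 (fun x => cos (a * x)).
  rewrite /I1 /I2 (cos_integral a i j HP t0) (etrans (cos_integral a j i HPhat t0) (exRe (0 +i* a))).
  by rewrite !mulrA mulfV ?gt_eqF// mul1r.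
have Isin a : I1 (fun x => sin (a * x)) = I2 (fun x => sin (a * x)).
  rewrite /I1 /I2 (sin_integral a i j HP t0) (etrans (sin_integral a j i HPhat t0) (exIm (0 +i* a))).
  by rewrite !mulrA mulfV ?gt_eqF// mul1r.
have bcos a : bounded_measurable (fun x : R => cos (a * x)).
  have -> : (fun x : R => cos (a * x)) = (fun x => cos (a * x + 0)).
    by apply/funext => x; rewrite addr0.
  exact: bounded_measurable_cos.
have bsin a : bounded_measurable (fun x : R => sin (a * x)).
  have -> : (fun x : R => sin (a * x)) = (fun x => cos (a * x + (- (trigo.pi / 2)))).
    by apply/funext => x; rewrite cosBpihalf.
  exact: bounded_measurable_cos.
have I12 a b : I1 (fun x => cos (a * x + b)) = I2 (fun x => cos (a * x + b)).
  (* The coefficient - sin b is split as (- sin b - 1) + 1 to match the shape c * f + g of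
     [bintegral_linear]. *)
  have -> : (fun x : R => cos (a * x + b)) = (fun x => cos b * cos (a * x) +
      ((- sin b - 1) * sin (a * x) + sin (a * x))).
    by apply/funext => x; rewrite cosD; lra.
  have bs := bounded_measurable_lin (- sin b - 1) (bsin a) (bsin a).
  do 2 rewrite (bintegral_linear I1P)// (bintegral_linear I2P)//.
  by rewrite Icos Isin.
have := trig_unique_indic I1P I2P I12 mB.
rewrite /I1 /I2 !Rintegral_indic_preimage// => H.
rewrite !setE -[P i _]fineK; last by apply: fin_num_measure; exact: mL.
rewrite -[Phat j _]fineK; last by apply: fin_num_measure; exact: mL.
by rewrite -!EFinM H.
Qed.

End Kernel.

(** * Time reversal *)

Section Reversal.
Context {R : realType} {n : nat}.
Implicit Types (w : cadlag_path R n) (t u z : R) (k : 'I_n).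

(* [L] is the index of the last grid point strictly before the life time. *)
Definition dies_in N L w : Prop :=
  w (L%:R * grid_step R N) <> None /\ w (L.+1%:R * grid_step R N) = None.

(** Ceiling minus one, not the floor: a life time that falls on the grid must be preceded by a
    strictly earlier grid point. *)
Definition death_index N z : nat := `|(Num.ceil (z / grid_step R N) - 1)%R|%N.

Lemma death_index_lt N z : 0 < z -> (death_index N z)%:R * grid_step R N < z.
Proof.
move=> z0; have h := grid_step_gt0 R N.
rewrite -ltr_pdivlMr// /death_index natr_absz ger0_norm.
  exact: ceilB1_lt.
by rewrite subr_ge0 -gtz0_ge1 ceil_gt0 divr_gt0.
Qed.

Lemma death_index_ge N z : 0 < z -> z <= (death_index N z).+1%:R * grid_step R N.
Proof.
move=> z0; have h := grid_step_gt0 R N.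
rewrite -ler_pdivrMr// -natr1 /death_index natr_absz ger0_norm.
  by rewrite intrB subrK ceil_ge.
by rewrite subr_ge0 -gtz0_ge1 ceil_gt0 divr_gt0.
Qed.

Lemma alive_before_lifetime w z t : 0 <= t -> t < z -> lifetime w = z%:E -> w t <> None.
Proof. by move=> t0 tz Ez; apply: alive_before => //; rewrite Ez lte_fin. Qed.

Lemma alive_lt_lifetime w z t : lifetime w = z%:E -> w t <> None -> t < z.
Proof.
move=> Ez wt; rewrite ltNge; apply/negP => zt; apply: wt.
by apply: dead_after; rewrite Ez lee_fin.
Qed.

Lemma alive_ge0 w t : w t <> None -> 0 <= t.
Proof.
by rewrite leNgt => wt; apply/negP => t0; apply: wt; exact: (cadlag_neg (path_cadlag w)).
Qed.

Lemma dies_in_death_index N w z : lifetime w = z%:E -> 0 < z ->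
  dies_in N (death_index N z) w.
Proof.
move=> Ez z0; split.
  apply: (alive_before_lifetime _ (death_index_lt N z0) Ez).
  by rewrite mulr_ge0// ltW// grid_step_gt0.
by apply: dead_after; rewrite Ez lee_fin death_index_ge.
Qed.

Lemma dies_in_unique N w L L' : dies_in N L w -> dies_in N L' w -> L = L'.
Proof.
have h := grid_step_gt0 R N.
have aux a b : (a < b)%N -> dies_in N a w -> dies_in N b w -> False.
  move=> ab [_ a2] [b1 _]; apply: b1.
  apply: (cadlag_absorbed (path_cadlag w) _ _ a2).
    by rewrite mulr_ge0// ltW.
  by rewrite ler_pM2r// ler_nat.
by move=> H H'; case: (ltngtP L L') => // ab; exfalso;
  [exact: (aux _ _ ab H H')|exact: (aux _ _ ab H' H)].
Qed.

Lemma dies_in_lifetime N L w : dies_in N L w ->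
  exists2 z, 0 < z & lifetime w = z%:E /\ L = death_index N z.
Proof.
have h := grid_step_gt0 R N.
move=> H; have [H1 H2] := H; case Ez : (lifetime w) => [z||].
- have z0 : 0 < z.
    apply: (le_lt_trans _ (alive_lt_lifetime Ez H1)).
    exact: alive_ge0 H1.
  exists z => //; split => //; apply: dies_in_unique H _.
  exact: dies_in_death_index.
- exfalso; apply: alive_before H2; last by rewrite Ez ltry.
  by rewrite mulr_ge0// ltW.
- exfalso; have : (0 <= lifetime w)%E.
    by apply: le_ereal_inf_tmp => _ [t [t0 _] <-]; rewrite lee_fin.
  by rewrite Ez.
Qed.

Lemma left_limit_alive w z : lifetime w = z%:E -> 0 < z -> left_limit w z <> None.
Proof.
move=> Ez z0 E; have /near_leftP[d d0 H] := left_limitP w z0 ltr01.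
set m := Num.max 0 (z - d).
have mz : m < z by rewrite gt_max z0 /=; lra.
have [m1 m2] : 0 <= m /\ z - d <= m by rewrite !le_max !lexx orbT.
have : close 1 (left_limit w z) (w ((m + z) / 2)) by apply: H; lra.
rewrite E; case E' : (w _) => [//|] _; move: E'.
by apply: (@alive_before_lifetime w z) => //; lra.
Qed.

Definition flip_at w t u : state R n := flip_state (level w t) (w (t - u)).

(* Flipping at the last grid point [T] before the life time [z]: as [T - u] increases
   strictly to [z - u], it picks up exactly the left limits used by the reversal. *)
Lemma reverse_approx w z u e : lifetime w = z%:E -> 0 < z -> 0 <= u -> 0 < e ->
  \forall N \near \oo,
    close e (reverse_path w u) (flip_at w ((death_index N z)%:R * grid_step R N) u).
Proof.
move=> Ez z0 u0 e0; rewrite /= /reverse_fun Ez u0 /=.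
have e20 : 0 < e / 2 by lra.
have approx v : 0 < z - v -> \forall N \near \oo,
    close (e / 2) (left_limit w (z - v)) (w ((death_index N z)%:R * grid_step R N - v)).
  move=> v0; have /near_leftP[d d0 H] := left_limitP w v0 e20.
  near=> N; have h0 := grid_step_gt0 R N.
  have hd : grid_step R N < d by near: N; exact: near_grid_step.
  have g1 := death_index_lt N z0; have := death_index_ge N z0.
  by rewrite -natr1 mulrDl mul1r => g2; apply: H; lra.
(* From the life time on both sides are dead: the flipped path is then read at a negative time,
   where paths are [None]. *)
have [uz|zu] := ltP u z; last first.
  near=> N; rewrite /flip_at (cadlag_neg (path_cadlag w))//.
  by rewrite subr_lt0 (lt_le_trans _ zu)// death_index_lt.
case Ex : (left_limit w z) => [[x k]|]; last by have := left_limit_alive Ez z0 Ex.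
have z00 : 0 < z - 0 by lra.
have zu0 : 0 < z - u by lra.
have A0 := approx _ z00; have Au := approx _ zu0.
near=> N; rewrite /flip_at /level.
have : close (e / 2) (left_limit w (z - 0))
  (w ((death_index N z)%:R * grid_step R N - 0)) by near: N.
have : close (e / 2) (left_limit w (z - u))
  (w ((death_index N z)%:R * grid_step R N - u)) by near: N.
rewrite !subr0 Ex.
case: (left_limit w (z - u)) => [[y l]|];
  case: (w ((death_index N z)%:R * grid_step R N - u)) => [[y' l']|] //=.
case: (w _) => [[x' k']|] //= [h1 ->] [h2 _]; split => //.
by move: h1 h2; rewrite !ltr_norml => /andP[? ?] /andP[? ?]; apply/andP; split; lra.
Unshelve. all: by end_near. Qed.

Lemma J_before_deathE w k : J_before_death k w <-> sphase (reverse_path w 0) = Some k.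
Proof.
rewrite /J_before_death /= /reverse_fun.
case Ez : (lifetime w) => [z||] //; rewrite lexx /= subr0.
have [z0|z0] := ltP 0 z.
  case: (left_limit w z) => [[x l]|] /=; last by split => // -[].
  split; first by move=> [y [_ ->]].
  by move=> [->]; exists x.
(* The remaining case is a path dead from the start: its left limit at 0 is taken over negative
   times, where it is [None], so neither side can hold. *)
have : (0 <= lifetime w)%E.
  by apply: le_ereal_inf_tmp => _ [t [t0 _] <-]; rewrite lee_fin.
rewrite Ez lee_fin => z0'; have -> : z = 0 by apply/eqP; rewrite eq_le z0.
suff -> : left_limit w 0 = None by split => // -[].
rewrite /left_limit; case: xgetP => [l _ lP|//].
have /near_leftP[d d0 H] := lP 1 ltr01.
have := H (- d / 2); rewrite (cadlag_neg (path_cadlag w)); last lra.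
case: l lP H => [[x l]|] // _ _ H.
by suff : close 1 (Some (x, l) : state R n) None by []; apply: H; lra.
Qed.

Lemma reverse_path_start w k : J_before_death k w -> reverse_path w 0 = Some (0, k).
Proof.
move=> /J_before_deathE /=; rewrite /reverse_fun.
case: (lifetime w) => [z||] //; rewrite lexx /=; case: ifP => // _.
case E : (left_limit w z) => [[x l]|] //; rewrite subr0 E /= => -[->].
by rewrite subrr.
Qed.

Lemma flip_at_alive w t u x k : flip_at w t u = Some (x, k) ->
  phase w (t - u) = Some k /\ level w t - level w (t - u) = x.
Proof. by rewrite /flip_at /phase /level; case: (w (t - u)) => [[y l]|] //= [<- <-]. Qed.

Lemma measurable_dies_in N L : measurable [set w : path_space R n | dies_in N L w].
Proof.
rewrite [X in _ X](_ : _ = ~` [set w : path_space R n | w (L%:R * grid_step R N) = None]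
  `&` [set w : path_space R n | w (L.+1%:R * grid_step R N) = None]) //.
by apply: measurableI; [apply: measurableC|]; exact: measurable_dead.
Qed.

(** The reversed path is a pointwise limit of flipped paths, whose events involve finitely many
    evaluations. A strict inequality holds in the limit iff, with some margin [grid_step R p], it
    holds on all fine grids; the union over [L] only picks the cell of death. *)
Lemma measurable_reverse_ray u k (a : R) : 0 <= u ->
  measurable [set w : path_space R n | exists2 x, a < x & reverse_path w u = Some (x, k)].
Proof.
move=> u0.
pose A p N L := [set w : path_space R n | dies_in N L w] `&`
  ([set w : path_space R n | phase w (L%:R * grid_step R N - u) = Some k] `&`
  [set w : path_space R n | a + grid_step R p <=
     level w (L%:R * grid_step R N) - level w (L%:R * grid_step R N - u)]).
have mA p N L : measurable (A p N L).
  apply: measurableI; first exact: measurable_dies_in.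
  apply: measurableI; first exact: measurable_phase.
  rewrite -[X in measurable X]setTI.
  have mf : measurable_fun setT (fun w : path_space R n =>
      level w (L%:R * grid_step R N) - level w (L%:R * grid_step R N - u)).
    by apply: measurable_funB; exact: measurable_level.
  rewrite (_ : [set w | _] = (fun w : path_space R n =>
      level w (L%:R * grid_step R N) - level w (L%:R * grid_step R N - u)) @^-1`
      `[a + grid_step R p, +oo[%classic); first exact: mf.
  by apply/seteqP; split => w /=; rewrite in_itv /= andbT.
rewrite [X in _ X](_ : _ = \bigcup_p \bigcup_N0 \bigcap_(N in [set N | (N0 <= N)%N])
    \bigcup_L A p N L).
  apply: bigcupT_measurable => p; apply: bigcupT_measurable => N0.
  apply: bigcap_measurableType => N _; exact: bigcupT_measurable.
apply/seteqP; split => w /=.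
  move=> [x ax rx].
  case Ez : (lifetime w) => [z||]; rewrite /reverse_fun Ez ?u0 //= in rx.
  have uz : u < z by move: rx; case: (u < z).
  have z0 : 0 < z by lra.
  (* Half of the gap pays for the margin, the other half for the approximation error. *)
  have e0 : 0 < (x - a) / 2 by lra.
  have [p _ hp] := near_grid_step e0; have {}hp := hp p (leqnn p).
  exists p => //.
  have [N0 _ HN] := reverse_approx Ez z0 u0 e0; exists N0 => // N N0N.
  exists (death_index N z) => //; rewrite /A /=.
  have := HN N N0N; rewrite /= /reverse_fun Ez u0 /= rx.
  case E : (flip_at _ _ _) => [[y l]|] //= [xy kl].
  have [Ep El] := flip_at_alive E; split; first exact: dies_in_death_index.
  split; first by rewrite kl.
  by rewrite El; move: xy; rewrite ltr_norml => /andP[? ?]; lra.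
move=> [p _ [N0 _ H]].
have [L0 _ [/dies_in_lifetime[z z0 [Ez _]] _]] := H N0 (leqnn _).
(* Conversely, the margin absorbs an approximation error of the same size, and strictness
   survives. *)
have [N1 _ HN] := reverse_approx Ez z0 u0 (grid_step_gt0 R p).
pose N := maxn N0 N1.
have [L _ [D [PL LL]]] := H N (leq_maxl _ _).
have LE : L = death_index N z.
  by apply: (dies_in_unique D); exact: dies_in_death_index.
have := HN N (leq_maxr _ _); rewrite -LE /flip_at.
move: PL LL; rewrite /= /phase /level.
case: (w (L%:R * grid_step R N - u)) => [[y l]|] //= [->] LL.
case: (reverse_fun w u) => [[x l']|] //= [xy ->]; exists x => //.
by move: xy; rewrite ltr_norml => /andP[? ?]; lra.
Qed.

Lemma measurable_reverse_visit u (B : set R) k : 0 <= u -> measurable B ->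
  measurable [set w : path_space R n | exists2 x, B x & reverse_path w u = Some (x, k)].
Proof.
move=> u0; apply: (measurable_state (G := fun w : path_space R n => reverse_path w u)).
move=> a l; rewrite [X in _ X](_ : _ = \bigcap_p
    [set w : path_space R n | exists2 x, a - grid_step R p < x & reverse_path w u = Some (x, l)]).
  by apply: bigcapT_measurable => p; exact: measurable_reverse_ray.
apply/seteqP; split => w /=.
  move=> [x ax rx] p _; exists x => //; have := grid_step_gt0 R p; lra.
move=> H; have [x _ rx] := H 0%N I; exists x => //.
rewrite leNgt; apply/negP => xa; have ax0 : 0 < a - x by lra.
have [p _ hp] := near_grid_step ax0; have {}hp := hp p (leqnn p).
have [y ay ry] := H p I; have : x = y by move: rx; rewrite ry => -[].
lra.
Qed.

Lemma measurable_reverse : measurable_fun setT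
  (@reverse_path R n : path_space R n -> path_space R n).
Proof.
have mE : @measurable _ (path_space R n) = <<s @cylinders R n>> by exact: borel_cylinderE.
apply: (measurability _ mE) => _ [_ [t [B [k [t0 mB ->]]]] <-].
rewrite setTI.
exact: measurable_reverse_visit.
Qed.

Lemma measurable_J_before_death k :
  measurable (J_before_death k : set (path_space R n)).
Proof.
rewrite [X in _ X](_ : _ = [set w : path_space R n |
  exists2 x, setT x & reverse_path w 0 = Some (x, k)]).
  exact: measurable_reverse_visit.
apply/seteqP; split => w /=.
  move=> /J_before_deathE /=; case: (reverse_fun w 0) => [[x l]|] //= [->].
  by exists x.
by move=> [x _ rx]; apply/J_before_deathE; rewrite /= rx.
Qed.

End Reversal.

(** * Chains of transitions *)

Section Steps.
Context {R : realType} {n : nat}.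
Implicit Types (w : cadlag_path R n) (f : R -> state R n) (k : 'I_n) (T u : R).

(* A step [(d, B, k)]: wait [d], move by an increment in [B], land in phase [k]. *)
Definition step : Type := (R * set R * 'I_n)%type.
Implicit Types (b acc : seq step).

(** Stated for bare functions because a path flipped at a grid point need not be càdlàg. *)
Fixpoint steps f u k b : Prop :=
  sphase (f u) = Some k /\
  if b is (d, B, k') :: b' then
    B (slevel (f (u + d)) - slevel (f u)) /\ steps f (u + d) k' b'
  else True.

Definition duration b : R := \sum_(s <- b) s.1.1.
Definition last_phase k b : 'I_n := last k (map snd b).
Definition steps_in (Q : R -> set R -> Prop) b : Prop :=
  forall s, List.In s b -> Q s.1.1 s.1.2.

(* Pushes the reversed steps of [b], run backwards to their start [k], onto [acc]. *)
Fixpoint rev_steps k b acc : seq step :=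
  if b is (d, B, k') :: b' then rev_steps k' b' ((d, B, k) :: acc) else acc.

Lemma steps_in_cons Q s b : steps_in Q (s :: b) <-> Q s.1.1 s.1.2 /\ steps_in Q b.
Proof.
split; first by move=> H; split; [apply: H; left|move=> t tb; apply: H; right].
by move=> [Qs Qb] t [<-|/Qb].
Qed.

Lemma steps_in_cat Q b b' : steps_in Q b -> steps_in Q b' -> steps_in Q (b ++ b').
Proof.
elim: b => [//|s b IH] /steps_in_cons[Qs /IH H] /H Qb'.
by apply/steps_in_cons.
Qed.

Lemma steps_in_rev Q k b acc : steps_in Q b -> steps_in Q acc ->
  steps_in Q (rev_steps k b acc).
Proof.
elim: b k acc => [//|[[d B] k'] b IH] k acc /steps_in_cons[/= QB Qb] Qacc.
by apply: IH => //; apply/steps_in_cons.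
Qed.

Lemma duration_cons s b : duration (s :: b) = s.1.1 + duration b.
Proof. by rewrite /duration big_cons. Qed.

Lemma duration_cat b b' : duration (b ++ b') = duration b + duration b'.
Proof. by rewrite /duration big_cat. Qed.

Lemma duration_rev k b acc : duration (rev_steps k b acc) = duration b + duration acc.
Proof.
elim: b k acc => [|[[d B] k'] b IH] k acc /=; first by rewrite /duration big_nil add0r.
by rewrite IH !duration_cons /=; lra.
Qed.

Lemma duration_ge0 Q b : steps_in (fun d B => 0 <= d /\ Q B) b -> 0 <= duration b.
Proof.
elim: b => [|s b IH]; first by rewrite /duration big_nil.
by move=> /steps_in_cons[[? _] /IH ?]; rewrite duration_cons addr_ge0.
Qed.

Lemma last_phase_rev k b acc :
  last_phase (last_phase k b) (rev_steps k b acc) = last_phase k acc.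
Proof.
elim: b k acc => [//|[[d B] k'] b IH] k acc /=.
by rewrite [last_phase k _]/last_phase /= -/(last_phase k' b) IH.
Qed.

Lemma steps_phase f u k b : steps f u k b -> sphase (f u) = Some k.
Proof. by case: b => [|[[d B] k'] b] /= []. Qed.

(** A last step with a free increment only prescribes a final phase; this is how a chain is
    prolonged to a grid point. *)
Lemma steps_rcons f u k b d k' : steps f u k (b ++ [:: (d, setT, k')]) <->
  steps f u k b /\ sphase (f (u + (duration b + d))) = Some k'.
Proof.
elim: b u k => [|[[d0 B] k0] b IH] u k /=.
  rewrite /duration big_nil add0r; split; first by move=> [? [_ []]].
  by move=> [[? _] ?].
rewrite duration_cons /= (_ : u + (d0 + duration b + d) = u + d0 + (duration b + d)); last lra.
split; first by move=> [? [? /IH[]]].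
by move=> [[? [? ?]] ?]; do 2 split => //; apply/IH.
Qed.

Lemma steps_alive f u k b : steps f u k b -> f (u + duration b) <> None.
Proof.
elim: b u k => [|[[d B] k'] b IH] u k /=.
  by rewrite /duration big_nil addr0; case: (f u) => [//|[]].
by move=> [_ [_ /IH]]; rewrite duration_cons /= addrA.
Qed.

Lemma steps_flip w T x u k b acc :
  (steps (fun v => flip_state x (w (T - v))) u k b /\ steps w (T - u) k acc) <->
  steps w (T - u - duration b) (last_phase k b) (rev_steps k b acc).
Proof.
have phase_flip v l : sphase (flip_state x (w v)) = Some l <-> sphase (w v) = Some l.
  by case: (w v) => [[y m]|].
elim: b u k acc => [|[[d B] k'] b IH] u k acc /=.
  rewrite /duration big_nil subr0; split => [[]//|H]; split => //; split => //.
  by apply/phase_flip; exact: steps_phase H.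
rewrite duration_cons /= (_ : T - u - (d + duration b) = T - (u + d) - duration b); last lra.
rewrite -IH /= (_ : T - (u + d) + d = T - u); last lra.
have lev l m : sphase (w (T - u)) = Some l -> sphase (w (T - (u + d))) = Some m ->
    slevel (flip_state x (w (T - (u + d)))) - slevel (flip_state x (w (T - u))) =
    slevel (w (T - u)) - slevel (w (T - (u + d))).
  by case: (w _) => [[y ?]|] // _; case: (w _) => [[z ?]|] //= _; lra.
split.
  move=> [[/phase_flip p [Bd st]] sacc].
  have /phase_flip p' := steps_phase st.
  split => //; split => //; split => //.
  by rewrite -(lev _ _ p p').
move=> [st [p' [Bd sacc]]]; have p := steps_phase sacc; split => //.
split; first by apply/phase_flip.
by rewrite (lev _ _ p p').
Qed.

Lemma steps_shift w x l d u k b : 0 <= u -> w d = Some (x, l) ->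
  steps_in (fun d _ => 0 <= d) b ->
  (steps (shift_path d w) u k b <-> steps w (d + u) k b).
Proof.
move=> u0 wd; have E v : 0 <= v -> shift_path d w v = shift_state x (w (d + v)).
  by move=> v0; rewrite /= /shift_fun ltNge v0 /= wd.
have phase_shift v m : 0 <= v ->
    sphase (shift_path d w v) = Some m <-> sphase (w (d + v)) = Some m.
  by move=> v0; rewrite E//; case: (w _) => [[]|].
elim: b u k u0 => [|[[d0 B] k'] b IH] u k u0 /=.
  by move=> _; split => -[/(phase_shift _ _ u0) ? _]; split => //; exact/(phase_shift _ _ u0).
move=> /steps_in_cons[/= d00 Hb]; have ud0 : 0 <= u + d0 by rewrite addr_ge0.
have lev m m' : sphase (w (d + u)) = Some m -> sphase (w (d + u + d0)) = Some m' ->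
    slevel (shift_path d w (u + d0)) - slevel (shift_path d w u) =
    slevel (w (d + u + d0)) - slevel (w (d + u)).
  rewrite !E// addrA; case: (w _) => [[y ?]|] // _; case: (w _) => [[z ?]|] //= _; lra.
split.
  move=> [/(phase_shift _ _ u0) p [Bd /(IH _ _ ud0 Hb)]]; rewrite addrA => st.
  by split => //; split => //; rewrite -(lev _ _ p (steps_phase st)).
move=> [p [Bd st]]; split; first exact/(phase_shift _ _ u0).
split; first by rewrite (lev _ _ p (steps_phase st)).
by apply/(IH _ _ ud0 Hb); rewrite addrA.
Qed.

Lemma measurable_steps u k b : steps_in (fun _ B => measurable B) b ->
  measurable [set w : path_space R n | steps w u k b].
Proof.
elim: b u k => [|[[d B] k'] b IH] u k /=.
  move=> _; rewrite [X in _ X](_ : _ = [set w : path_space R n | phase w u = Some k]).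
    exact: measurable_phase.
  by apply/seteqP; split => w /= [].
move=> /steps_in_cons[/= mB Hb].
rewrite [X in _ X](_ : _ = [set w : path_space R n | phase w u = Some k] `&`
   ((fun w : path_space R n => level w (u + d) - level w u) @^-1` B `&`
   [set w : path_space R n | steps w (u + d) k' b])) //.
apply: measurableI; first exact: measurable_phase.
apply: measurableI; last exact: IH.
rewrite -[X in measurable X]setTI.
have mf : measurable_fun setT (fun w : path_space R n => level w (u + d) - level w u).
  by apply: measurable_funB; exact: measurable_level.
exact: mf.
Qed.

End Steps.

Section ChainProbability.
Context {R : realType} {n : nat}.
Implicit Types (P : 'I_n -> probability (path_space R n) R) (b acc : seq (@step R n)).

Lemma measurable_start i : measurable [set w : path_space R n | w 0 = Some (0, i)].
Proof.
rewrite [X in _ X](_ : _ = [set w : path_space R n |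
  exists2 x, [set 0] x & w 0 = Some (x, i)]); first exact: measurable_visit.
by apply/seteqP; split => w /=; [exists 0|move=> [_ ->]].
Qed.

Lemma eq_prob_start P i (A A' : set (path_space R n)) : is_MAP P ->
  measurable A -> measurable A' ->
  (forall w : cadlag_path R n, w 0 = Some (0, i) -> (A w <-> A' w)) -> P i A = P i A'.
Proof.
move=> HP mA mA' AA'.
pose S := [set w : path_space R n | w 0 = Some (0, i)].
have mS : measurable S by exact: measurable_start.
have S1 : P i S = 1%E := MAP_start HP i.
have S0 : P i (~` S) = 0%E by rewrite probability_setC// S1 subee.
have cut X : measurable X -> P i X = P i (X `&` S).
  move=> mX; rewrite (measureDI (P i) mX mS) [X in (X + _)%E](_ : _ = 0%E) ?add0e//.
  apply: (subset_measure0 (mu := P i)) S0; [exact: measurableD|exact: measurableC|].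
  by move=> w [].
rewrite (cut A)// (cut A')//; congr (P i _).
by apply/seteqP; split => w [Aw Sw]; split => //; apply/(AA' w Sw).
Qed.

Definition transition P i (d : R) (B : set R) k : \bar R :=
  P i [set w : path_space R n | exists2 x, B x & w d = Some (x, k)].

Fixpoint weight P i b : \bar R :=
  if b is (d, B, k) :: b' then (transition P i d B k * weight P k b')%E else 1%E.

(** The Markov property is applied at the end of the first step. The rest of the chain speaks of
    increments and phases only, hence is an event of the shifted path. *)
Lemma chain_prob P i b (h : R) : is_MAP P ->
  steps_in (fun d B => 0 <= d /\ measurable B) b -> 0 <= h ->
  (P i [set w : path_space R n | steps w 0%R i b /\ w (duration b + h)%R = None] =
   weight P i b * P (last_phase i b) [set w : path_space R n | w h = None])%E.
Proof.
move=> HP + h0; elim: b i => [|[[d B] k] b IH] i.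
  move=> _; rewrite /= mul1e /duration big_nil add0r.
  apply: (eq_prob_start HP); [|exact: measurable_dead|].
    rewrite [X in _ X](_ : _ = [set w : path_space R n | phase w 0 = Some i] `&`
      [set w : path_space R n | w h = None]).
      by apply: measurableI; [exact: measurable_phase|exact: measurable_dead].
    by apply/seteqP; split => w /= [] => [[? _]|] ?.
  by move=> w w0 /=; rewrite w0 /=; split => // -[].
move=> /steps_in_cons[/= [d0 mB] Hb].
have Hm : steps_in (fun _ B => measurable B) b by move=> s /Hb[].
have Hd : steps_in (fun d _ => 0 <= d) b by move=> s /Hb[].
pose A := [set w : cadlag_path R n | exists2 x, B x & w d = Some (x, k)].
pose E := [set w : path_space R n | steps w 0 k b /\ w (duration b + h) = None].
have mE : measurable E.
  rewrite [X in _ X](_ : _ = [set w : path_space R n | steps w 0 k b] `&`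
      [set w : path_space R n | w (duration b + h) = None]) //.
  by apply: measurableI; [exact: measurable_steps|exact: measurable_dead].
have pA : past d A.
  by apply: sub_sigma_algebra; exists d, B, k; rewrite lexx d0; split.
have AE : A `&` [set w | phase w d = Some k] = A.
  apply/seteqP; split => w; first by case.
  by move=> [x Bx wd]; split; [exists x|rewrite /= /phase wd].
have := MAP_markov HP i k d0 pA mE; rewrite AE IH// /transition -/A muleA => <-.
have dur0 : 0 <= duration b + h by rewrite addr_ge0// (duration_ge0 Hb).
have SE : A `&` shift_path d @^-1` E = [set w : path_space R n |
    exists2 x, B x & w d = Some (x, k)] `&` ([set w : path_space R n | steps w d k b] `&`
    [set w : path_space R n | w (d + duration b + h) = None]).
  apply/seteqP; split => w [[x Bx wd]]; rewrite /E /=.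
    move=> -[/(steps_shift k (lexx 0) wd Hd)]; rewrite addr0 => st.
    rewrite /shift_fun ltNge dur0 /= wd => sh; split; first by exists x.
    by split => //; move: sh; rewrite -addrA; case: (w _) => [[]|].
  move=> [st wn]; split; first by exists x.
  split; first by apply/(steps_shift k (lexx 0) wd Hd); rewrite addr0.
  by rewrite /shift_fun ltNge dur0 /= wd addrA wn.
rewrite SE duration_cons /=.
have mA : measurable [set w : path_space R n | exists2 x, B x & w d = Some (x, k)].
  exact: measurable_visit.
apply: (eq_prob_start HP).
- rewrite [X in _ X](_ : _ = [set w : path_space R n | steps w 0 i ((d, B, k) :: b)] `&`
      [set w : path_space R n | w (d + duration b + h) = None]) //.
  apply: measurableI; last exact: measurable_dead.
  by apply: measurable_steps; apply/steps_in_cons.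
- apply: measurableI => //; apply: measurableI; last exact: measurable_dead.
  exact: measurable_steps.
- move=> w w0 /=; rewrite w0 add0r /= subr0; split.
    move=> [[_ [Bd st]] wn]; split => //.
    by have /state_eta wd := steps_phase st; exists (slevel (w d)).
  by move=> [[x Bx wd] [st wn]]; split => //; split => //; rewrite wd.
Qed.

(** Each use of duality moves the factor [pi] one phase further and turns one kernel around, which
    is then pushed onto the accumulator. *)
Lemma weight_reversal P Phat (pi : 'I_n -> R) i b acc :
  (forall d B i j, 0 <= d -> measurable B ->
    ((pi i)%:E * transition P i d B j = (pi j)%:E * transition Phat j d B i)%E) ->
  steps_in (fun d B => 0 <= d /\ measurable B) b ->
  ((pi i)%:E * weight P i b * weight Phat i acc =
   (pi (last_phase i b))%:E * weight Phat (last_phase i b) (rev_steps i b acc))%E.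
Proof.
move=> dual; elim: b i acc => [|[[d B] k] b IH] i acc; first by rewrite /= mule1.
move=> /steps_in_cons[/= [d0 mB] Hb].
rewrite [last_phase i _]/last_phase /= -/(last_phase k b) -IH//= muleA dual//.
by rewrite -!muleA; congr (_ * _)%E; rewrite muleCA.
Qed.

End ChainProbability.

(** * Reversal on a grid *)

Section StepLimits.
Context {R : realType} {n : nat}.
Implicit Types (f : R -> state R n) (b : seq (@step R n)) (k : 'I_n) (u : R).

Lemma close_sphase e (s s' : state R n) : close e s s' -> sphase s = sphase s'.
Proof. by case: s s' => [[x i]|] [[y j]|] //= [_ ->]. Qed.

Lemma close_slevel e (s s' : state R n) : 0 < e -> close e s s' ->
  `|slevel s - slevel s'| < e.
Proof. by case: s s' => [[x i]|] [[y j]|] //= e0; [case|rewrite subrr normr0]. Qed.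

Variables (f : R -> state R n) (f_ : nat -> R -> state R n).
Hypothesis f_cvg : forall u e, 0 <= u -> 0 < e ->
  \forall N \near \oo, close e (f u) (f_ N u).

Lemma near_sphase u : 0 <= u -> \forall N \near \oo, sphase (f_ N u) = sphase (f u).
Proof.
move=> u0; near=> N; apply/esym; apply: (@close_sphase 1).
by near: N; exact: f_cvg.
Unshelve. all: by end_near. Qed.

Lemma near_open_increment u d (B : set R) : 0 <= u -> 0 <= d -> open B ->
  B (slevel (f (u + d)) - slevel (f u)) ->
  \forall N \near \oo, B (slevel (f_ N (u + d)) - slevel (f_ N u)).
Proof.
move=> u0 d0 oB Bx; have /nbhs_ballP[e /= e0 eB] := open_nbhs_nbhs (conj oB Bx).
have e20 : 0 < e / 2 by lra.
have ud0 : 0 <= u + d by lra.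
near=> N; apply: eB; rewrite /ball /=.
have h1 : `|slevel (f u) - slevel (f_ N u)| < e / 2.
  by apply: close_slevel => //; near: N; exact: f_cvg.
have h2 : `|slevel (f (u + d)) - slevel (f_ N (u + d))| < e / 2.
  by apply: close_slevel => //; near: N; exact: f_cvg.
by move: h1 h2; rewrite !ltr_norml => /andP[? ?] /andP[? ?]; apply/andP; split; lra.
Unshelve. all: by end_near. Qed.

Lemma near_open_steps u k b : 0 <= u -> steps_in (fun d B => 0 <= d /\ open B) b ->
  steps f u k b -> \forall N \near \oo, steps (f_ N) u k b.
Proof.
elim: b u k => [|[[d B] k'] b IH] u k u0 /=.
  by move=> _ [pk _]; near=> N; split => //; rewrite -pk; near: N; exact: near_sphase.
move=> /steps_in_cons[/= [d0 oB] Hb] [pk [Bx st]]; near=> N; split.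
  by rewrite -pk; near: N; exact: near_sphase.
split; first by near: N; exact: near_open_increment.
by near: N; apply: IH => //; rewrite addr_ge0.
Unshelve. all: by end_near. Qed.

(** An increment outside a closed set stays outside under small perturbations, so a constraint
    violated in the limit is eventually violated. *)
Lemma near_closed_steps u k b : 0 <= u -> steps_in (fun d B => 0 <= d /\ closed B) b ->
  ~ steps f u k b -> \forall N \near \oo, ~ steps (f_ N) u k b.
Proof.
elim: b u k => [|[[d B] k'] b IH] u k u0 /=.
  move=> _ H; near=> N => -[pk _]; apply: H; split => //.
  by rewrite -pk; apply/esym; near: N; exact: near_sphase.
move=> /steps_in_cons[/= [d0 cB] Hb] H.
have [pk|pk] := pselect (sphase (f u) = Some k); last first.
  by near=> N => -[pk' _]; apply: pk; rewrite -pk'; apply/esym; near: N; exact: near_sphase.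
have [Bx|Bx] := pselect (B (slevel (f (u + d)) - slevel (f u))); last first.
  have := @near_open_increment u d (~` B) u0 d0 (closed_openC cB) Bx.
  by apply: filterS => N nB [_ [/nB]].
have : ~ steps f (u + d) k' b by move=> st; apply: H.
move=> /(IH _ _ (addr_ge0 u0 d0) Hb); by apply: filterS => N nst [_ [_ /nst]].
Unshelve. all: by end_near. Qed.

End StepLimits.

Section SetConvergence.
Context {R : realType} {d : measure_display} {T : measurableType d}.

Lemma cvg_prob (mu : probability T R) (A_ : nat -> set T) (A : set T) :
  (forall N, measurable (A_ N)) -> measurable A ->
  (forall w, \forall N \near \oo, A_ N w <-> A w) ->
  fine (mu (A_ N)) @[N --> \oo] --> fine (mu A).
Proof.
move=> mA_ mA AA.
have H : ((\int[mu]_w (\1_(A_ N) w)%:E)%E @[N --> \oo] --> (\int[mu]_w (\1_A w)%:E)%E).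
  apply: (@dominated_cvg _ _ _ mu setT measurableT (fun N w => (\1_(A_ N) w)%:E) _ (cst 1%E)) => //.
  - by move=> N; apply/measurable_EFinP; exact: measurable_indic.
  - move=> w _; apply: cvg_near_cst; have := AA w; apply: filterS => N E.
    by rewrite !indicE; congr ((nat_of_bool _)%:R%:E); apply/idP/idP => /set_mem h;
      apply/mem_set; apply/E.
  - exact: finite_measure_integrable_cst.
  - by move=> N w _; rewrite /= indicE lee_fin ger0_norm ?ler0n// lern1 leq_b1.
apply: fine_cvg; rewrite fineK ?fin_num_measure//.
by move: H; under eq_fun do rewrite integral_indic// setIT; rewrite integral_indic// setIT.
Qed.

End SetConvergence.

Section GridEvents.
Context {R : realType} {n : nat}.
Implicit Types (w : cadlag_path R n) (b : seq (@step R n)) (i j : 'I_n).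

(** The added step waits with free increment until the grid point of index [L], so that the chain
    ends exactly where death within one step is asked. *)
Definition grid_steps N L b i : seq (@step R n) :=
  b ++ [:: (L%:R * grid_step R N - duration b, setT, i)].

(** The first condition, which does not involve the path, makes the last waiting time of
    [grid_steps] non-negative. *)
Definition forward_event N L b i j : set (cadlag_path R n) :=
  [set w | duration b <= L%:R * grid_step R N /\
    (steps w 0 j (grid_steps N L b i) /\ w (L%:R * grid_step R N + grid_step R N) = None)].

(** Written as a chain of [w] itself, so that [chain_prob] applies; [backward_eventE] reads it as an
    event of the flipped path. *)
Definition backward_event N L b i j : set (cadlag_path R n) :=
  [set w | duration b <= L%:R * grid_step R N /\
    (steps w 0 i (rev_steps j (grid_steps N L b i) [::]) /\
     w (L%:R * grid_step R N + grid_step R N) = None)].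

Lemma duration_grid_steps N L b i : duration (grid_steps N L b i) = L%:R * grid_step R N.
Proof. by rewrite duration_cat duration_cons /duration big_nil /=; lra. Qed.

Lemma last_phase_grid_steps N L b i j : last_phase j (grid_steps N L b i) = i.
Proof. by rewrite /last_phase /grid_steps map_cat last_cat. Qed.

Lemma forward_eventE N L b i j w : forward_event N L b i j w <->
  [/\ dies_in N L w, duration b <= L%:R * grid_step R N, steps w 0 j b &
      phase w (L%:R * grid_step R N) = Some i].
Proof.
rewrite /forward_event /dies_in /= -natr1 mulrDl mul1r /grid_steps.
split; last first.
  move=> [[? ?] ? ? ?]; split => //; split => //; apply/steps_rcons; split => //.
  by rewrite (_ : 0 + _ = L%:R * grid_step R N)//; lra.
move=> [? [/steps_rcons[?]]].
rewrite (_ : 0 + _ = L%:R * grid_step R N); last lra.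
move=> p ?; split => //; split => // E; by move: p; rewrite E.
Qed.

Lemma backward_eventE N L b i j w : backward_event N L b i j w <->
  [/\ dies_in N L w, duration b <= L%:R * grid_step R N,
      steps (flip_at w (L%:R * grid_step R N)) 0 j b & phase w 0 = Some i].
Proof.
rewrite /backward_event /dies_in /= -natr1 mulrDl mul1r.
set t := L%:R * grid_step R N.
have H := steps_flip w t (level w t) 0 j (grid_steps N L b i) [::].
rewrite last_phase_grid_steps duration_grid_steps -/t subr0 subrr /= in H.
have phase_flip v l : sphase (flip_at w t v) = Some l <-> sphase (w (t - v)) = Some l.
  by rewrite /flip_at; case: (w (t - v)) => [[y m]|].
have e0 : 0 + (duration b + (t - duration b)) = t by lra.
split.
  move=> [dt [/H[/steps_rcons[st]]]]; rewrite e0 -/(flip_at w t t).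
  move=> /phase_flip; rewrite subrr => p0 [pj _] wn; split => //.
  by split => // E; move: pj; rewrite E.
move=> [[wt wn] dt st p0]; split => //; split => //; apply/H; split.
  apply/steps_rcons; split => //; rewrite e0 -/(flip_at w t t); apply/phase_flip.
  by rewrite subrr.
by have /phase_flip := steps_phase st; rewrite subr0.
Qed.

Lemma grid_event_measurable N L b i j (A : set (path_space R n)) (c : seq (@step R n)) k :
  steps_in (fun _ B => measurable B) c ->
  A = [set w : path_space R n | duration b <= L%:R * grid_step R N /\
    (steps w 0 k c /\ w (L%:R * grid_step R N + grid_step R N) = None)] -> measurable A.
Proof.
move=> mc ->; have [h|h] := boolP (duration b <= L%:R * grid_step R N).
  rewrite [X in _ X](_ : _ = [set w : path_space R n | steps w 0 k c] `&`
      [set w : path_space R n | w (L%:R * grid_step R N + grid_step R N) = None]).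
    by apply: measurableI; [exact: measurable_steps|exact: measurable_dead].
  by apply/seteqP; split => w [] // ? [].
rewrite [X in _ X](_ : _ = set0); first exact: measurable0.
by apply/seteqP; split => w //= [].
Qed.

Lemma grid_steps_in Q N L b i : steps_in Q b ->
  Q (L%:R * grid_step R N - duration b) setT -> steps_in Q (grid_steps N L b i).
Proof. by move=> Qb QT; apply: steps_in_cat => // s [<-|[]]. Qed.

Lemma measurable_forward_event N L b i j : steps_in (fun _ B => measurable B) b ->
  measurable (forward_event N L b i j : set (path_space R n)).
Proof.
move=> mb; apply: (@grid_event_measurable N L b i j _ (grid_steps N L b i) j) => //.
exact: grid_steps_in.
Qed.

Lemma measurable_backward_event N L b i j : steps_in (fun _ B => measurable B) b ->
  measurable (backward_event N L b i j : set (path_space R n)).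
Proof.
move=> mb; apply: (@grid_event_measurable N L b i j _
  (rev_steps j (grid_steps N L b i) [::]) i) => //.
by apply: steps_in_rev => //; exact: grid_steps_in.
Qed.

Definition forward_union N b i j := \bigcup_L forward_event N L b i j.
Definition backward_union N b i j := \bigcup_L backward_event N L b i j.

Lemma forward_union_lifetime N b i j w z : lifetime w = z%:E -> 0 < z ->
  forward_union N b i j w <-> [/\ duration b <= (death_index N z)%:R * grid_step R N,
    steps w 0 j b & phase w ((death_index N z)%:R * grid_step R N) = Some i].
Proof.
move=> Ez z0; have D := dies_in_death_index N Ez z0; split.
  move=> [L _ /forward_eventE[DL ? ? ?]].
  by rewrite (dies_in_unique D DL).
by move=> [? ? ?]; exists (death_index N z) => //; apply/forward_eventE.
Qed.

Lemma backward_union_lifetime N b i j w z : lifetime w = z%:E -> 0 < z ->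
  backward_union N b i j w <->
    steps (flip_at w ((death_index N z)%:R * grid_step R N)) 0 j b /\ phase w 0 = Some i.
Proof.
move=> Ez z0; have D := dies_in_death_index N Ez z0; split.
  move=> [L _ /backward_eventE[DL ? ? ?]].
  by rewrite (dies_in_unique D DL).
move=> [st p0]; exists (death_index N z) => //; apply/backward_eventE; split => //.
(* The bound on the duration is automatic: the flipped path is alive at time [duration b], so [w] is
   read there at a non-negative time. *)
have := steps_alive st; rewrite /flip_at add0r.
case E : (w _) => [s|] // _; rewrite -subr_ge0; apply: alive_ge0 (w) _ _.
by rewrite E.
Qed.

Lemma forward_union_dies N b i j w : forward_union N b i j w ->
  exists2 z, 0 < z & lifetime w = z%:E.
Proof.
by move=> [L _ /forward_eventE[/dies_in_lifetime[z z0 [Ez _]] _ _ _]]; exists z.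
Qed.

Lemma backward_union_dies N b i j w : backward_union N b i j w ->
  exists2 z, 0 < z & lifetime w = z%:E.
Proof.
by move=> [L _ /backward_eventE[/dies_in_lifetime[z z0 [Ez _]] _ _ _]]; exists z.
Qed.

Lemma J_before_death_lifetime i w : J_before_death i w ->
  exists2 z, 0 < z & lifetime w = z%:E.
Proof.
move=> /J_before_deathE; rewrite /= /reverse_fun; case: (lifetime w) => [z||] //.
by rewrite lexx /=; case: ifP => // z0 _; exists z.
Qed.

Lemma near_death_phase w z i : lifetime w = z%:E -> 0 < z ->
  \forall N \near \oo,
   (phase w ((death_index N z)%:R * grid_step R N) = Some i <-> J_before_death i w).
Proof.
move=> Ez z0; have := @reverse_approx R n w z 0 1 Ez z0 (lexx 0) ltr01.
apply: filterS => N /close_sphase; rewrite /flip_at subr0 => E.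
rewrite -> J_before_deathE, E; rewrite /phase.
by case: (w _) => [[x k]|].
Qed.

(** The path is alive at the end of its steps, so [duration b] lies strictly before the life time
    and fine grids see all of them. The grid then enters only through the phase just before death,
    hence arbitrary increment sets are allowed. *)
Lemma near_forward_union b i j w : steps_in (fun d _ => 0 <= d) b ->
  \forall N \near \oo,
   (forward_union N b i j w <-> steps w 0 j b /\ J_before_death i w).
Proof.
move=> Hb; have [[z z0 Ez]|nz] := pselect (exists2 z, 0 < z & lifetime w = z%:E); last first.
  near=> N; split; first by move/forward_union_dies.
  by move=> [_ /J_before_death_lifetime].
have [st|nst] := pselect (steps w 0 j b); last first.
  by near=> N; split; [move/(forward_union_lifetime _ _ _ _ Ez z0) => []|case].
have dz : duration b < z.
  by apply: (alive_lt_lifetime Ez); have := steps_alive st; rewrite add0r.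
near=> N.
have E : phase w ((death_index N z)%:R * grid_step R N) = Some i <-> J_before_death i w.
  by near: N; exact: near_death_phase.
split; first by move/(forward_union_lifetime _ _ _ _ Ez z0) => [_ _ /E].
move=> [_ /E p]; apply/(forward_union_lifetime _ _ _ _ Ez z0); split => //.
have := death_index_ge N z0; rewrite -natr1 mulrDl mul1r.
have : grid_step R N < z - duration b by near: N; apply: near_grid_step; lra.
by lra.
Unshelve. all: by end_near. Qed.

Lemma near_backward_union_open b i j w : steps_in (fun d B => 0 <= d /\ open B) b ->
  steps (reverse_path w) 0 j b /\ phase w 0 = Some i ->
  \forall N \near \oo, backward_union N b i j w.
Proof.
move=> Hb [st p0]; have /J_before_deathE/J_before_death_lifetime[z z0 Ez] := steps_phase st.
have := near_open_steps (fun u e => @reverse_approx R n w z u e Ez z0) (lexx 0) Hb st.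
by apply: filterS => N stN; apply/(backward_union_lifetime _ _ _ _ Ez z0).
Qed.

Lemma near_backward_union_closed b i j w : steps_in (fun d B => 0 <= d /\ closed B) b ->
  ~ (steps (reverse_path w) 0 j b /\ phase w 0 = Some i) ->
  \forall N \near \oo, ~ backward_union N b i j w.
Proof.
move=> Hb H; have [[z z0 Ez]|nz] := pselect (exists2 z, 0 < z & lifetime w = z%:E); last first.
  by near=> N => /backward_union_dies.
have [p0|p0] := pselect (phase w 0 = Some i); last first.
  by near=> N => /(backward_union_lifetime _ _ _ _ Ez z0)[].
have nst : ~ steps (reverse_path w) 0 j b by move=> st; apply: H.
have := near_closed_steps (fun u e => @reverse_approx R n w z u e Ez z0) (lexx 0) Hb nst.
by apply: filterS => N stN /(backward_union_lifetime _ _ _ _ Ez z0)[].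
Unshelve. all: by end_near. Qed.

Lemma trivIset_dies_in N (A : nat -> set (cadlag_path R n)) :
  (forall L w, A L w -> dies_in N L w) -> trivIset setT A.
Proof.
by move=> AD L L' _ _ [w [/AD D /AD D']]; exact: dies_in_unique D D'.
Qed.

End GridEvents.

Section Duality.
Context {R : realType} {n : nat}.
Variables (P Phat : 'I_n -> probability (path_space R n) R) (pi : 'I_n -> R).
Hypothesis (P_MAP : is_MAP P) (Phat_MAP : is_MAP Phat).
Hypothesis dual : forall d (B : set R) i j, 0 <= d -> measurable B ->
  ((pi i)%:E * transition P i d B j = (pi j)%:E * transition Phat j d B i)%E.
Implicit Types (b : seq (@step R n)) (i j : 'I_n).

Let Pdead i N := P i [set w : path_space R n | w (grid_step R N) = None].
Let Pdead_hat i N := Phat i [set w : path_space R n | w (grid_step R N) = None].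

Lemma grid_duality N L b i j : steps_in (fun d B => 0 <= d /\ measurable B) b ->
  ((pi i)%:E * (Pdead_hat i N * P i (backward_event N L b i j)) =
   (pi j)%:E * (Pdead j N * Phat j (forward_event N L b i j)))%E.
Proof.
move=> Hb; have [dL|dL] := boolP (duration b <= L%:R * grid_step R N); last first.
  rewrite (_ : backward_event N L b i j = set0).
    rewrite (_ : forward_event N L b i j = set0) ?measure0 ?mule0//.
    by apply/seteqP; split => w // -[h _]; move: dL; rewrite h.
  by apply/seteqP; split => w // -[h _]; move: dL; rewrite h.
have h0 := grid_step_gt0 R N.
have Hg : steps_in (fun d B => 0 <= d /\ measurable B) (grid_steps N L b i).
  by apply: grid_steps_in => //; split => //; rewrite subr_ge0.
have -> : backward_event N L b i j = [set w : path_space R n |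
    steps w 0 i (rev_steps j (grid_steps N L b i) [::]) /\
    w (duration (rev_steps j (grid_steps N L b i) [::]) + grid_step R N) = None].
  rewrite duration_rev duration_grid_steps /duration big_nil addr0.
  by apply/seteqP; split => w // [].
have -> : forward_event N L b i j = [set w : path_space R n |
    steps w 0 j (grid_steps N L b i) /\
    w (duration (grid_steps N L b i) + grid_step R N) = None].
  by rewrite duration_grid_steps; apply/seteqP; split => w // [].
rewrite !chain_prob ?(ltW h0)//; last by apply: steps_in_rev.
(* The roles are exchanged: the chain of [Phat] from [j] is turned into the chain of [P] from
   [i]. *)
have /= := @weight_reversal R n Phat P pi j (grid_steps N L b i) [::] _ Hg.
rewrite mule1 last_phase_grid_steps => W.
have lp : last_phase i (rev_steps j (grid_steps N L b i) [::]) = j.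
  by have := last_phase_rev j (grid_steps N L b i) [::]; rewrite last_phase_grid_steps.
rewrite lp [(Pdead_hat i N * _)%E]muleCA !muleA -W; last first.
  by move=> d B k l d0 mB; rewrite dual.
rewrite /Pdead_hat /Pdead -!muleA; congr (_ * _)%E; rewrite [RHS]muleC -!muleA.
by congr (_ * _)%E; rewrite muleC.
Qed.

Lemma union_duality N b i j : steps_in (fun d B => 0 <= d /\ measurable B) b ->
  pi i * fine (Pdead_hat i N) * fine (P i (backward_union N b i j)) =
  pi j * fine (Pdead j N) * fine (Phat j (forward_union N b i j)).
Proof.
move=> Hb; have mb : steps_in (fun _ B => measurable B) b by move=> s /Hb[].
have mB L := measurable_backward_event N L i j mb.
have mF L := measurable_forward_event N L i j mb.
have tB : trivIset setT (fun L => backward_event N L b i j).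
  by apply: (@trivIset_dies_in R n N) => L w /backward_eventE[].
have tF : trivIset setT (fun L => forward_event N L b i j).
  by apply: (@trivIset_dies_in R n N) => L w /forward_eventE[].
apply: EFin_inj; rewrite !EFinM !fineK ?fin_num_measure//;
  try exact: bigcupT_measurable; try exact: measurable_dead.
rewrite /backward_union /forward_union.
rewrite measure_semi_bigcup//; last exact: bigcupT_measurable.
rewrite measure_semi_bigcup//; last exact: bigcupT_measurable.
have fh : Pdead_hat i N \is a fin_num by rewrite fin_num_measure//; exact: measurable_dead.
have f : Pdead j N \is a fin_num by rewrite fin_num_measure//; exact: measurable_dead.
rewrite -(fineK fh) -(fineK f) -!EFinM -!nneseriesZl//.
by apply: eq_eseriesr => L _; rewrite !EFinM !fineK// -!muleA; exact: grid_duality.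
Qed.

End Duality.

(** * Duality for increments *)

Section RayLists.
Context {R : realType} {n : nat}.
Implicit Types (f : R -> state R n) (l : seq (@step R n)) (a : nat -> option R).

(** [None] leaves an increment free: it puts the whole space into the pi-system and allows a single
    increment to be isolated. *)
Definition open_ray (o : option R) : set R := if o is Some x then [set y | x < y] else setT.
Definition closed_ray p (o : option R) : set R :=
  if o is Some x then [set y | x + grid_step R p <= y] else setT.

(** Waiting times and phases of [l] stay fixed while the bounds [a] vary; intersections then amount
    to maxima of bounds. *)
Fixpoint with_rays (ray : option R -> set R) l a : seq (@step R n) :=
  if l is (d, _, k) :: l' then (d, ray (a 0%N), k) :: with_rays ray l' (a \o S) else [::].

Lemma steps_in_rays (Q Q' : R -> set R -> Prop) ray l a : steps_in Q l ->
  (forall d B o, Q d B -> Q' d (ray o)) -> steps_in Q' (with_rays ray l a).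
Proof.
move=> + QQ; elim: l a => [|[[d B] k] l IH] a /=; first by move=> _ s [].
by move=> /steps_in_cons[/= Qd Ql]; apply/steps_in_cons; split; [exact: QQ Qd|exact: IH].
Qed.

Lemma open_rayP o : open (open_ray o).
Proof. by case: o => [x|] /=; [exact: open_gt|exact: openT]. Qed.

Lemma closed_rayP p o : closed (closed_ray p o).
Proof. by case: o => [x|] /=; [exact: closed_ge|exact: closedT]. Qed.

Lemma measurable_open_ray o : measurable (open_ray o).
Proof. by apply: open_measurable; exact: open_rayP. Qed.

Lemma steps_closed_open f u k l a p :
  steps f u k (with_rays (closed_ray p) l a) -> steps f u k (with_rays open_ray l a).
Proof.
elim: l u k a => [//|[[d B] k'] l IH] u k a /= [pk [Bx /IH st]].
split => //; split => //; case: (a 0%N) Bx => //= x; apply: lt_le_trans.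
by rewrite ltrDl grid_step_gt0.
Qed.

Lemma near_closed_open f u k l a : \forall p \near \oo,
  (steps f u k (with_rays (closed_ray p) l a) <-> steps f u k (with_rays open_ray l a)).
Proof.
have [st|nst] := pselect (steps f u k (with_rays open_ray l a)); last first.
  by near=> p; split => // /steps_closed_open.
suff : \forall p \near \oo, steps f u k (with_rays (closed_ray p) l a).
  by apply: filterS => p ?; split.
elim: l u k a st => [|[[d B] k'] l IH] u k a /=; first by move=> ?; near=> p.
move=> [pk [Bx /IH st]]; near=> p; split => //; split; last by near: p.
near: p; case: (a 0%N) Bx => [x|] /= Bx; last by near=> p.
near=> p; rewrite -lerBrDl ltW//; near: p; apply: near_grid_step.
by rewrite subr_gt0.
Unshelve. all: by end_near. Qed.

End RayLists.

Section RayDuality.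
Context {R : realType} {n : nat}.
Variables (P Phat : 'I_n -> probability (path_space R n) R) (pi q : 'I_n -> R).
Hypothesis (P_MAP : is_MAP P) (Phat_MAP : is_MAP Phat).
Hypothesis pi0 : forall i, 0 < pi i.
Hypothesis dual : forall d (B : set R) i j, 0 <= d -> measurable B ->
  ((pi i)%:E * transition P i d B j = (pi j)%:E * transition Phat j d B i)%E.
Hypothesis rate : forall i,
  (fine (P i [set w : path_space R n | w (grid_step R N) = None]) / grid_step R N)
    @[N --> \oo] --> q i.
Hypothesis rate_hat : forall i,
  (fine (Phat i [set w : path_space R n | w (grid_step R N) = None]) / grid_step R N)
    @[N --> \oo] --> q i.
Implicit Types (b : seq (@step R n)) (i j : 'I_n).

Lemma rate_ge0 i : 0 <= q i.
Proof.
have /cvgr_to_ge := @rate i; apply; near=> N.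
by rewrite divr_ge0 ?fine_ge0//; exact/ltW/grid_step_gt0.
Unshelve. all: by end_near. Qed.

Definition reversed_steps j b : set (path_space R n) :=
  [set w : path_space R n | steps (reverse_path w) 0 j b].
Definition dual_steps i j b : set (path_space R n) :=
  [set w : path_space R n | steps w 0 j b /\ J_before_death i w].

Lemma measurable_reversed_steps j b : steps_in (fun _ B => measurable B) b ->
  measurable (reversed_steps j b).
Proof.
move=> mb; have := measurable_reverse measurableT (measurable_steps 0 j mb).
by rewrite setTI.
Qed.

Lemma measurable_dual_steps i j b : steps_in (fun _ B => measurable B) b ->
  measurable (dual_steps i j b).
Proof.
move=> mb; apply: measurableI; first exact: measurable_steps.
exact: measurable_J_before_death.
Qed.

(** The starting phase is recorded because the backward grid events prescribe it; under [P i] it is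
    almost sure. *)
Let A1 i j b : set (path_space R n) :=
  [set w : path_space R n | steps (reverse_path w) 0 j b /\ phase w 0 = Some i].

Let mA1 i j b : steps_in (fun _ B => measurable B) b -> measurable (A1 i j b).
Proof.
move=> mb; apply: measurableI; first exact: measurable_reversed_steps.
exact: measurable_phase.
Qed.

Let A1E i j b : steps_in (fun _ B => measurable B) b ->
  P i (A1 i j b) = P i (reversed_steps j b).
Proof.
move=> mb; apply: (eq_prob_start P_MAP).
- exact: mA1.
- exact: measurable_reversed_steps.
- move=> w w0; rewrite /A1 /reversed_steps /=; split => [[]//|H]; split => //.
  by rewrite /phase w0.
Qed.

Let mU N b i j : steps_in (fun _ B => measurable B) b ->
  measurable (backward_union N b i j : set (path_space R n)).
Proof. by move=> mb; apply: bigcupT_measurable => L; exact: measurable_backward_event. Qed.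

(** The limit is computed on the dual side, where the events converge for all measurable increment
    sets; the backward events themselves may fail to converge. *)
Let limit_duality i j b : steps_in (fun d B => 0 <= d /\ measurable B) b ->
  (pi i * (fine (Phat i [set w : path_space R n | w (grid_step R N) = None]) / grid_step R N)
    * fine (P i (backward_union N b i j)))
  @[N --> \oo] --> pi j * q j * fine (Phat j (dual_steps i j b)).
Proof.
move=> Hb; have mb : steps_in (fun _ B => measurable B) b by move=> s /Hb[].
have db : steps_in (fun d _ => 0 <= d) b by move=> s /Hb[].
have H : (pi j * (fine (P j [set w : path_space R n | w (grid_step R N) = None]) / grid_step R N)
    * fine (Phat j (forward_union N b i j)))
  @[N --> \oo] --> pi j * q j * fine (Phat j (dual_steps i j b)).
  apply: cvgM.
    by apply: cvgM; [exact: cvg_cst|exact: rate].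
  apply: cvg_prob.
  - move=> N; apply: bigcupT_measurable => L; exact: measurable_forward_event.
  - exact: measurable_dual_steps.
  - by move=> w; exact: near_forward_union.
apply: cvg_trans H; apply: near_eq_cvg; near=> N.
have := @union_duality R n P Phat pi P_MAP Phat_MAP dual N b i j Hb.
rewrite !mulrA => U.
by rewrite -[LHS]mulrAC -[RHS]mulrAC U.
Unshelve. all: by end_near. Qed.

(** Backward events eventually contain each path of the limit event. Intersecting them with it
    restores convergence at the price of an inequality. *)
Let open_le i j b : steps_in (fun d B => 0 <= d /\ open B) b ->
  pi i * q i * fine (P i (reversed_steps j b)) <=
  pi j * q j * fine (Phat j (dual_steps i j b)).
Proof.
move=> ob; have Hb : steps_in (fun d B => 0 <= d /\ measurable B) b.
  by move=> s /ob[? ?]; split => //; exact: open_measurable.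
have mb : steps_in (fun _ B => measurable B) b by move=> s /Hb[].
have mI N : measurable (backward_union N b i j `&` A1 i j b : set (path_space R n)).
  by apply: measurableI; [exact: mU|exact: mA1].
have H : (pi i * (fine (Phat i [set w : path_space R n | w (grid_step R N) = None]) / grid_step R N)
    * fine (P i (backward_union N b i j `&` A1 i j b)))
  @[N --> \oo] --> pi i * q i * fine (P i (A1 i j b)).
  apply: cvgM; first by apply: cvgM; [exact: cvg_cst|exact: rate_hat].
  apply: (@cvg_prob _ _ _ (P i) (fun N => backward_union N b i j `&` A1 i j b)) => //.
    exact: mA1.
  move=> w; have [wA|nwA] := pselect (A1 i j b w); last by near=> N; split => // -[].
  have := near_backward_union_open ob wA; apply: filterS => N wN; by split => // -[].
rewrite -A1E//; apply: (ler_cvg_to H (@limit_duality i j b Hb)); near=> N.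
apply: ler_wpM2l.
    by rewrite mulr_ge0 ?(ltW (pi0 _))// divr_ge0 ?fine_ge0//; exact/ltW/grid_step_gt0.
  apply: fine_le; rewrite ?fin_num_measure//; first exact: mU.
  by apply: le_measure; rewrite ?inE//; first exact: mU.
Unshelve. all: by end_near. Qed.

(** Here the backward events eventually exclude each path outside the limit event, so unions take
    the place of intersections and the inequality is reversed. *)
Let closed_ge i j b : steps_in (fun d B => 0 <= d /\ closed B) b ->
  pi j * q j * fine (Phat j (dual_steps i j b)) <=
  pi i * q i * fine (P i (reversed_steps j b)).
Proof.
move=> cb; have Hb : steps_in (fun d B => 0 <= d /\ measurable B) b.
  by move=> s /cb[? ?]; split => //; exact: closed_measurable.
have mb : steps_in (fun _ B => measurable B) b by move=> s /Hb[].
have mI N : measurable (backward_union N b i j `|` A1 i j b : set (path_space R n)).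
  by apply: measurableU; [exact: mU|exact: mA1].
have H : (pi i * (fine (Phat i [set w : path_space R n | w (grid_step R N) = None]) / grid_step R N)
    * fine (P i (backward_union N b i j `|` A1 i j b)))
  @[N --> \oo] --> pi i * q i * fine (P i (A1 i j b)).
  apply: cvgM; first by apply: cvgM; [exact: cvg_cst|exact: rate_hat].
  apply: (@cvg_prob _ _ _ (P i) (fun N => backward_union N b i j `|` A1 i j b)) => //.
    exact: mA1.
  move=> w; have [wA|nwA] := pselect (A1 i j b w); first by near=> N; split => // _; right.
  have := near_backward_union_closed cb nwA; apply: filterS => N wN; split; first by case.
  by move=> ?; right.
rewrite -A1E//; apply: (ler_cvg_to (@limit_duality i j b Hb) H); near=> N.
apply: ler_wpM2l.
    by rewrite mulr_ge0 ?(ltW (pi0 _))// divr_ge0 ?fine_ge0//; exact/ltW/grid_step_gt0.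
  apply: fine_le; rewrite ?fin_num_measure//; first exact: mU.
  by apply: le_measure; rewrite ?inE//; first exact: mU.
Unshelve. all: by end_near. Qed.

Lemma ray_duality i j l a : steps_in (fun d _ => 0 <= d) l ->
  pi i * q i * fine (P i (reversed_steps j (with_rays open_ray l a))) =
  pi j * q j * fine (Phat j (dual_steps i j (with_rays open_ray l a))).
Proof.
move=> Hl.
have ol : steps_in (fun d B => 0 <= d /\ open B) (with_rays open_ray l a).
  by apply: steps_in_rays Hl _ => d _ o d0; split => //; exact: open_rayP.
have cl p : steps_in (fun d B => 0 <= d /\ closed B) (with_rays (closed_ray p) l a).
  by apply: steps_in_rays Hl _ => d _ o d0; split => //; exact: closed_rayP.
have ml : steps_in (fun _ B => measurable B) (with_rays open_ray l a).
  by move=> s /ol[_ ?]; exact: open_measurable.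
have mc p : steps_in (fun _ B => measurable B) (with_rays (closed_ray p) l a).
  by move=> s /(cl p)[_ ?]; exact: closed_measurable.
apply/eqP; rewrite eq_le open_le//=.
(* Only the dual side has to converge as the closed rays fill the open ones; on the other side
   inclusion is enough. *)
have H : pi j * q j * fine (Phat j (dual_steps i j (with_rays (closed_ray p) l a)))
    @[p --> \oo] --> pi j * q j * fine (Phat j (dual_steps i j (with_rays open_ray l a))).
  apply: cvgM; first exact: cvg_cst.
  apply: (@cvg_prob _ _ _ (Phat j) (fun p => dual_steps i j (with_rays (closed_ray p) l a))).
  - by move=> p; exact: measurable_dual_steps.
  - exact: measurable_dual_steps.
  - move=> w; have := near_closed_open w 0 j l a; apply: filterS => p E.
    by rewrite /dual_steps /=; split => -[/E].
move/cvgr_to_le : H; apply; near=> p; apply: le_trans (@closed_ge i j _ (cl p)) _.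
apply: ler_wpM2l; first by rewrite mulr_ge0 ?rate_ge0// (ltW (pi0 _)).
apply: fine_le; rewrite ?fin_num_measure//; try exact: measurable_reversed_steps.
apply: le_measure; rewrite ?inE; try exact: measurable_reversed_steps.
by move=> w; exact: steps_closed_open.
Unshelve. all: by end_near. Qed.

End RayDuality.

(** * From increments to all events *)

Section Increments.
Context {R : realType} {n : nat}.
Implicit Types (w : cadlag_path R n) (l : seq (@step R n)) (a : nat -> option R) (u : R).

Definition no_rays : nat -> option R := fun=> None.

Fixpoint increments w u l a : Prop :=
  if l is (d, _, _) :: l' then
    open_ray (a 0%N) (level w (u + d) - level w u) /\ increments w (u + d) l' (a \o S)
  else True.

Fixpoint positions w u l : Prop :=
  if l is (d, B, _) :: l' then
    B (level w (u + d) - level w 0) /\ positions w (u + d) l'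
  else True.

Lemma steps_increments w u k l a : steps w u k (with_rays open_ray l a) <->
  steps w u k (with_rays open_ray l no_rays) /\ increments w u l a.
Proof.
elim: l u k a => [|[[d B] k'] l IH] u k a /=; first by split => [|[]].
split; first by move=> [? [? /IH[]]].
by move=> [[? [_ ?]] [? ?]]; do 2 split => //; apply/IH.
Qed.

Lemma increments_no_rays w u l : increments w u l no_rays.
Proof. by elim: l u => [//|[[d B] k] l IH] u /=; split => //; exact: IH. Qed.

Definition ray_meet (o o' : option R) : option R :=
  match o, o' with
  | Some x, Some y => Some (Num.max x y)
  | Some x, None => Some x
  | None, _ => o'
  end.

Lemma open_ray_meet o o' : open_ray (ray_meet o o') = open_ray o `&` open_ray o'.
Proof.
case: o o' => [x|] [y|]; rewrite /= ?setIT ?setTI//.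
by apply/seteqP; split => z /=; rewrite gt_max => /andP.
Qed.

Lemma increments_meet w u l a a' :
  increments w u l (fun m => ray_meet (a m) (a' m)) <->
  increments w u l a /\ increments w u l a'.
Proof.
elim: l u a a' => [|[[d B] k] l IH] u a a' /=; first by split.
rewrite open_ray_meet; split; first by move=> [[? ?] /IH[]].
by move=> [[? ?] [? ?]]; split => //; apply/IH.
Qed.

Definition increment_events l : set (set (cadlag_path R n)) :=
  [set A | exists a, A = [set w | increments w 0 l a]].

(* Positions are sums of increments, so they are measurable for any sigma-algebra
   containing the increment events. *)
Lemma measurable_positions (G : set (set (cadlag_path R n))) l u :
  measurable_fun setT (fun w : g_sigma_algebraType G => level w u - level w 0) ->
  (forall a, measurable [set w : g_sigma_algebraType G | increments w u l a]) ->
  steps_in (fun _ B => measurable B) l ->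
  measurable [set w : g_sigma_algebraType G | positions w u l].
Proof.
elim: l u => [|[[d B] k] l IH] u mY mI.
  by move=> _; rewrite [X in _ X](_ : _ = setT).
move=> /steps_in_cons[/= mB ml].
have mD : measurable_fun setT (fun w : g_sigma_algebraType G => level w (u + d) - level w u).
  apply: (measurability _ (RGenOInfty.measurableE R)) => _ [_ [x ->] <-].
  (* Bounding the first increment alone isolates it; leaving it free, further down, isolates the
     remaining ones. *)
  have := mI (fun m => if m is 0%N then Some x else None); rewrite /= setTI.
  congr (measurable _); apply/seteqP; split => w /=; rewrite in_itv /= andbT; first by case.
  by move=> ?; split => //; exact: increments_no_rays.
have mY' : measurable_fun setT (fun w : g_sigma_algebraType G => level w (u + d) - level w 0).
  have -> : (fun w : g_sigma_algebraType G => level w (u + d) - level w 0) =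
      (fun w => (level w (u + d) - level w u) + (level w u - level w 0)).
    by apply/funext => w; rewrite addrA subrK.
  exact: measurable_funD.
rewrite [X in _ X](_ : _ = (fun w : g_sigma_algebraType G => level w (u + d) - level w 0) @^-1` B
  `&` [set w : g_sigma_algebraType G | positions w (u + d) l]) //.
apply: measurableI; first by rewrite -[X in measurable X]setTI; exact: mY'.
apply: IH => // a.
have := mI (fun m => if m is m'.+1 then a m' else None).
congr (measurable _); apply/seteqP; split => w /=; first by case.
by move=> ?; split.
Qed.

Lemma measurable_increments l a : measurable [set w : path_space R n | increments w 0 l a].
Proof.
suff H u : measurable [set w : path_space R n | increments w u l a] by [].
elim: l u a => [|[[d B] k] l IH] u a /=.
  by rewrite [X in _ X](_ : _ = setT).
rewrite [X in _ X](_ : _ = (fun w : path_space R n => level w (u + d) - level w u) @^-1`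
    (open_ray (a 0%N)) `&` [set w : path_space R n | increments w (u + d) l (a \o S)]) //.
apply: measurableI => //; rewrite -[X in measurable X]setTI.
have mf : measurable_fun setT (fun w : path_space R n => level w (u + d) - level w u).
  by apply: measurable_funB; exact: measurable_level.
by apply: mf => //; exact: measurable_open_ray.
Qed.

(** Both measures are restricted to the event that fixes the phases. The restrictions agree on the
    pi-system of increment events, whose sigma-algebra contains the conditions on positions. *)
Lemma steps_positions_unique (m1 m2 : {measure set (path_space R n) -> \bar R}) k l :
  (m1 setT < +oo)%E ->
  (forall a, m1 [set w : path_space R n | steps w 0 k (with_rays open_ray l a)] =
             m2 [set w : path_space R n | steps w 0 k (with_rays open_ray l a)]) ->
  steps_in (fun _ B => measurable B) l ->
  m1 [set w : path_space R n | steps w 0 k (with_rays open_ray l no_rays) /\ positions w 0 l] =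
  m2 [set w : path_space R n | steps w 0 k (with_rays open_ray l no_rays) /\ positions w 0 l].
Proof.
move=> m1oo m12 ml.
pose K := [set w : path_space R n | steps w 0 k (with_rays open_ray l no_rays)].
have mK : measurable K.
  apply: measurable_steps; apply: steps_in_rays ml _ => d B o _.
  exact: measurable_open_ray.
have mG : @increment_events l `<=` @measurable _ (path_space R n).
  by move=> _ [a ->]; exact: measurable_increments.
have KE (Q : cadlag_path R n -> Prop) : [set w : path_space R n |
    steps w 0 k (with_rays open_ray l no_rays) /\ Q w] = [set w : path_space R n | Q w] `&` K.
  by apply/seteqP; split => w [].
have GI : setI_closed (increment_events l).
  move=> _ _ [a ->] [a' ->]; exists (fun m => ray_meet (a m) (a' m)).
  by apply/seteqP; split => w /=; move/increments_meet.
have GT : increment_events l setT.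
  by exists no_rays; apply/seteqP; split => w // _; exact: increments_no_rays.
have agree A : <<s increment_events l>> A -> mrestr m1 mK A = mrestr m2 mK A.
  apply: (@g_sigma_algebra_measure_unique _ R (path_space R n) (increment_events l) mG
    (fun=> setT) _ _ (mrestr m1 mK) (mrestr m2 mK) GI) => //.
  - by apply/seteqP; split => // w _; exists 0%N.
  - move=> _ [a ->]; rewrite /= /mrestr -!KE.
    have := m12 a; congr (_ = _); congr (_ _); apply/seteqP; split => w /=;
      by move/steps_increments.
  - move=> _; rewrite /= /mrestr; apply: le_lt_trans m1oo.
    by apply: le_measure; rewrite ?inE//; exact: measurableI.
have := agree [set w | positions w 0 l]; rewrite /mrestr -!KE; apply.
apply: (@measurable_positions (increment_events l)) => //.
- rewrite (_ : (fun w => _) = cst 0); first exact: measurable_cst.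
  by apply/funext => w /=; rewrite subrr.
- by move=> a; apply: sub_sigma_algebra; exists a.
Qed.

End Increments.

(** * Finite-dimensional events determine measures on paths *)

Section FiniteDimensional.
Context {R : realType} {n : nat}.
Implicit Types (w : cadlag_path R n) (c : seq (@step R n)) (u : R) (k : 'I_n).

Definition visits w (s : @step R n) : Prop :=
  exists2 x, s.1.2 x & w s.1.1 = Some (x, s.2).
Definition visits_all c w : bool := all (fun s => `[< visits w s >]) c.

(** Converts absolute times into the waiting times expected by [steps]. *)
Fixpoint time_steps u c : seq (@step R n) :=
  if c is (t, B, k) :: c' then (t - u, B, k) :: time_steps t c' else [::].

Definition time_le (s s' : @step R n) : bool := s.1.1 <= s'.1.1.

Lemma time_steps_ge0 u c : all (fun s => u <= s.1.1) c -> sorted time_le c ->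
  steps_in (fun d _ => 0 <= d) (time_steps u c).
Proof.
elim: c u => [|[[t B] k] c IH] u /=; first by move=> _ _ s [].
move=> /andP[ut _] sc; apply/steps_in_cons; split; first by rewrite /= subr_ge0.
apply: IH; last exact: path_sorted sc.
by apply: (order_path_min _ sc) => x y z; exact: le_trans.
Qed.

Lemma time_steps_measurable u c : steps_in (fun _ B => measurable B) c ->
  steps_in (fun _ B => measurable B) (time_steps u c).
Proof.
elim: c u => [|[[t B] k] c IH] u /=; first by move=> _ s [].
by move=> /steps_in_cons[/= mB /IH Hc]; apply/steps_in_cons; split => //; exact: Hc.
Qed.

(** [positions] measures levels from the one at time 0 and [visits] absolutely; they coincide for a
    path started at level 0. *)
Lemma visits_all_positions w u k c : level w 0 = 0 -> sphase (w u) = Some k ->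
  visits_all c w <->
  steps w u k (with_rays open_ray (time_steps u c) no_rays) /\ positions w u (time_steps u c).
Proof.
move=> w0; rewrite /visits_all; elim: c u k => [|[[t B] k'] c IH] u k pk /=; first by split.
rewrite (_ : u + (t - u) = t); last lra.
rewrite w0 subr0; split.
  move=> /andP[/asboolP[x /= Bx wt]].
  have pt : sphase (w t) = Some k' by rewrite wt.
  move=> /(IH t k' pt)[st ps]; split => //; split => //.
  by rewrite /level wt.
move=> [[_ [_ st]] [Bt ps]]; have pt := steps_phase st.
apply/andP; split; last exact/(IH t k' pt).
by apply/asboolP; exists (slevel (w t)) => //=; exact: state_eta.
Qed.

(** Times may be unordered or repeated, so that an intersection is a concatenation; sorting is
    deferred to [path_measure_unique]. *)
Definition finite_dim_events : set (set (cadlag_path R n)) :=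
  [set A | exists c, [/\ steps_in (fun t _ => 0 <= t) c, steps_in (fun _ B => measurable B) c &
    A = [set w | visits_all c w]]].

Lemma finite_dim_eventsI : setI_closed finite_dim_events.
Proof.
move=> _ _ [c [c1 c2 ->]] [c' [c1' c2' ->]]; exists (c ++ c'); split.
- exact: steps_in_cat.
- exact: steps_in_cat.
- by apply/seteqP; split => w /=; rewrite /visits_all all_cat => /andP.
Qed.

Lemma finite_dim_borel : <<s finite_dim_events>> = @measurable _ (path_space R n).
Proof.
have mE : @measurable _ (path_space R n) = <<s @cylinders R n>> by exact: borel_cylinderE.
have cylE t (B : set R) k : [set w : cadlag_path R n | visits w (t, B, k)] =
   [set w | exists2 x, B x & w t = Some (x, k)] by [].
apply/seteqP; split.
  rewrite mE; apply: smallest_sub; first exact: smallest_sigma_algebra.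
  move=> _ [c [c1 c2 ->]]; rewrite -mE.
  elim: c c1 c2 => [|[[t B] k] c IH].
    move=> _ _; rewrite [X in _ X](_ : _ = setT); first exact: measurableT.
    by apply/seteqP; split.
  move=> /steps_in_cons[/= t0 c1] /steps_in_cons[/= mB c2].
  rewrite [X in _ X](_ : _ = [set w : path_space R n | visits w (t, B, k)] `&`
     [set w : path_space R n | visits_all c w]).
    apply: measurableI; last exact: IH.
    by rewrite cylE mE; apply: sub_sigma_algebra; exists t, B, k.
  apply/seteqP; split => w /=; rewrite /visits_all /=.
    by move=> /andP[/asboolP ? ?].
  by move=> [? ?]; apply/andP; split => //; apply/asboolP.
rewrite mE; apply: sub_sigma_algebra2 => _ [t [B [k [t0 mB ->]]]].
exists [:: (t, B, k)]; split; [by move=> s [<-|[]]..|].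
rewrite -cylE; apply/seteqP; split => w /=; rewrite /visits_all /= andbT.
  by move=> ?; apply/asboolP.
by move=> /asboolP.
Qed.

(** On paths started at (0, k), which carry both measures, a finite-dimensional event with sorted
    times becomes a condition on steps and positions. *)
Lemma path_measure_unique (m1 m2 : {measure set (path_space R n) -> \bar R}) k :
  (m1 setT < +oo)%E ->
  m1 (~` [set w : path_space R n | w 0 = Some (0, k)]) = 0%E ->
  m2 (~` [set w : path_space R n | w 0 = Some (0, k)]) = 0%E ->
  (forall l a, steps_in (fun d _ => 0 <= d) l ->
    m1 [set w : path_space R n | steps w 0 k (with_rays open_ray l a)] =
    m2 [set w : path_space R n | steps w 0 k (with_rays open_ray l a)]) ->
  forall A : set (path_space R n), measurable A -> m1 A = m2 A.
Proof.
move=> m1oo m10 m20 m12.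
pose S := [set w : path_space R n | w 0 = Some (0, k)].
have mS : measurable S by exact: measurable_start.
have cut (m : {measure set (path_space R n) -> \bar R}) X :
    m (~` S) = 0%E -> measurable X -> m X = m (X `&` S).
  move=> mS0 mX; rewrite (measureDI m mX mS) [X in (X + _)%E](_ : _ = 0%E) ?add0e//.
  apply: (subset_measure0 (mu := m)) mS0; [exact: measurableD|exact: measurableC|].
  by move=> w [].
have mG : finite_dim_events `<=` @measurable _ (path_space R n).
  by rewrite -finite_dim_borel; exact: sub_sigma_algebra.
apply: (@measure_unique _ R (path_space R n) finite_dim_events (fun=> setT)) => //.
- by rewrite finite_dim_borel.
- exact: finite_dim_eventsI.
- move=> _; exists [::]; split; [by move=> s []..|].
  by apply/seteqP; split.
- by apply/seteqP; split => // w _; exists 0%N.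
move=> A GA; have mA := mG _ GA; move: GA => [c [c1 c2 AE]].
pose c' := sort time_le c.
have tot : total time_le by move=> x y; exact: le_total.
have sc : sorted time_le c' by exact: sort_sorted.
have c'1 : all (fun s => 0 <= s.1.1) c'.
  rewrite all_sort; elim: (c) (c1) => [//|s c0 IH] /steps_in_cons[/= -> /IH ->] //.
have c'2 : steps_in (fun _ B => measurable B) c'.
  suff : all (fun s : @step R n => `[< measurable s.1.2 >]) c'.
    elim: (c') => [_ s []//|s c0 IH] /= /andP[/asboolP ms /IH H].
    by apply/steps_in_cons.
  rewrite all_sort; elim: (c) (c2) => [//|s c0 IH] /steps_in_cons[/= ms /IH ->].
  by rewrite andbT; apply/asboolP.
pose l := time_steps 0 c'.
have ml : steps_in (fun _ B => measurable B) l by exact: time_steps_measurable.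
have l0 := time_steps_ge0 c'1 sc.
pose A' := [set w : path_space R n |
  steps w 0 k (with_rays open_ray l no_rays) /\ positions w 0 l].
have mA' : measurable A'.
  have mK : measurable [set w : path_space R n | steps w 0 k (with_rays open_ray l no_rays)].
    apply: measurable_steps; apply: steps_in_rays ml _ => d B o _.
    exact: measurable_open_ray.
  apply: measurableI => //; apply: (@measurable_positions R n (@skorokhod_open R n)) => //.
    by apply: measurable_funB; exact: measurable_level.
  move=> a; exact: measurable_increments.
have AA' : A `&` S = A' `&` S.
  apply/seteqP; split => w [wA w0]; split => //; have ws := w0; rewrite /S /= in ws.
    have := @visits_all_positions w 0 k c'; rewrite /level ws /= => /(_ erefl erefl) H.
    by apply/H; rewrite /visits_all all_sort; move: wA; rewrite AE.
  have := @visits_all_positions w 0 k c'; rewrite /level ws /= => /(_ erefl erefl) H.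
  by rewrite AE /=; move/H : wA; rewrite /visits_all all_sort.
rewrite (cut m1 A)// (cut m2 A)// AA' -(cut m1)// -(cut m2)//.
apply: steps_positions_unique => // a; exact: m12.
Qed.

Lemma ge0_integral_mrestr d (T : measurableType d) (m : {measure set T -> \bar R})
    (D : set T) (mD : measurable D) (F : T -> \bar R) :
  measurable_fun setT F -> (forall x, 0 <= F x)%E ->
  (\int[mrestr m mD]_x F x = \int[m]_(x in D) F x)%E.
Proof.
move=> mF F0.
have mDC : measurable (~` D) by exact: measurableC.
rewrite (@ge0_negligible_integral _ _ _ (mrestr m mD) setT (~` D))//; last first.
  by rewrite /= /mrestr setICl measure0.
rewrite setTD setCK; apply: eq_measure_integral => A mA AD /=.
by rewrite /mrestr; move/setIidPl : AD => ->.
Qed.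

End FiniteDimensional.

(** * Duality at the life time *)

Theorem mainTheorem6 (R : realType) (n : nat)
  (P Phat : 'I_n -> probability (path_space R n) R)
  (Psi : R[i] -> 'M[R[i]]_n) (q : 'cV[R]_n) (pi : 'rV[R]_n)
  (P_MAP : is_MAP P) (P_irr : irreducible_phase P)
  (P_Psi : is_matrix_exponent P Psi)
  (q_rates : killing_rates Psi q) (q_neq0 : q != 0)
  (pi_stat : is_stationary Psi q pi)
  (Phat_MAP : is_MAP Phat)
  (Phat_Psi : is_matrix_exponent Phat (dual_exponent pi Psi))
  (F : path_space R n -> \bar R)
  (F_meas : measurable_fun setT F) (F_ge0 : forall w, (0 <= F w)%E)
  (i j : 'I_n) :
  ((pi 0 i * q i 0)%R%:E *
     \int[P i]_(w in J_before_death j) F (reverse_path w) =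
   (pi 0 j * q j 0)%R%:E *
     \int[Phat j]_(w in J_before_death i) F (kill_path w))%E.
Proof.
have pi0 := stationary_gt0 P_Psi P_irr pi_stat.
have rate k := dead_rate (i := k) P_Psi q_rates.
have rate_hat k := dead_rate (i := k) Phat_Psi (dual_killing_rates P_Psi pi0 pi_stat).
have dual d (B : set R) k l : 0 <= d -> measurable B ->
  ((pi 0 k)%:E * transition P k d B l = (pi 0 l)%:E * transition Phat l d B k)%E.
  by move=> d0 mB; exact: (kernel_duality k l pi0 P_Psi Phat_Psi d0 mB).
have q0 k : 0 <= q k 0 := rate_ge0 (q := fun k => q k 0) rate k.
have mJ k : measurable (J_before_death k : set (path_space R n)).
  exact: measurable_J_before_death.
pose ci : {nonneg R} := NngNum (mulr_ge0 (ltW (pi0 i)) (q0 i)).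
pose cj : {nonneg R} := NngNum (mulr_ge0 (ltW (pi0 j)) (q0 j)).
(* Both sides become integrals of [F] against one measure each: the image under reversal of [P i] on
   J_{zeta-} = j, and [Phat j] on J_{zeta-} = i, with weights pi_i q_i and pi_j q_j. Equality of the
   two measures is then what remains. *)
pose m1' : {measure set (path_space R n) -> \bar R} :=
  mscale ci (pushforward (mrestr (P i) (mJ j)) (@reverse_path R n : path_space R n -> path_space R n)).
pose m1 := m1' (@measurable_reverse R n).
pose m2 : {measure set (path_space R n) -> \bar R} := mscale cj (mrestr (Phat j) (mJ i)).
(* Killing changes nothing: a path is in the cemetery from its life time on, the life time included
   by right-continuity. *)
have killE (w : cadlag_path R n) : kill_path w = w.
  apply: cadlag_path_eq; apply/funext => t; rewrite /= /kill_fun.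
  by case: ltP => // /dead_after ->.
have -> : (\int[Phat j]_(w in J_before_death i) F (kill_path w) =
    \int[Phat j]_(w in J_before_death i) F w)%E.
  by apply: eq_integral => w _; rewrite killE.
have mFr : measurable_fun setT (fun w : path_space R n => F (reverse_path w)).
  exact: (measurableT_comp F_meas (@measurable_reverse R n)).
transitivity (\int[m1]_w F w)%E.
  rewrite /m1 /m1' ge0_integral_mscale//= ge0_integral_pushforward//; last exact: measurable_reverse.
  rewrite preimage_setT; congr (_ * _)%E; apply/esym.
  exact: (ge0_integral_mrestr (P i) (mJ j) mFr).
transitivity (\int[m2]_w F w)%E; last first.
  rewrite /m2 ge0_integral_mscale//=; congr (_ * _)%E.
  exact: (ge0_integral_mrestr (Phat j) (mJ i) F_meas).
apply: eq_measure_integral => A mA _.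
apply: (@path_measure_unique R n m1 m2 j) => //.
- rewrite /m1 /m1' /= /mscale /= /pushforward /mrestr preimage_setT setTI.
  by rewrite ltey_eq fin_numM// fin_num_measure.
- rewrite /m1 /m1' /= /mscale /= /pushforward /mrestr.
  rewrite (_ : _ `&` _ = set0) ?measure0 ?mule0//.
  by apply/seteqP; split => w //= -[nS /reverse_path_start].
- rewrite /m2 /= /mscale /= /mrestr (_ : Phat j _ = 0%E) ?mule0//.
  have mS : measurable [set w : path_space R n | w 0 = Some (0, j)].
    exact: measurable_start.
  have S0 : Phat j (~` [set w : path_space R n | w 0 = Some (0, j)]) = 0%E.
    by rewrite probability_setC// (MAP_start Phat_MAP) subee.
  apply: (subset_measure0 (mu := Phat j)) S0; last exact: subIsetl.
    by apply: measurableI => //; exact: measurableC.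
  exact: measurableC.
- move=> l a l0; have ml : steps_in (fun _ B => measurable B) (with_rays open_ray l a).
    by apply: steps_in_rays l0 _ => d B o _; exact: measurable_open_ray.
  have := ray_duality P_MAP Phat_MAP pi0 dual rate rate_hat i j a l0.
  rewrite /m1 /m1' /m2 /= /mscale /= /pushforward /mrestr => H.
  (* Steps of the reversed path that start in phase [j] already force J_{zeta-} = j. *)
  have -> : (@reverse_path R n @^-1` [set w | steps w 0 j (with_rays open_ray l a)] `&`
      J_before_death j) = reversed_steps j (with_rays open_ray l a).
    apply/seteqP; split => w; first by case.
    by move=> st; split => //; apply/J_before_deathE; exact: steps_phase st.
  have f1 := fin_num_measure (P i) _ (measurable_reversed_steps j ml).
  have f2 := fin_num_measure (Phat j) _ (measurable_dual_steps i j ml).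
  by rewrite -(fineK f1) -(fineK f2) -!EFinM H.
Qed.
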